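(* Let $\alpha\colon\mathbb{Z}_+^n\to\mathrm{End}(A)$ be a unital C*-dynamical system, and let $\sigma\colon\mathbb{R}\to\mathrm{Aut}(\mathcal{NT}(A,\alpha))$ be the action $\sigma_t=\gamma_{(\exp(i\lambda_1t),\dots,\exp(i\lambda_nt))}$ related to $\lambda=(\lambda_1,\dots,\lambda_n)\in\mathbb{R}^n$. Then a state $\psi$ of $\mathcal{NT}(A,\alpha)$ is a ground state if and only if there is a state $\tau$ of $A$ such that for all $a\in A$ and $x,y\in\mathbb{Z}_+^n$ $$\psi(V_xaV_y^* )=\begin{cases}\tau(a)&\text{for }x=0=y,\\0&\text{otherwise.}\end{cases}$$ Consequently, there is an affine homeomorphism from the state space $S(A)$ onto the ground states on $\mathcal{NT}(A,\alpha)$.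
   Context: A C*-dynamical system over $\mathbb{Z}_+^n$ is a semigroup action $\alpha\colon\mathbb{Z}_+^n\to\mathrm{End}(A)$ by $*$-endomorphisms of a C*-algebra $A$; it is unital if $A$ is unital and every $\alpha_x$ is unital. Let $\mathbf{e}_1,\dots,\mathbf{e}_n$ be the standard generators of $\mathbb{Z}_+^n$; write $V_i=V_{\mathbf{e}_i}$, $\alpha_i=\alpha_{\mathbf{e}_i}$. An isometric Nica covariant pair $(\pi,V)$ on a Hilbert space $H$ consists of a $*$-representation $\pi\colon A\to\mathcal{B}(H)$ and a semigroup homomorphism $V$ of $\mathbb{Z}_+^n$ into the isometries on $H$ with $V_iV_j^*=V_j^*V_i$ for $i\neq j$, such that $\pi(a)V_i=V_i\pi(\alpha_i(a))$ for all $a\in A$ and all $i$. The Toeplitz-Nica-Pimsner algebra $\mathcal{NT}(A,\alpha)$ is the universal C*-algebra generated by the elements $V_x\pi(a)$ ($x\in\mathbb{Z}_+^n$, $a\in A$) over all such pairs. $A$ embeds isometrically (write $a$ for $\pi(a)$), $1\in A$ is the unit of $\mathcal{NT}(A,\alpha)$, and the elements $V_xaV_y^*$ span a dense $*$-subalgebra. The gauge action $\gamma$ of $\mathbb{T}^n$ is $\gamma_z(V_xaV_y^* )=z_1^{x_1-y_1}\cdots z_n^{x_n-y_n}V_xaV_y^*$. For an action $\sigma$ of $\mathbb{R}$ on a C*-algebra $\mathcal{A}$, an element $b$ is analytic if $t\mapsto\sigma_t(b)$ extends to an entire function $z\mapsto\sigma_z(b)$. A state $\psi$ of $\mathcal{A}$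 is a ground state if the function $z\mapsto\psi(a\sigma_z(b))$ is bounded on $\{z\in\mathbb{C}:\mathrm{Im}\,z>0\}$ for all $a,b$ in a dense set of analytic elements of $\mathcal{A}$.
   Formalization: The formal statement assumes λ_i > 0 for every i instead of arbitrary λ in R^n; if some λ_i ≤ 0 and A ≠ 0 the stated equivalence is false (e.g. A = C, n = 1, λ = 0, where every state is a ground state). *)

(* Defs.v *)
From HB Require Import structures.
From mathcomp Require Import all_boot all_order all_algebra.
From mathcomp Require Import complex.
From mathcomp Require Import all_classical all_reals all_analysis.
Set Implicit Arguments.
Unset Strict Implicit.
Unset Printing Implicit Defensive.
Import Order.TTheory GRing.Theory Num.Theory.
Import numFieldNormedType.Exports.
Local Open Scope classical_set_scope.
Local Open Scope ring_scope.
Local Open Scope complex_scope.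

(* The norm of a normed module over R[i] is R[i]-valued, and z <= w in R[i]
   means that w - z is a nonnegative real. *)

(* MathComp has no join of its rings with its normed modules (other than number
   domains), so the product is a field of the mixin.  The zero algebra, in which
   cone = 0, is allowed. *)
HB.mixin Record isUnitalCStarAlgebra (R : realType) A
    of CompleteNormedModule R[i] A := {
  cone : A;
  cmul : A -> A -> A;
  star : A -> A;
  cmulA : forall a b c : A, cmul a (cmul b c) = cmul (cmul a b) c;
  cmul1l : forall a : A, cmul cone a = a;
  cmul1r : forall a : A, cmul a cone = a;
  cmul_linearl : forall (k : R[i]) (a b c : A),
    cmul (k *: a + b) c = k *: cmul a c + cmul b c;
  cmul_linearr : forall (k : R[i]) (a b c : A),
    cmul a (k *: b + c) = k *: cmul a b + cmul a c;
  starK : forall a : A, star (star a) = a;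
  starM : forall a b : A, star (cmul a b) = cmul (star b) (star a);
  star_semilinear : forall (k : R[i]) (a b : A),
    star (k *: a + b) = k^* *: star a + star b;
  cnormM : forall a b : A, `|cmul a b| <= `|a| * `|b|;
  cstar_identity : forall a : A, `|cmul (star a) a| = `|a| ^+ 2
}.

#[short(type="unitalCStarAlgType")]
HB.structure Definition UnitalCStarAlgebra (R : realType) :=
  {A of isUnitalCStarAlgebra R A & CompleteNormedModule R[i] A}.

Notation "a ** b" := (cmul a b) (at level 40, left associativity) : ring_scope.

HB.mixin Record isHilbertSpace (R : realType) H
    of CompleteNormedModule R[i] H := {
  inner : {dot H for (@conjc R)};
  inner_norm : forall u : H, inner u u = `|u| ^+ 2
}.

#[short(type="hilbertType")]
HB.structure Definition HilbertSpace (R : realType) :=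
  {H of isHilbertSpace R H & CompleteNormedModule R[i] H}.


Section CStarNotions.
Variable R : realType.
Implicit Types A B : unitalCStarAlgType R.

Record star_hom A B (f : A -> B) : Prop := {
  star_hom_linear : linear f;
  star_homM : forall a b, f (a ** b) = f a ** f b;
  star_hom_star : forall a, f (star a) = star (f a)
}.

Definition star_automorphism A (f : A -> A) : Prop := star_hom f /\ bijective f.

Record is_state A (f : A -> R[i]) : Prop := {
  state_linear : scalar f;
  state_positive : forall a, 0 <= f (star a ** a);
  state1 : f cone = 1
}.

Definition is_adjoint (H : hilbertType R) (T S : H -> H) : Prop :=
  forall u v : H, inner (T u) v = inner u (S v).

(* Not assumed nondegenerate. *)
Record star_rep A (H : hilbertType R) (pi : A -> H -> H) : Prop := {
  star_rep_opL : forall a, linear (pi a);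
  star_rep_opC : forall a, continuous (pi a);
  star_rep_linear : forall (k : R[i]) (a b : A) (u : H),
    pi (k *: a + b) u = k *: pi a u + pi b u;
  star_repM : forall (a b : A) (u : H), pi (a ** b) u = pi a (pi b u);
  star_rep_star : forall a, is_adjoint (pi a) (pi (star a))
}.

Definition isometry_op (H : hilbertType R) (T : H -> H) : Prop :=
  linear T /\ forall u : H, `|T u| = `|u|.

Definition entire_extension A (sigma : R -> A -> A) (b : A) (F : R[i]^o -> A) : Prop :=
  (forall t : R, F t%:C = sigma t b) /\ forall z : R[i], derivable F z 1.

Definition analytic A (sigma : R -> A -> A) (b : A) : Prop :=
  exists F, entire_extension sigma b F.

Definition ground_state A (sigma : R -> A -> A) (psi : A -> R[i]) : Prop :=
  is_state psi /\
  exists D : set A, [/\ dense D, D `<=` [set b | analytic sigma b] &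
    forall a b, D a -> D b ->
    forall F, entire_extension sigma b F ->
    exists M : R[i], forall z : R[i], 0 < complex.Im z -> `|psi (a ** F z)| <= M].

End CStarNotions.

Section ToeplitzNicaPimsner.
Variables (R : realType) (n : nat) (A : unitalCStarAlgType R).

Local Notation Zn := {ffun 'I_n -> nat}.

Definition generator (i : 'I_n) : Zn := [ffun j => nat_of_bool (j == i)].

Record unital_dynamical_system (alpha : Zn -> A -> A) : Prop := {
  dynsys_hom : forall x, star_hom (alpha x);
  dynsys_unital : forall x, alpha x cone = cone;
  dynsys0 : forall a, alpha 0 a = a;
  dynsysD : forall x y a, alpha (x + y) a = alpha x (alpha y a)
}.

Record nica_covariant_pair (alpha : Zn -> A -> A) (H : hilbertType R)
    (pi : A -> H -> H) (V : Zn -> H -> H) : Prop := {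
  nica_rep : star_rep pi;
  nica_isometry : forall x, isometry_op (V x);
  nica_V0 : forall u, V 0 u = u;
  nica_VD : forall x y u, V (x + y) u = V x (V y u);
  nica_commute : forall i j : 'I_n, i != j ->
    exists2 Vj_adj : H -> H, is_adjoint (V (generator j)) Vj_adj &
      forall u, V (generator i) (Vj_adj u) = Vj_adj (V (generator i) u);
  nica_covariant : forall (a : A) (i : 'I_n) (u : H),
    pi a (V (generator i) u) = V (generator i) (pi (alpha (generator i) a) u)
}.

(* The representation Phi of NT determined by the pair (pi, V), where gen x a
   is the abstract generator V_x a *)
Definition integrated_form (NT : unitalCStarAlgType R) (gen : Zn -> A -> NT)
    (H : hilbertType R) (pi : A -> H -> H) (V : Zn -> H -> H)
    (Phi : NT -> H -> H) : Prop :=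
  star_rep Phi /\ forall x a u, Phi (gen x a) u = V x (pi a u).

(* NT is the completion of the *-algebra generated by the gen x a for the
   supremum of the seminorms given by all isometric Nica covariant pairs *)
Record is_toeplitz_nica_pimsner (alpha : Zn -> A -> A)
    (NT : unitalCStarAlgType R) (gen : Zn -> A -> NT) : Prop := {
  tnp_generated : forall D : set NT, closed D ->
    (forall (k : R[i]) b c, D b -> D c -> D (k *: b + c)) ->
    (forall b c, D b -> D c -> D (b ** c)) ->
    (forall b, D b -> D (star b)) ->
    (forall x a, D (gen x a)) ->
    forall b, D b;
  tnp_universal : forall (H : hilbertType R) pi (V : Zn -> H -> H),
    nica_covariant_pair alpha pi V ->
    exists Phi, integrated_form gen pi V Phi;
  tnp_norm_ub : forall (b : NT) (H : hilbertType R) pi (V : Zn -> H -> H) Phi,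
    nica_covariant_pair alpha pi V -> integrated_form gen pi V Phi ->
    forall u, `|Phi b u| <= `|b| * `|u|;
  tnp_norm_lub : forall (b : NT) (M : R[i]), 0 <= M ->
    (forall (H : hilbertType R) pi (V : Zn -> H -> H) Phi,
      nica_covariant_pair alpha pi V -> integrated_form gen pi V Phi ->
      forall u, `|Phi b u| <= M * `|u|) ->
    `|b| <= M
}.

Variables (NT : unitalCStarAlgType R) (gen : Zn -> A -> NT).

(* V_x a V_y^*, where V_x = V_x 1 and a = V_0 a *)
Definition VaV (x : Zn) (a : A) (y : Zn) : NT :=
  gen x cone ** gen 0 a ** star (gen y cone).

Definition torus (z : 'I_n -> R[i]) : Prop := forall i, `|z i| = 1.

Record is_gauge_action (gamma : ('I_n -> R[i]) -> NT -> NT) : Prop := {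
  gauge_aut : forall z, torus z -> star_automorphism (gamma z);
  gaugeM : forall z w, torus z -> torus w ->
    forall b, gamma (fun i => z i * w i) b = gamma z (gamma w b);
  gaugeE : forall z, torus z -> forall x a y,
    gamma z (VaV x a y) =
      (\prod_(i < n) z i ^ ((x i)%:Z - (y i)%:Z)) *: VaV x a y
}.

(* exp (i * lambda_i * t) has real part cos (lambda_i * t) and imaginary part
   sin (lambda_i * t) *)
Definition gauge_flow (gamma : ('I_n -> R[i]) -> NT -> NT) (lambda : 'I_n -> R)
    (t : R) : NT -> NT :=
  gamma (fun i => cos (lambda i * t) +i* sin (lambda i * t)).

End ToeplitzNicaPimsner.

Definition homeomorphism_onto (T U : topologicalType) (S : set T) (G : set U)
    (f : T -> U) : Prop :=
  [/\ set_bij S G f, {within S, continuous f} &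
    exists2 g : U -> T, (forall s, S s -> g (f s) = s) &
      {within G, continuous g}].

Definition affine_on (R : realType) (A B : Type) (S : set (A -> R[i]))
    (f : (A -> R[i]) -> B -> R[i]) : Prop :=
  forall s t, S s -> S t -> forall r : R, 0 <= r <= 1 ->
  forall b, f (fun a => r%:C * s a + (1 - r)%:C * t a) b =
            r%:C * f s b + (1 - r)%:C * f t b.

(* Main.v *)
Require Import Defs.
From HB Require Import structures.
From mathcomp Require Import all_boot all_order all_algebra.
From mathcomp Require Import complex ring lra finmap.
From mathcomp Require Import all_classical all_reals all_analysis.
Set Implicit Arguments.
Unset Strict Implicit.
Unset Printing Implicit Defensive.
Import Order.TTheory GRing.Theory Num.Theory.
Import numFieldNormedType.Exports.
Local Open Scope classical_set_scope.
Local Open Scope ring_scope.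
Local Open Scope complex_scope.

(* The flow multiplies V_x a V_y^* by exp (i t <lambda, x - y>).  Let psi be a
   ground state, y <> 0, b = a V_y^* and s = <lambda, y> > 0.  Choose b' and c'
   close to b and c in the given dense set; on the real line the function
   z |-> psi (c' sigma_z (b')) exp (i s z) is uniformly close to the constant
   psi (c b), and in the upper half plane it decays like exp (- s Im z).  Shifting
   the contour upwards shows that its mean over the real line vanishes, so
   psi (c a V_y^* ) = 0, and taking adjoints covers the case x <> 0.  Conversely,
   if psi has the stated form, the Cauchy-Schwarz inequality gives
   psi (c V_x a V_y^* ) = 0 for y <> 0, while for y = 0 the weight <lambda, x> is
   nonnegative and psi (c sigma_z (b)) is bounded; an arbitrary entire extension
   gives the same values by the identity theorem.  The state belonging to tau is
   the vacuum state of the Fock representation on l^2(Z_+^n, H_tau), whose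
   Hilbert space is realised as the bounded antilinear functionals on the
   finitely supported functions Z_+^n -> A.  States are contractions and the
   V_x a V_y^* span a dense subspace, hence uniqueness, affinity and
   continuity. *)

(** * Complex analysis *)

(** A ground state is bounded only on some dense set, which need not contain [c] or [V_x a V_y^*].
    The argument therefore runs on approximants, and it works because the error on the real line is
    uniform in t: a state composed with the automorphism [sigma_t] is again a state, hence a
    contraction. Of complex analysis only Cauchy's theorem for parallelograms is needed. Contour
    integrals are replaced by dyadic midpoint sums; Goursat's bisection shows that the sum around a
    parallelogram is eventually below any given bound, so no limit has to be formed. The identity
    theorem comes from the same fact, without power series. The algebra [NT] is known through its
    representations, so its relations are verified in all Nica covariant pairs, where [pi cone] may
    be a proper projection. Taking functionals as the vectors of the Fock space makes completeness a
    matter of pointwise limits and avoids the quotient by null vectors. The norm estimates for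
    positive functionals rest on a square root of 1 - h, found as a fixed point, in place of
    spectral theory. *)

Section RealNorm.
Variables (R : realType) (V : normedModType R[i]).
Implicit Types (u v : V).

Definition rnorm (v : V) : R := complex.Re `|v|.

Lemma rnormE v : `|v| = (rnorm v)%:C.
Proof.
by rewrite /rnorm; case: `|v| (normr_ge0 v) => a b; rewrite lecE /= => /andP[/eqP -> _].
Qed.

Lemma rnorm_ge0 v : 0 <= rnorm v.
Proof. by have := normr_ge0 v; rewrite rnormE lecR. Qed.

Lemma rnormD u v : rnorm (u + v) <= rnorm u + rnorm v.
Proof. by have := ler_normD u v; rewrite !rnormE -rmorphD lecR. Qed.

Lemma rnormN v : rnorm (- v) = rnorm v.
Proof. by rewrite /rnorm normrN. Qed.

Lemma rnorm0 : rnorm 0 = 0.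
Proof. by rewrite /rnorm normr0. Qed.

Lemma rnorm_eq0 v : rnorm v = 0 -> v = 0.
Proof. by move=> v0; apply/eqP; rewrite -normr_eq0 rnormE v0. Qed.

Lemma rnormB u v : rnorm (u - v) = rnorm (v - u).
Proof. by rewrite /rnorm distrC. Qed.

End RealNorm.

Section Complex.
Variable R : realType.
Implicit Types (z w : R[i]) (x y : R).
Local Notation C := (R[i]^o).

Lemma rnormC_ge z : `|complex.Re z| <= rnorm (z : C).
Proof. by have := normc_ge_Re z; rewrite (rnormE (z : C)) lecR. Qed.

Lemma rnormM z w : rnorm (z * w : C) = rnorm (z : C) * rnorm (w : C).
Proof. by apply: complexI; rewrite -rnormE normrM (rnormE (z : C)) (rnormE (w : C)) rmorphM. Qed.

Lemma rnormZ (V : normedModType R[i]) z (v : V) : rnorm (z *: v) = rnorm (z : C) * rnorm v.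
Proof. by apply: complexI; rewrite -rnormE normrZ !rnormE rmorphM. Qed.

Lemma rnorm_real x : rnorm (x%:C : C) = `|x|.
Proof. by rewrite /rnorm normc_def /= expr0n addr0 sqrtr_sqr. Qed.

Lemma rnorm_sqr z : rnorm (z : C) ^+ 2 = complex.Re z ^+ 2 + complex.Im z ^+ 2.
Proof. by rewrite /rnorm normc_def /= sqr_sqrtr // addr_ge0 // sqr_ge0. Qed.

Lemma rnorm_le_sum z : rnorm (z : C) <= `|complex.Re z| + `|complex.Im z|.
Proof.
rewrite -(@ler_pXn2r _ 2) ?nnegrE ?rnorm_ge0 ?addr_ge0 ?normr_ge0 //.
rewrite rnorm_sqr -(real_normK (num_real (complex.Re z))) -(real_normK (num_real (complex.Im z))).
have := mulr_ge0 (normr_ge0 (complex.Re z)) (normr_ge0 (complex.Im z)).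
by rewrite sqrrD; lra.
Qed.

Lemma rnormC_ge_Im z : `|complex.Im z| <= rnorm (z : C).
Proof.
rewrite -(@ler_pXn2r _ 2) ?nnegrE ?rnorm_ge0 ?normr_ge0 //.
by rewrite rnorm_sqr real_normK ?num_real // lerDr sqr_ge0.
Qed.

End Complex.

(** Clearing the difference quotient of its denominator gives a bound that also holds at [h = 0].
    The field is general because the lemma serves the real functions [expR], [cos], [sin] as well as
    complex ones. *)
Lemma derivable_littleoP (K : numFieldType) (V : normedModType K) (f : K^o -> V)
    (x : K) (l : V) :
  is_derive (x : K^o) 1 f l <-> forall e : K, 0 < e -> exists2 d : K, 0 < d &
    forall h : K, `|h| < d -> `|f (h + x) - f x - h *: l| <= e * `|h|.
Proof.
split=> [[df <-] e e0|dP].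
  have /cvgrPdist_le /(_ e e0) := df; rewrite -/(derive f x 1).
  move=> /nbhs_ballP[d /= d0 dP]; exists d => // h hd.
  have [->|h0] := eqVneq h 0.
    by rewrite add0r subrr scale0r subrr !normr0 mulr0.
  have hb : ball (0 : K) d h by rewrite -ball_normE /ball_ /= sub0r normrN.
  have := dP h hb h0; rewrite (_ : h%:A = h); last by rewrite /GRing.scale /= mulr1.
  rewrite -(ler_pM2r (x := `|h|)) ?normr_gt0 // [ `|'D_1 f x - _| * _]mulrC -normrZ scalerBr.
  by rewrite scalerA mulfV // scale1r distrC.
have lim : (fun h : K => h^-1 *: ((f \o shift x) (h *: (1 : K^o)) - f x)) @ 0^' --> l.
  apply/cvgrPdist_le => e e0; have [d d0 dH] := dP e e0.
  apply/nbhs_ballP; exists d => //= h; rewrite -ball_normE /ball_ /= sub0r normrN => hd h0.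
  have := dH h hd; rewrite (_ : h%:A = h); last by rewrite /GRing.scale /= mulr1.
  rewrite -(ler_pM2r (x := `|h|^-1)) ?invr_gt0 ?normr_gt0 // mulfK ?normr_eq0 //.
  by rewrite [_ * `|h|^-1]mulrC -normfV -normrZ scalerBr scalerA mulVf // scale1r distrC.
by apply: DeriveDef; [apply/cvg_ex; exists l | exact: cvg_lim].
Qed.

(** * Midpoint sums along segments and around parallelograms *)

Section Segments.
Variable R : realType.
Implicit Types (g : R[i] -> R[i]) (p d w v z : R[i]).
Local Notation C := (R[i]^o).
Local Notation nm z := (rnorm (z : R[i]^o)).

(* Midpoint Riemann sum, so that affine functions are integrated exactly. *)
Fixpoint midsum g N p d : R[i] :=
  if N is N'.+1 then midsum g N' p (d / 2) + midsum g N' (p + d / 2) (d / 2)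
  else g (p + d / 2) * d.

Lemma half_half d : d = d / 2 + d / 2 :> R[i].
Proof. by field. Qed.

Lemma midsumB g1 g2 N p d :
  midsum (fun z => g1 z - g2 z) N p d = midsum g1 N p d - midsum g2 N p d.
Proof.
elim: N p d => [|N IH] p d /=; first by rewrite mulrBl.
by rewrite !IH; ring.
Qed.

Lemma midsum_affine a b N p d :
  midsum (fun z => a + b * z) N p d = (a + b * (p + d / 2)) * d.
Proof. by elim: N p d => [|N IH] p d //=; rewrite !IH; field. Qed.

Lemma nm_half d : nm (d / 2) = nm d / 2.
Proof.
rewrite rnormM; congr (_ * _).
by rewrite (_ : 2^-1 = (2^-1 : R)%:C) ?rnorm_real ?gtr0_norm // fmorphV rmorph_nat.
Qed.

Definition on_segment p d (P : R[i] -> Prop) :=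
  forall r : R, 0 <= r <= 1 -> P (p + r%:C * d).

Lemma on_segment_mid p d P : on_segment p d P -> P (p + d / 2).
Proof.
move=> /(_ 2^-1); rewrite fmorphV rmorph_nat [_ * d]mulrC; apply.
by rewrite invr_ge0 ler0n invf_le1 ?ler1n.
Qed.

Lemma on_segment_half p d P : on_segment p d P ->
  on_segment p (d / 2) P /\ on_segment (p + d / 2) (d / 2) P.
Proof.
move=> H; split=> r /andP[r0 r1].
  have /H : 0 <= r / 2 <= 1 by rewrite divr_ge0 //= ler_pdivrMr // mul1r; lra.
  by rewrite rmorphM fmorphV rmorph_nat mulrAC -mulrA.
have /H : 0 <= (1 + r) / 2 <= 1 by rewrite divr_ge0 ?addr_ge0 //= ler_pdivrMr // mul1r; lra.
rewrite rmorphM fmorphV rmorph_nat rmorphD rmorph1.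
by congr P; field.
Qed.

Lemma midsum_bound g N p d (K : R) : on_segment p d (fun z => nm (g z) <= K) ->
  nm (midsum g N p d) <= K * nm d.
Proof.
elim: N p d => [|N IH] p d H /=.
  by rewrite rnormM ler_wpM2r ?rnorm_ge0 //; exact: on_segment_mid H.
have [/IH h1 /IH h2] := on_segment_half H.
apply: le_trans (rnormD _ _) _; move: h1 h2; rewrite nm_half; lra.
Qed.

(** Approximates the contour integral around the parallelogram with corners [p], [p + w],
    [p + w + v], [p + v], in this order; the two returning sides enter with a minus sign. *)
Definition paramsum g N p w v : R[i] :=
  midsum g N p w + midsum g N (p + w) v - midsum g N (p + v) w - midsum g N p v.

(** A side at level [N.+1] is exactly the sum of its halves at level [N], and each inner side of the
    four quarters occurs twice with opposite signs. The cancellation is thus exact at every finite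
    level. *)
Lemma paramsumS g N p w v : paramsum g N.+1 p w v =
  paramsum g N p (w / 2) (v / 2) + paramsum g N (p + w / 2) (w / 2) (v / 2) +
  paramsum g N (p + v / 2) (w / 2) (v / 2) +
  paramsum g N (p + w / 2 + v / 2) (w / 2) (v / 2).
Proof.
rewrite /paramsum /= -[p + w / 2 + w / 2]addrA -half_half.
rewrite -[p + v / 2 + v / 2]addrA -half_half.
rewrite (_ : p + w / 2 + v / 2 + w / 2 = p + w + v / 2); last by field.
rewrite (_ : p + w / 2 + v / 2 + v / 2 = p + v + w / 2); last by field.
rewrite (_ : p + v / 2 + w / 2 = p + w / 2 + v / 2); last by field.
ring.
Qed.

Lemma paramsum_affine a b N p w v : paramsum (fun z => a + b * z) N p w v = 0.
Proof. by rewrite /paramsum !midsum_affine; field. Qed.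

Lemma paramsumB g1 g2 N p w v :
  paramsum (fun z => g1 z - g2 z) N p w v = paramsum g1 N p w v - paramsum g2 N p w v.
Proof. by rewrite /paramsum !midsumB; ring. Qed.

End Segments.

Lemma nested_intervals (R : realType) (a h : nat -> R) :
  (forall k, a k <= a k.+1) -> (forall k, a k.+1 + h k.+1 <= a k + h k) ->
  (forall k, 0 <= h k) -> exists l, forall k, a k <= l <= a k + h k.
Proof.
move=> a_nd ah_ni h0.
have nd : {homo a : m n / (m <= n)%N >-> m <= n} by apply/nondecreasing_seqP.
have ni : {homo (fun k => a k + h k) : m n / (m <= n)%N >-> n <= m}.
  by apply/nonincreasing_seqP.
have ub j k : a j <= a k + h k.
  have [jk|/ltnW kj] := leqP j k.
    by apply: le_trans (nd _ _ jk) _; rewrite lerDl.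
  by apply: le_trans (ni _ _ kj); rewrite lerDl.
have hs : has_sup (range a).
  by split; [exists (a 0%N); exists 0%N | exists (a 0%N + h 0%N) => _ [j _ <-]].
exists (sup (range a)) => k; apply/andP; split.
  by apply: sup_upper_bound => //; exists k.
by apply: ge_sup; [case: hs | move=> _ [j _ <-]].
Qed.

Section ComplexDifferentiation.
Variables (R : realType) (V : normedModType R[i]).
Local Notation nm z := (rnorm (z : R[i]^o)).

Lemma derivable_rnormP (f : R[i]^o -> V) (z : R[i]) (l : V) :
  is_derive (z : R[i]^o) 1 f l <-> forall e : R, 0 < e -> exists2 d : R, 0 < d &
    forall h : R[i], nm h < d -> rnorm (f (h + z) - f z - h *: l) <= e * nm h.
Proof.
rewrite derivable_littleoP; split=> [H e e0|H e e0].
  have [|d d0 dP] := H e%:C; first by rewrite ltcR.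
  exists (complex.Re d); first by move: d0; rewrite ltcE => /andP[].
  move=> h hd; have := dP h; rewrite (rnormE (h : R[i]^o)) (rnormE (_ - _ : V)) -rmorphM lecR;
    apply.
  by move: d0; rewrite !ltcE /= => /andP[/eqP ->]; rewrite eqxx.
have e1 : 0 < complex.Re e by move: e0; rewrite ltcE => /andP[].
have [d d0 dP] := H _ e1; exists d%:C; first by rewrite ltcR.
move=> h; rewrite (rnormE (h : R[i]^o)) ltcR => /dP; rewrite rnormE -lecR rmorphM.
rewrite [X in _ <= X * _ -> _](_ : _ = e) //=.
by move: e0; rewrite ltcE; case: (e) => a b /= /andP[/eqP -> _].
Qed.

End ComplexDifferentiation.

(** * Cauchy's theorem for parallelograms, by bisection *)

Section Goursat.
Variable R : realType.
Implicit Types (g : R[i] -> R[i]) (p d w v z : R[i]).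
Local Notation C := (R[i]^o).
Local Notation nm z := (rnorm (z : R[i]^o)).

Lemma paramsum_bound g N p w v (K : R) :
  (forall r s : R, 0 <= r <= 1 -> 0 <= s <= 1 -> nm (g (p + r%:C * w + s%:C * v)) <= K) ->
  nm (paramsum g N p w v) <= 2 * K * (nm w + nm v).
Proof.
move=> H; have le01 : 0 <= (0 : R) <= 1 by apply/andP; split; lra.
have le11 : 0 <= (1 : R) <= 1 by apply/andP; split; lra.
have h1 : nm (midsum g N p w) <= K * nm w.
  by apply: midsum_bound => r r01; have := H r 0 r01 le01; rewrite mul0r addr0.
have h2 : nm (midsum g N (p + w) v) <= K * nm v.
  by apply: midsum_bound => r r01; have := H 1 r le11 r01; rewrite mul1r.
have h3 : nm (midsum g N (p + v) w) <= K * nm w.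
  by apply: midsum_bound => r r01; have := H r 1 r01 le11; rewrite mul1r addrAC.
have h4 : nm (midsum g N p v) <= K * nm v.
  by apply: midsum_bound => r r01; have := H 0 r le01 r01; rewrite mul0r addr0.
rewrite /paramsum; apply: le_trans (rnormD _ _) _; rewrite rnormN.
have := rnormD (midsum g N p w + midsum g N (p + w) v : C) (- midsum g N (p + v) w).
have := rnormD (midsum g N p w : C) (midsum g N (p + w) v).
rewrite rnormN; lra.
Qed.

(** Negates the conclusion of [goursat]. Largeness is asked at arbitrarily high levels because this
    form survives the choice of one quarter out of four. *)
Definition frequently_large g p w v (m : R) :=
  forall N0, exists2 N, (N0 <= N)%N & m < nm (paramsum g N p w v).

(** Otherwise each quarter has a level beyond which its sum is at most [m / 4]; past the maximum of
    the four levels this contradicts [paramsumS]. The booleans [ab] name a quarter by its corner. *)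
Lemma frequently_large_half g p w v (m : R) : frequently_large g p w v m ->
  exists2 ab : bool * bool, True &
   frequently_large g (p + (ab.1%:R / 2) * w + (ab.2%:R / 2) * v) (w / 2) (v / 2) (m / 4).
Proof.
move=> Fm; apply: contrapT => /forall2NP noF.
have H (ab : bool * bool) : exists N0, forall N, (N0 <= N)%N ->
    nm (paramsum g N (p + (ab.1%:R / 2) * w + (ab.2%:R / 2) * v) (w / 2) (v / 2)) <= m / 4.
  have [//|/existsNP[N0 H]] := noF ab; exists N0 => N N0N.
  by rewrite leNgt; apply/negP => lt; apply: H; exists N.
have [N1 H1] := H (false, false); have [N2 H2] := H (true, false).
have [N3 H3] := H (false, true); have [N4 H4] := H (true, true).
have [[//|N] ltN mlt] := Fm (maxn N1 (maxn N2 (maxn N3 N4))).+1.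
move: ltN; rewrite ltnS !geq_max => /and4P[/H1 h1 /H2 h2 /H3 h3 /H4 h4].
move: mlt; rewrite paramsumS; apply/negP; rewrite -leNgt.
move: h1 h2 h3 h4; rewrite /= mulr0n mulr1n !mul0r !addr0 !mul1r ![2^-1 * _]mulrC.
set A := paramsum _ _ p _ _; set B := paramsum _ _ (p + w / 2) _ _.
set A' := paramsum _ _ (p + v / 2) _ _; set B' := paramsum _ _ (p + w / 2 + v / 2) _ _.
have := rnormD (A + B + A' : C) B'; have := rnormD (A + B : C) A'; have := rnormD (A : C) B.
lra.
Qed.

Lemma goursat g p w v (m : R) : (forall z, derivable (g : C -> C) z 1) -> 0 < m ->
  exists N0, forall N, (N0 <= N)%N -> nm (paramsum g N p w v) <= m.
Proof.
move=> dg m0; apply: contrapT => /forallNP noN.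
have F0 : frequently_large g p w v m.
  move=> N0; have /existsNP[N /not_implyP[N0N /negP]] := noN N0.
  by rewrite -ltNge; exists N.
(* [s] holds the coordinates, along [w] and [v], of the corner of the k-th quarter. *)
pose inv k (s : R * R) := frequently_large g (p + s.1%:C * w + s.2%:C * v)
  (w / 2 ^+ k) (v / 2 ^+ k) (m / 4 ^+ k).
have /choice[f fP] : forall ks : nat * (R * R), exists s' : R * R, inv ks.1 ks.2 ->
    [/\ inv ks.1.+1 s', ks.2.1 <= s'.1 <= ks.2.1 + (2 ^+ ks.1.+1)^-1 &
      ks.2.2 <= s'.2 <= ks.2.2 + (2 ^+ ks.1.+1)^-1].
  move=> [k [a b]] /=; have [|H] := pselect (inv k (a, b)); last by exists (0, 0).
  move=> /frequently_large_half[[i j] _ H].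
  exists (a + i%:R * (2 ^+ k.+1)^-1, b + j%:R * (2 ^+ k.+1)^-1) => _.
  have pos : (0 : R) <= (2 ^+ k.+1)^-1 by rewrite invr_ge0 exprn_ge0.
  split=> /=; last 2 first.
  - by case: (i); rewrite ?mulr1n ?mulr0n ?mul1r ?mul0r; apply/andP; split; lra.
  - by case: (j); rewrite ?mulr1n ?mulr0n ?mul1r ?mul0r; apply/andP; split; lra.
  move: H; rewrite /inv /= !exprSr !invfM !mulrA.
  congr (frequently_large g _ _ _ _).
  by rewrite !rmorphD !rmorphM !fmorphV !rmorphXn !rmorph_nat; field; rewrite expf_neq0 ?pnatr_eq0.
pose s := fix s k := if k is k'.+1 then f (k', s k') else (0, 0) : R * R.
have sinv k : inv k (s k).
  elim: k => [|k /(fP (k, s k))[]//].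
  by move: F0; rewrite /inv /= !mul0r !addr0 !expr0 !divr1.
have sP k := fP (k, s k) (sinv k).
have pow k : (2 ^+ k)^-1 = (2 ^+ k.+1)^-1 + (2 ^+ k.+1)^-1 :> R.
  by rewrite exprS; field; rewrite expf_neq0 ?pnatr_eq0.
have powge0 k : (0 : R) <= (2 ^+ k)^-1 by rewrite invr_ge0 exprn_ge0.
have [a aP] : exists a, forall k, (s k).1 <= a <= (s k).1 + (2 ^+ k)^-1.
  apply: nested_intervals => // k; have [_ /andP[h1 h2] _] := sP k => //.
  by rewrite [X in _ <= _ + X]pow; move: h2 => /=; lra.
have [b bP] : exists b, forall k, (s k).2 <= b <= (s k).2 + (2 ^+ k)^-1.
  apply: nested_intervals => // k; have [_ _ /andP[h1 h2]] := sP k => //.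
  by rewrite [X in _ <= _ + X]pow; move: h2 => /=; lra.
pose L := nm w + nm v; have L0 : 0 <= L by rewrite addr_ge0 ?rnorm_ge0.
pose z0 : R[i] := p + a%:C * w + b%:C * v.
have L2 : 0 < 2 * L ^+ 2 + 1 by rewrite ltr_wpDl // mulr_ge0 // sqr_ge0.
(* The final estimate is [2 * e * L ^+ 2 / 4 ^+ k]; this [e] puts it below [m / 4 ^+ k], also when
   [L = 0]. *)
pose e := m / (2 * L ^+ 2 + 1); have e0 : 0 < e by rewrite divr_gt0.
have dz0 := dg z0; have : is_derive (z0 : C) 1 (g : C -> C) ('D_1 (g : C -> C) z0) by split.
move: ('D_1 (g : C -> C) z0) => l /derivable_rnormP /(_ e e0)[d d0 dP].
have [k kd] : exists k, L * (2 ^+ k)^-1 < d.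
  have : (fun k => L * (2^-1 : R) ^+ k) @ \oo --> L * 0.
    apply: cvgMr; apply: cvg_expr; rewrite gtr0_norm ?invr_gt0 //; lra.
  rewrite mulr0 => /cvgrPdist_lt /(_ d d0)[k _ /(_ k (leqnn _))] /=.
  by rewrite sub0r normrN ger0_norm ?mulr_ge0 ?exprn_ge0 // exprVn; exists k.
have [N _] := sinv k 0%N; apply/negP; rewrite -leNgt.
(* Subtracting the tangent at [z0] changes nothing, since affine functions have sum zero; what
   remains is the error term of differentiability. *)
have -> : paramsum g N (p + (s k).1%:C * w + (s k).2%:C * v) (w / 2 ^+ k) (v / 2 ^+ k) =
   paramsum (fun z => g z - ((g z0 - z0 * l) + l * z)) N
     (p + (s k).1%:C * w + (s k).2%:C * v) (w / 2 ^+ k) (v / 2 ^+ k).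
  by rewrite paramsumB paramsum_affine subr0.
have nmdiv z : nm (z / 2 ^+ k) = nm z * (2 ^+ k)^-1.
  rewrite rnormM; congr (_ * _).
  rewrite (_ : (2 ^+ k)^-1 = ((2 ^+ k)^-1 : R)%:C); last by rewrite fmorphV rmorphXn rmorph_nat.
  by rewrite rnorm_real ger0_norm.
apply: le_trans (@paramsum_bound _ _ _ _ _ (e * (L * (2 ^+ k)^-1)) _) _.
  move=> x y /andP[x0 x1] /andP[y0 y1].
  set z := (X in g X).
  have zE : z - z0 = ((s k).1 - a + x * (2 ^+ k)^-1)%:C * w +
                     ((s k).2 - b + y * (2 ^+ k)^-1)%:C * v.
    rewrite /z /z0 !rmorphD !rmorphN !rmorphM !fmorphV !rmorphXn !rmorph_nat.
    by field; rewrite expf_neq0 ?pnatr_eq0.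
  have bnd (c c' t : R) : c' <= c <= c' + (2 ^+ k)^-1 -> 0 <= t <= 1 ->
      `|c' - c + t * (2 ^+ k)^-1| <= (2 ^+ k)^-1.
    move=> /andP[h1 h2] /andP[t0 t1]; rewrite ler_norml.
    have := powge0 k; set q := (2 ^+ k)^-1 in h2 * => q0.
    have := mulr_ge0 t0 q0; have : t * q <= q by rewrite ler_piMl.
    by move=> h3 h4; apply/andP; split; lra.
  have zz0 : nm (z - z0) <= L * (2 ^+ k)^-1.
    rewrite zE; apply: le_trans (rnormD _ _) _; rewrite !rnormM !rnorm_real mulrDl.
    rewrite ![nm _ * _]mulrC; apply: lerD; rewrite ler_wpM2r ?rnorm_ge0 //; apply: bnd => //.
    - by rewrite x0.
    - by rewrite y0.
  have := dP (z - z0) (le_lt_trans zz0 kd); rewrite subrK.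
  rewrite (_ : g z - g z0 - (z - z0) *: l = g z - (g z0 - z0 * l + l * z)); last first.
    by rewrite /GRing.scale /=; ring.
  by move=> /le_trans; apply; rewrite ler_wpM2l // ltW.
rewrite !nmdiv -mulrDl -/L.
rewrite (_ : _ * _ = (2 * e * L ^+ 2) * (4 ^+ k)^-1); last first.
  have -> : (4 : R) = 2 ^+ 2 by rewrite -natrX.
  by rewrite -exprM mulnC exprM; field; rewrite expf_neq0 ?pnatr_eq0.
rewrite ler_pM2r ?invr_gt0 ?exprn_gt0 //.
rewrite /e mulrA mulrAC ler_pdivrMr //; nra.
Qed.

End Goursat.

(** * The complex exponential as an entire function *)

Section ComplexExponential.
Variable R : realType.
Implicit Types (z w : R[i]).
Local Notation C := (R[i]^o).
Local Notation nm z := (rnorm (z : R[i]^o)).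

Definition cexp z : R[i] :=
  (expR (complex.Re z) * cos (complex.Im z)) +i* (expR (complex.Re z) * sin (complex.Im z)).

Lemma cexpD z w : cexp (z + w) = cexp z * cexp w.
Proof.
case: z w => [a b] [c d]; rewrite /cexp /= expRD cosD sinD; apply/eqP.
by rewrite eq_complex /=; apply/andP; split; apply/eqP; ring.
Qed.

Lemma cexp0 : cexp 0 = 1.
Proof. by rewrite /cexp /= expR0 cos0 sin0 mulr0 mulr1. Qed.

Lemma rnorm_cexp z : nm (cexp z) = expR (complex.Re z).
Proof.
apply/eqP; rewrite -(@eqrXn2 _ 2) ?rnorm_ge0 ?expR_ge0 // rnorm_sqr /=.
by rewrite !exprMn -mulrDr cos2Dsin2 mulr1.
Qed.

Lemma cexp_real (x : R) : cexp x%:C = (expR x)%:C.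
Proof. by rewrite /cexp /= cos0 sin0 mulr1 mulr0. Qed.

(** Only the derivative at 0 is computed from the real functions; [cexpD] transports it to every
    other point. *)
Lemma is_derive_cexp0 : is_derive (0 : C) 1 (cexp : C -> C) (1 : C).
Proof.
(* The four error terms [F1] to [F4] below contribute 3, 3, 1 and 1 times [e' * q], hence the 8. *)
apply/derivable_rnormP => e e0; pose e' := Num.min 1 (e / 8).
have e'0 : 0 < e' by rewrite lt_min ltr01 divr_gt0.
have e'1 : e' <= 1 by rewrite ge_min lexx.
have e'e : 8 * e' <= e by rewrite mulrC -ler_pdivlMr // ge_min lexx orbT.
have /derivable_littleoP /(_ _ e'0)[d1 d10 H1] := is_derive_expR (0 : R).
have /derivable_littleoP /(_ _ e'0)[d2 d20 H2] := is_derive_cos (0 : R).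
have /derivable_littleoP /(_ _ e'0)[d3 d30 H3] := is_derive_sin (0 : R).
exists (Num.min (e' / 2) (Num.min d1 (Num.min d2 d3))).
  by rewrite !lt_min d10 d20 d30 divr_gt0.
move=> h; rewrite !lt_min => /and4P[h0 h1 h2 h3].
have hx := rnormC_ge h; have hy := rnormC_ge_Im h.
have := H1 _ (le_lt_trans hx h1); have := H2 _ (le_lt_trans hy h2).
have := H3 _ (le_lt_trans hy h3).
rewrite !addr0 expR0 cos0 sin0 oppr0 scaler0 !subr0 cexp0 !scaler1 ?addr0.
move: h0 hx hy; set q := nm h => h0 hx hy B3 B2 B1.
apply: le_trans (rnorm_le_sum _) _.
have -> : complex.Re (cexp h - 1 - h) = (expR (complex.Re h) - 1 - complex.Re h) +
    expR (complex.Re h) * (cos (complex.Im h) - 1) by case: (h) => x y /=; ring.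
have -> : complex.Im (cexp h - 1 - h) = expR (complex.Re h) * (sin (complex.Im h) - complex.Im h)
    + (expR (complex.Re h) - 1) * complex.Im h by case: (h) => x y /=; ring.
move: (complex.Re h) (complex.Im h) hx hy B1 B2 B3 => x y hx hy B1 B2 B3.
have q0 : 0 <= q by apply: le_trans hx.
have x0 := normr_ge0 x; have y0 := normr_ge0 y.
have E1 : `|expR x - 1| <= 2 * `|x|.
  rewrite -(subrK x (expR x - 1)); apply: le_trans (ler_normD _ _) _.
  by have : e' * `|x| <= 1 * `|x| by [rewrite ler_wpM2r]; lra.
have E2 : expR x <= 3 by move: E1; rewrite ler_norml => /andP[_]; lra.
have F1 : `|expR x * (cos y - 1)| <= 3 * (e' * q).
  rewrite normrM ger0_norm ?expR_ge0 //; apply: ler_pM => //.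
  by apply: le_trans B2 _; rewrite ler_pM2l.
have F2 : `|expR x * (sin y - y)| <= 3 * (e' * q).
  rewrite normrM ger0_norm ?expR_ge0 //; apply: ler_pM => //.
  by apply: le_trans B3 _; rewrite ler_pM2l.
have F3 : `|(expR x - 1) * y| <= e' * q.
  by rewrite normrM; apply: ler_pM => //; apply: le_trans E1 _; lra.
have F4 : `|expR x - 1 - x| <= e' * q by apply: le_trans B1 _; rewrite ler_pM2l.
have := ler_normD (expR x - 1 - x) (expR x * (cos y - 1)).
have := ler_normD (expR x * (sin y - y)) ((expR x - 1) * y).
have : 8 * e' * q <= e * q by rewrite ler_wpM2r.
lra.
Qed.

Lemma derivable_cexp z : derivable (cexp : C -> C) z 1.
Proof.
suff : is_derive (z : C) 1 (cexp : C -> C) (cexp z : C) by case.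
apply/derivable_rnormP => e e0; have /derivable_rnormP H := is_derive_cexp0.
have cz0 : 0 < nm (cexp z) by rewrite rnorm_cexp expR_gt0.
have [d d0 dP] := H (e / nm (cexp z)) (divr_gt0 e0 cz0); exists d => // h /dP.
rewrite addr0 cexp0 cexpD scaler1.
rewrite (_ : _ - h *: (cexp z : C) = cexp z * (cexp h - 1 - h)); last first.
  by rewrite /GRing.scale /=; ring.
rewrite rnormM -(ler_pM2l cz0) => /le_trans; apply.
by rewrite mulrA mulrCA divff ?mulr1 ?gt_eqF.
Qed.

Lemma derivable_mulC (f g : C -> C) : (forall z : C, derivable f z 1) ->
  (forall z : C, derivable g z 1) -> forall z : C, derivable (fun w : C => f w * g w : C) z 1.
Proof. by move=> df dg z; exact: (derivableM (df z) (dg z)). Qed.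

Lemma derivable_compC (f g : C -> C) : (forall z : C, derivable f z 1) ->
  (forall z : C, derivable g z 1) -> forall z : C, derivable (fun w : C => f (g w)) z 1.
Proof.
move=> df dg z; apply/derivable1_diffP.
by apply: differentiable_comp; apply/derivable1_diffP.
Qed.

Lemma derivable_affineC (a b : R[i]) z : derivable (fun w : C => a * w + b : C) z 1.
Proof.
suff : is_derive (z : C) 1 (fun w : C => a * w + b : C) (a : C) by case.
apply/derivable_rnormP => e e0; exists 1 => // h _.
rewrite (_ : _ - _ = 0); last by rewrite /GRing.scale /=; ring.
by rewrite rnorm0 mulr_ge0 ?rnorm_ge0 // ltW.
Qed.

End ComplexExponential.

(** * Vanishing means of functions decaying in the upper half plane *)

Section LineIntegralEstimates.
Variable R : realType.
Implicit Types (z w : R[i]).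
Local Notation C := (R[i]^o).
Local Notation nm z := (rnorm (z : R[i]^o)).

(** With [u = M / e] the inequality [1 + u <= expR u] is enough; it supplies explicit heights and
    exponents without logarithms. *)
Lemma expRN_small (M e : R) : 0 <= M -> 0 < e -> M * expR (- (M / e)) <= e.
Proof.
move=> M0 e0; have u0 : 0 <= M / e by rewrite divr_ge0 // ltW.
rewrite expRN ler_pdivrMr ?expR_gt0 //.
have := expR_ge1Dx (M / e); rewrite -(ler_pM2l e0) => /(le_trans _); apply.
by rewrite mulrDr mulrCA divff ?gt_eqF // !mulr1 lerDr ltW.
Qed.

Lemma rnormI (y : R) : nm (Complex 0 y) = `|y|.
Proof.
apply/eqP; rewrite -(@eqrXn2 _ 2) ?rnorm_ge0 ?normr_ge0 // rnorm_sqr /=.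
by rewrite expr0n add0r real_normK // num_real.
Qed.

(* Integrate [g] along the boundary of [-T, T] x [0, Y] and let first [Y], then
   [T] be large. *)
Lemma mean_value_bound (g : C -> C) (c : R[i]) (s M e : R) :
  (forall z, derivable g z 1) -> 0 < s -> 0 <= M -> 0 <= e ->
  (forall z : R[i], 0 < complex.Im z -> nm (g z) <= M * expR (- (s * complex.Im z))) ->
  (forall t : R, nm (g t%:C - c) <= e) -> nm c <= e.
Proof.
move=> dg s0 M0 e0 gM gc; rewrite leNgt; apply/negP => ec.
(* On a base of length [2 * T], the top, the two vertical sides and the Goursat remainder cost at
   most [2 * eta * T], [2 * eta * T] and [eta * T], whereas [nm c - e = 4 * eta] would require
   [8 * eta * T]. *)
pose eta := (nm c - e) / 4; have eta0 : 0 < eta by rewrite divr_gt0 // subr_gt0.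
(* Bounds [g] on the closed half plane: on the real axis the decay hypothesis is silent and only the
   distance to [c] is controlled. *)
pose M' := M + e + nm c.
have M'0 : 0 <= M' by rewrite !addr_ge0 ?rnorm_ge0.
have gM' z : 0 <= complex.Im z -> nm (g z) <= M'.
  rewrite le0r => /predU1P[z0|z0].
    have -> : z = (complex.Re z)%:C by apply/eqP; rewrite eq_complex z0 !eqxx.
    by have := gc (complex.Re z); have := rnormD (g (complex.Re z)%:C - c) (c : C);
      rewrite subrK /M'; lra.
  apply: le_trans (gM z z0) _; apply: (@le_trans _ _ M);
    last by rewrite /M' -addrA lerDl addr_ge0 ?rnorm_ge0.
  by rewrite ler_piMr // -expR0 ler_expR oppr_le0 mulr_ge0 // ltW.
pose Y := M / eta / s + 1; have Y0 : 0 < Y by have := divr_ge0 (divr_ge0 M0 (ltW eta0)) (ltW s0);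
  rewrite /Y; lra.
have MY : M * expR (- (s * Y)) <= eta.
  apply: le_trans (expRN_small M0 eta0); rewrite ler_wpM2l // ler_expR lerN2.
  by rewrite /Y mulrDr mulr1 mulrCA divff ?gt_eqF // mulr1 lerDl ltW.
pose T := M' * Y / eta + 1; have T0 : 0 < T by have := divr_ge0 (mulr_ge0 M'0 (ltW Y0)) (ltW eta0); rewrite /T; lra.
have MT : M' * Y <= eta * T by rewrite (_ : eta * T = M' * Y + eta) ?lerDl ?ltW // /T; field;
  rewrite gt_eqF.
pose p : R[i] := (- T)%:C; pose w : R[i] := (2 * T)%:C; pose v : R[i] := Complex 0 Y.
have nw : nm w = 2 * T by rewrite rnorm_real ger0_norm // mulr_ge0 // ltW.
have nv : nm v = Y by rewrite rnormI ger0_norm // ltW.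
have [N /(_ N (leqnn _))] := goursat p w v dg (mulr_gt0 eta0 T0).
have bot : nm (midsum g N p w - c * w) <= e * (2 * T).
  have -> : c * w = midsum (fun z => c + 0 * z) N p w by rewrite midsum_affine mul0r addr0.
  rewrite -midsumB -nw; apply: midsum_bound => r _.
  by rewrite mul0r addr0 /p /w -rmorphM -rmorphD; exact: gc.
have top : nm (midsum g N (p + v) w) <= eta * (2 * T).
  rewrite -nw; apply: midsum_bound => r _.
  have E : complex.Im (p + v + r%:C * w) = Y by rewrite /= mulr0 mul0r !addr0 add0r.
  by have := gM (p + v + r%:C * w); rewrite E => /(_ Y0) /le_trans; apply.
have lft : nm (midsum g N p v) <= M' * Y.
  rewrite -[X in _ * X]nv; apply: midsum_bound => r /andP[r0 _].
  by apply: gM'; rewrite /= mul0r addr0 add0r mulr_ge0 // ltW.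
have rgt : nm (midsum g N (p + w) v) <= M' * Y.
  rewrite -[X in _ * X]nv; apply: midsum_bound => r /andP[r0 _].
  by apply: gM'; rewrite /= mul0r !addr0 add0r mulr_ge0 // ltW.
rewrite /paramsum; move: bot top lft rgt.
set B := midsum _ _ p w; set U := midsum _ _ (p + v) w; set L := midsum _ _ p v.
set D := midsum _ _ (p + w) v => bot top lft rgt S.
have : nm (c * w) <= nm (B - c * w) + nm (B + D - U - L) + nm U + nm L + nm D.
  have E : c * w = - (B - c * w) + (B + D - U - L) + U + L - D by ring.
  rewrite {1}E.
  apply: le_trans (rnormD _ _) _; rewrite rnormN lerD2r.
  apply: le_trans (rnormD _ _) _; rewrite lerD2r.
  apply: le_trans (rnormD _ _) _; rewrite lerD2r.
  by apply: le_trans (rnormD _ _) _; rewrite rnormN.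
rewrite rnormM nw.
have : nm c = e + 4 * eta by rewrite /eta; field.
move=> ->; have := mulr_gt0 eta0 T0; nra.
Qed.

End LineIntegralEstimates.

Section PeakEstimates.
Variable R : realType.
Implicit Types (z w : R[i]).
Local Notation C := (R[i]^o).
Local Notation nm z := (rnorm (z : R[i]^o)).

Lemma derivable_near (h : C -> C) (z : C) (e : R) : derivable h z 1 -> 0 < e ->
  exists2 d : R, 0 < d & forall w : R[i], nm w < d -> nm (h (w + z) - h z) < e.
Proof.
move=> dh e0; have : is_derive z 1 h ('D_1 h z) by split.
move: ('D_1 h z) => l /derivable_rnormP /(_ 1 ltr01)[d d0 dP].
have l0 : 0 < 1 + nm l by rewrite ltr_pwDl // rnorm_ge0.
exists (Num.min d (e / (1 + nm l))); first by rewrite lt_min d0 divr_gt0.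
move=> w; rewrite lt_min => /andP[/dP H]; rewrite ltr_pdivlMr // mulrDr mulr1 => we.
rewrite -(subrK (w *: l) (h (w + z) - h z)).
apply: le_lt_trans (rnormD _ _) _; rewrite rnormZ.
by apply: le_lt_trans we; rewrite lerD2r; move: H; rewrite mul1r.
Qed.

Lemma segment_bounded (h : C -> C) p d : (forall z : C, derivable h z 1) ->
  exists2 M : R, 0 <= M & on_segment p d (fun z => nm (h z) <= M).
Proof.
move=> dh; pose f (r : R) := nm (h (p + r%:C * d)).
have cf : continuous f.
  move=> r; apply/cvgrPdist_lt => e e0.
  have [c c0 cP] := derivable_near (dh (p + r%:C * d)) e0.
  have d1 : 0 < 1 + nm d by rewrite ltr_pwDl // rnorm_ge0.
  apply/nbhs_ballP; exists (c / (1 + nm d)) => /=; first by rewrite divr_gt0.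
  move=> t; rewrite /ball_ /= ltr_pdivlMr // => rt.
  have /cP : nm ((t - r)%:C * d) < c.
    rewrite rnormM rnorm_real distrC; apply: le_lt_trans rt.
    by rewrite ler_wpM2l // lerDr.
  rewrite (_ : (t - r)%:C * d + (p + r%:C * d) = p + t%:C * d); last first.
    by rewrite rmorphB; ring.
  set a := h _; set b := h _ => ab.
  apply: le_lt_trans ab; rewrite ler_norml /f.
  have := rnormD (a - b) b; have := rnormD (b - a) a; rewrite !subrK (rnormB b a) => h1 h2.
  by apply/andP; split; rewrite -/a -/b; lra.
have [||c _ cP] := @EVT_max R f 0 1; first exact: ler01.
  exact: continuous_subspaceT.
by exists (f c); [exact: rnorm_ge0 | move=> r r01; apply: cP; rewrite in_itv].
Qed.

(** The sign [sg] treats segments to the right and to the left at once; the outer factor [sg] undoes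
    the orientation. *)
Lemma midsum_lower (g : R[i] -> R[i]) N p (D sg lo : R) : sg ^+ 2 = 1 -> 0 <= D ->
  on_segment p (sg * D)%:C (fun z => lo <= complex.Re (g z)) ->
  lo * D <= sg * complex.Re (midsum g N p (sg * D)%:C).
Proof.
move=> sg1; elim: N p D => [|N IH] p D D0 H /=.
  have := on_segment_mid H; case: (g _) => a b /= ha.
  rewrite (_ : sg * _ = sg ^+ 2 * (a * D)); last by ring.
  by rewrite sg1 mul1r ler_wpM2r.
have E : (sg * D)%:C / 2 = (sg * (D / 2))%:C.
  by rewrite mulrA [in RHS]rmorphM fmorphV rmorph_nat.
have D2 : 0 <= D / 2 by rewrite divr_ge0.
have [] := on_segment_half H; rewrite E => /(IH _ _ D2) h1 /(IH _ _ D2) h2.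
by rewrite raddfD /=; lra.
Qed.

(** A midpoint sum can be estimated separately only on dyadic pieces, so the length is
    [dl * 2 ^+ m]: m halvings isolate the first stretch [dl] and one more isolates [dl / 2], which
    explains the level [N + m.+1]. The peak on the first half gives [lo * (dl / 2)], the second half
    is harmless, the rest costs at most [b] per unit length. *)
Lemma midsum_peak (g : R[i] -> R[i]) z0 (sg dl lo b : R) m : sg ^+ 2 = 1 -> 0 < dl -> 0 <= b ->
  (forall x : R, 0 <= x <= dl / 2 -> lo <= complex.Re (g (z0 + (sg * x)%:C))) ->
  (forall x : R, 0 <= x <= dl -> 0 <= complex.Re (g (z0 + (sg * x)%:C))) ->
  (forall x : R, dl <= x <= dl * 2 ^+ m -> - b <= complex.Re (g (z0 + (sg * x)%:C))) ->
  forall N, lo * (dl / 2) - b * (dl * 2 ^+ m) <=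
    sg * complex.Re (midsum g (N + m.+1) z0 (sg * (dl * 2 ^+ m))%:C).
Proof.
move=> sg1 dl0 b0 H1 H2 H3 N.
(* The induction charges only the stretch from [dl] to [dl * 2 ^+ k], of length [dl * (2 ^+ k - 1)];
   the last doubling adds the right half. *)
suff H k : (k <= m)%N -> lo * (dl / 2) - b * (dl * (2 ^+ k - 1)) <=
    sg * complex.Re (midsum g (N + k.+1) z0 (sg * (dl * 2 ^+ k))%:C).
  by apply: le_trans (H m _) => //; have := mulr_ge0 b0 (ltW dl0); nra.
have half x : (sg * x)%:C / 2 = (sg * (x / 2))%:C.
  by rewrite mulrA [in RHS]rmorphM fmorphV rmorph_nat.
have pt x r (y : R) : z0 + (sg * y)%:C + r%:C * (sg * x)%:C = z0 + (sg * (y + r * x))%:C.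
  by rewrite !rmorphM !rmorphD !rmorphM; ring.
have pt0 x r : z0 + r%:C * (sg * x)%:C = z0 + (sg * (r * x))%:C.
  by rewrite !rmorphM; ring.
elim: k => [_|k IH km].
  rewrite expr0 subrr !mulr0 subr0 mulr1 addn1 /= half raddfD /= mulrDr -[X in X <= _]addr0.
  have d2 : 0 <= dl / 2 by rewrite divr_ge0 // ltW.
  apply: lerD; first apply: midsum_lower => // r /andP[r0 r1].
    by rewrite pt0; apply: H1; rewrite mulr_ge0 //= ler_piMl.
  rewrite -[X in X <= _](mul0r (dl / 2)); apply: midsum_lower => // r /andP[r0 r1].
  by rewrite pt; apply: H2; apply/andP; split; nra.
have pk : 1 <= 2 ^+ k :> R by rewrite exprn_ege1 // ler1n.
have E : dl * 2 ^+ k.+1 / 2 = dl * 2 ^+ k by rewrite exprS; field.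
rewrite addnS /= half E raddfD /= mulrDr.
have /IH := ltnW km; have D0 : 0 <= dl * 2 ^+ k by rewrite mulr_ge0 ?exprn_ge0 // ltW.
have : - b * (dl * 2 ^+ k) <= sg * complex.Re (midsum g (N + k.+1) (z0 + (sg * (dl * 2 ^+ k))%:C) (sg * (dl * 2 ^+ k))%:C).
  apply: midsum_lower => // r /andP[r0 r1]; rewrite pt; apply: H3; apply/andP; split.
    by apply: (@le_trans _ _ (dl * 2 ^+ k)); rewrite ?lerDl ?mulr_ge0 ?ler_peMr // ltW.
  apply: (@le_trans _ _ (dl * 2 ^+ k.+1)); first by rewrite exprS; nra.
  by rewrite ler_pM2l // ler_eXn2l // ltr1n.
by rewrite exprS; lra.
Qed.

End PeakEstimates.

(** * Entire functions vanishing on the real line *)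

Section IdentityTheorem.
Variable R : realType.
Implicit Types (z w : R[i]).
Local Notation C := (R[i]^o).
Local Notation nm z := (rnorm (z : R[i]^o)).

(* Multiply [h] by the Gaussian exp(-K (z - z0)^2), which peaks at z0 on the
   horizontal line through z0, and integrate along the two rectangles that
   reach from z0 to the real axis; K is then taken to be large. *)
Lemma entire_eq0 (h : C -> C) : (forall z : C, derivable h z 1) ->
  (forall t : R, h t%:C = 0) -> forall z : R[i], 0 < complex.Im z -> h z = 0.
Proof.
move=> dh0 h00 z0 y0; apply/eqP/negP => /negP hz0.
pose h1 : C -> C := fun z => (h z0)^-1 * h z.
have dh z : derivable h1 z 1.
  exact: (@derivable_mulC _ (fun=> (h z0)^-1) h (fun w => derivable_cst _ _ _) dh0 z).
have hR t : h1 t%:C = 0 by rewrite /h1 h00 mulr0.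
have h1z0 : h1 z0 = 1 by rewrite /h1 mulVf.
have half0 : 0 < 2^-1 :> R by rewrite invr_gt0.
have [d d0 dP] := derivable_near (dh z0) half0.
pose y := complex.Im z0; pose dl := d / 2; have dl0 : 0 < dl by rewrite divr_gt0.
(* [T] must be [dl] times a power of two for [midsum_peak], and exceed [y + dl] so that
   [T ^+ 2 - t ^+ 2 >= dl ^+ 2] at each depth [t <= y] of the outer vertical sides. *)
have [m mP] : exists m, (y + dl) / dl < 2 ^+ m.
  exists (Num.truncn ((y + dl) / dl)).+1.
  apply: lt_le_trans (truncnS_gt _) _.
  by rewrite -natrX ler_nat ltnW // ltn_expl.
pose T := dl * 2 ^+ m; have yT : y + dl < T by rewrite /T mulrC -ltr_pdivrMr.
have T0 : 0 < T by apply: lt_trans yT; rewrite addr_gt0.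
pose v : R[i] := Complex 0 (- y).
have [M1 M10 HM1] := segment_bounded z0 T%:C dh.
have [M2 M20 HM2] := segment_bounded z0 (- T)%:C dh.
have [M3 M30 HM3] := segment_bounded (z0 + T%:C) v dh.
have [M4 M40 HM4] := segment_bounded (z0 + (- T)%:C) v dh.
pose M := M1 + M2 + M3 + M4; have M0 : 0 <= M by rewrite !addr_ge0.
(* [K] is such that passing from [dl / 2] to [dl] costs the Gaussian a factor [expR (- u)], and [u]
   is such that [u * expR (- u) <= 1] yields [b * (T + y) <= a * dl / 8]. *)
pose u := 8 * (T + y) * M / dl; have u0 : 0 <= u.
  by rewrite divr_ge0 ?mulr_ge0 ?addr_ge0 // ltW.
pose K := 4 * u / (3 * dl ^+ 2); have K0 : 0 <= K.
  by apply: divr_ge0; apply: mulr_ge0 => //; exact: sqr_ge0.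
pose g z := h1 z * cexp ((- K)%:C * ((z - z0) * (z - z0))).
have dg z : derivable (g : C -> C) z 1.
  have dB w1 : derivable (fun w : C => w - z0 : C) w1 1.
    have := @derivable_affineC R 1 (- z0) w1.
    by rewrite (_ : (fun w : C => _) = (fun w : C => w - z0 : C)) //; apply/funext => w2;
      rewrite mul1r.
  have dq := derivable_mulC dB dB.
  have dKq := @derivable_mulC _ (fun=> (- K)%:C) _ (fun w => derivable_cst _ _ _) dq.
  exact: (derivable_mulC dh (derivable_compC (@derivable_cexp R) dKq)).
have gline (x : R) : g (z0 + x%:C) = h1 (z0 + x%:C) * (expR (- K * x ^+ 2))%:C.
  by rewrite /g [_ - z0]addrC addrA addNr add0r -!rmorphM cexp_real -expr2.
have gE (x t : R) : nm (g (z0 + x%:C + Complex 0 t)) =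
    nm (h1 (z0 + x%:C + Complex 0 t)) * expR (- K * (x ^+ 2 - t ^+ 2)).
  rewrite /g rnormM rnorm_cexp; congr (_ * expR _).
  rewrite (_ : z0 + x%:C + Complex 0 t - z0 = Complex x t); first by rewrite /=; ring.
  rewrite (_ : _ - z0 = x%:C + Complex 0 t); last by ring.
  by apply/eqP; rewrite eq_complex /=; apply/andP; split; apply/eqP; ring.
pose a := expR (- K * (dl / 2) ^+ 2); pose b := M * expR (- K * dl ^+ 2).
have b0 : 0 <= b by rewrite mulr_ge0 ?expR_ge0.
have ReM (z : R[i]) (x : R) : complex.Re (z * x%:C) = complex.Re z * x.
  by case: z => p q /=; rewrite mulr0 subr0.
have hnear (x : R) : `|x| <= dl -> 2^-1 <= complex.Re (h1 (z0 + x%:C)).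
  move=> xdl; have /dP : nm (x%:C) < d by rewrite rnorm_real; apply: le_lt_trans xdl _;
    rewrite /dl; lra.
  rewrite h1z0 [x%:C + _]addrC => /(le_lt_trans (rnormC_ge _)).
  rewrite raddfB /= ltr_norml => /andP[+ _]; lra.
have peak (sg : R) : sg ^+ 2 = 1 -> (forall r : R, 0 <= r <= 1 -> nm (h1 (z0 + r%:C * (sg * T)%:C)) <= M) ->
    forall N, 2^-1 * a * (dl / 2) - b * T <= sg * complex.Re (midsum g (N + m.+1) z0 (sg * T)%:C).
  move=> sg1 hM N; have sgn : `|sg| = 1.
    by apply/eqP; rewrite -(@eqrXn2 _ 2) // real_normK ?num_real // sg1 expr1n.
  apply: midsum_peak => // x /andP[x0 x1]; rewrite gline ReM exprMn sg1 mul1r.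
  - have hx : 2^-1 <= complex.Re (h1 (z0 + (sg * x)%:C)).
      by apply: hnear; rewrite normrM sgn mul1r ger0_norm //; move: x1; rewrite /dl; lra.
    apply: ler_pM; rewrite ?invr_ge0 ?expR_ge0 //.
    by rewrite ler_expR !mulNr lerN2 ler_wpM2l // ler_pXn2r ?nnegrE // (le_trans x0).
  - apply: mulr_ge0; rewrite ?expR_ge0 //; apply: le_trans (hnear _ _); rewrite ?invr_ge0 //.
    by rewrite normrM sgn mul1r ger0_norm.
  have hx : - M <= complex.Re (h1 (z0 + (sg * x)%:C)).
    have := hM (x / T); rewrite -rmorphM mulrCA divfK ?gt_eqF // => H.
    have x0' : 0 <= x by apply: le_trans x0; exact: ltW.
    have /H /(le_trans (rnormC_ge _)) : 0 <= x / T <= 1.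
      by rewrite divr_ge0 //= ?ler_pdivrMr ?mul1r // ltW.
    by rewrite ler_norml => /andP[].
  have : expR (- K * x ^+ 2) <= expR (- K * dl ^+ 2).
    by rewrite ler_expR !mulNr lerN2 ler_wpM2l // ler_pXn2r ?nnegrE // ?ltW // (lt_le_trans dl0).
  have := expR_ge0 (- K * x ^+ 2); rewrite /b; nra.
have side (x : R) N : `|x| = T -> (forall r : R, 0 <= r <= 1 -> nm (h1 (z0 + x%:C + r%:C * v)) <= M) ->
    nm (midsum g N (z0 + x%:C) v) <= b * y.
  move=> xT hM; have nv : nm v = y by rewrite rnormI normrN ger0_norm // ltW.
  rewrite -[X in _ * X]nv; apply: midsum_bound => r r01.
  have := hM r r01; have -> : r%:C * v = Complex 0 (- (r * y)).
    by apply/eqP; rewrite eq_complex /=; apply/andP; split; apply/eqP; ring.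
  rewrite gE => hr; apply: ler_pM; rewrite ?rnorm_ge0 ?expR_ge0 //.
  rewrite ler_expR !mulNr lerN2 ler_wpM2l // -(real_normK (num_real x)) xT.
  case/andP: r01 => r0 r1; have y0' : 0 < y by [].
  have : (r * y) ^+ 2 <= y ^+ 2 by rewrite exprMn ler_piMl ?sqr_ge0 // expr_le1.
  have : (y + dl) ^+ 2 <= T ^+ 2 by rewrite ler_pXn2r ?nnegrE // ltW // addr_gt0.
  by have := mulr_gt0 dl0 y0'; have := sqr_ge0 y; rewrite sqrrD sqrrN; lra.
have bot N (x : R) : midsum g N (z0 + v) x%:C = 0.
  apply: (@rnorm_eq0 R C); apply/eqP; rewrite eq_le rnorm_ge0 andbT -[X in _ <= X](mul0r (nm x%:C)).
  apply: midsum_bound => r _.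
  have -> : z0 + v + r%:C * x%:C = (complex.Re z0 + r * x)%:C.
    apply/eqP; rewrite eq_complex; apply/andP.
    by split; apply/eqP; rewrite !raddfD /= /y; ring.
  by rewrite /g hR mul0r rnorm0.
have a0 : 0 < a := expR_gt0 _.
have mm0 : 0 < a * dl / 16 by rewrite divr_gt0 // mulr_gt0.
(* The right and the left rectangle share the vertical side below [z0], where the Gaussian grows and
   no useful bound exists; this side cancels in the difference of the two estimates. *)
have [N1 HN1] := goursat z0 T%:C v dg mm0.
have [N2 HN2] := goursat z0 (- T)%:C v dg mm0.
pose N := (N1 + N2 + m.+1)%N.
have := HN1 N; rewrite /paramsum bot subr0 => /(_ _) A.
have {}A := A (leq_trans (leq_addr _ _) (leq_addr _ _)).
have := HN2 N; rewrite /paramsum bot subr0 => /(_ _) B.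
have {}B := B (leq_trans (leq_addl _ _) (leq_addr _ _)).
have MM r (r01 : 0 <= r <= 1) : [/\ nm (h1 (z0 + r%:C * T%:C)) <= M, nm (h1 (z0 + r%:C * (- T)%:C)) <= M,
    nm (h1 (z0 + T%:C + r%:C * v)) <= M & nm (h1 (z0 + (- T)%:C + r%:C * v)) <= M].
  have := HM1 r r01; have := HM2 r r01; have := HM3 r r01; have := HM4 r r01.
  by rewrite /M => *; split; lra.
have P1 : 2^-1 * a * (dl / 2) - b * T <= complex.Re (midsum g N z0 T%:C).
  have := peak 1 (expr1n _ _) _ (N1 + N2)%N; rewrite !mul1r; apply => r /MM[].
  by [].
have P2 : 2^-1 * a * (dl / 2) - b * T <= - complex.Re (midsum g N z0 (- T)%:C).
  have N11 : (-1) ^+ 2 = 1 :> R by rewrite sqrrN expr1n.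
  have := peak (-1) N11 _ (N1 + N2)%N; rewrite !mulN1r; apply => r /MM[].
  by [].
have S1 : nm (midsum g N (z0 + T%:C) v) <= b * y.
  by apply: side => [|r /MM[]//]; rewrite ger0_norm // ltW.
have S2 : nm (midsum g N (z0 + (- T)%:C) v) <= b * y.
  by apply: side => [|r /MM[]//]; rewrite normrN ger0_norm // ltW.
have {}A := le_trans (rnormC_ge _) A; have {}B := le_trans (rnormC_ge _) B.
have {}S1 := le_trans (rnormC_ge _) S1; have {}S2 := le_trans (rnormC_ge _) S2.
move: A B S1 S2; rewrite !raddfB !raddfD /= !ler_norml.
move=> /andP[A1 A2] /andP[B1 B2] /andP[S11 S12] /andP[S21 S22].
have bE : b = M * a * expR (- u).
  rewrite /b -mulrA -expRD; congr (_ * expR _); rewrite /K; field.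
  by rewrite gt_eqF.
have Mu : (T + y) * M = u * dl / 8 by rewrite /u; field; rewrite gt_eqF.
have ue : u * expR (- u) <= 1 by have := expRN_small u0 ltr01; rewrite divr1.
have bTy : b * (T + y) = (u * expR (- u)) * (a * dl / 8).
  rewrite bE (_ : _ * (T + y) = ((T + y) * M) * (a * expR (- u))); last by ring.
  by rewrite Mu; ring.
(* In the difference of [A] and [B] the horizontal line gives at least [a * dl / 2 - 2 * b * T], the
   outer sides at most [2 * b * y] and the remainders at most [a * dl / 8], which is
   contradictory. *)
have := mulr_gt0 a0 dl0; have : b * (T + y) <= a * dl / 8.
  by rewrite bTy ler_piMl // divr_ge0 // mulr_ge0 // ltW.
lra.
Qed.

End IdentityTheorem.

(** * Positive functionals on C*-algebras *)

Section SemiInnerProduct.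
Variables (R : realType) (P : lmodType R[i]).
Implicit Types (f g h : P).
Local Notation nm z := (rnorm (z : R[i]^o)).

Record semi_inner (B : P -> P -> R[i]) : Prop := {
  semi_inner_linearl : forall k f g h, B (k *: f + g) h = k * B f h + B g h;
  semi_inner_linearr : forall k f g h, B h (k *: f + g) = k^* * B h f + B h g;
  semi_inner_ge0 : forall f, 0 <= B f f
}.

(** The bound is the value at the vertex [t = X / Y]; for [Y = 0] and [X != 0] the choice
    [t = (a + 1) / (2 * X)] would make the expression -1. *)
Lemma quadratic_ge0 (a X Y : R) : 0 <= a -> 0 <= Y ->
  (forall t, 0 <= a - 2 * t * X + t ^+ 2 * Y) -> X ^+ 2 <= a * Y.
Proof.
move=> a0; rewrite le0r => /predU1P[->|Y0] H.
  rewrite mulr0; have [->|X0] := eqVneq X 0; first by rewrite expr0n.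
  have := H ((a + 1) / (2 * X)).
  rewrite (_ : _ + _ = -1); last by field.
  by rewrite oppr_ge0 ler10.
have := H (X / Y); rewrite (_ : _ + _ = a - X ^+ 2 / Y); last by field; rewrite gt_eqF.
by rewrite subr_ge0 ler_pdivrMr.
Qed.

Variables (B : P -> P -> R[i]) (semiB : semi_inner B).

Lemma semi_innerDl f g h : B (f + g) h = B f h + B g h.
Proof. by have := semi_inner_linearl semiB 1 f g h; rewrite scale1r mul1r. Qed.

Lemma semi_innerDr f g h : B h (f + g) = B h f + B h g.
Proof. by have := semi_inner_linearr semiB 1 f g h; rewrite scale1r rmorph1 mul1r. Qed.

Lemma semi_inner0l h : B 0 h = 0.
Proof. by have := semi_innerDl 0 0 h; rewrite addr0 => /eqP;
  rewrite -subr_eq0 opprD addrA subrr sub0r oppr_eq0 => /eqP. Qed.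

Lemma semi_inner0r h : B h 0 = 0.
Proof. by have := semi_innerDr 0 0 h; rewrite addr0 => /eqP;
  rewrite -subr_eq0 opprD addrA subrr sub0r oppr_eq0 => /eqP. Qed.

Lemma semi_innerZl k f h : B (k *: f) h = k * B f h.
Proof. by have := semi_inner_linearl semiB k f 0 h; rewrite addr0 semi_inner0l addr0. Qed.

Lemma semi_innerZr k f h : B h (k *: f) = k^* * B h f.
Proof. by have := semi_inner_linearr semiB k f 0 h; rewrite addr0 semi_inner0r addr0. Qed.

Definition sqn f : R := complex.Re (B f f).

Lemma sqnE f : B f f = (sqn f)%:C.
Proof.
by rewrite /sqn; case: (B f f) (semi_inner_ge0 semiB f) => a b; rewrite lecE /= => /andP[/eqP -> _].
Qed.

Lemma sqn_ge0 f : 0 <= sqn f.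
Proof. by have := semi_inner_ge0 semiB f; rewrite sqnE lecR. Qed.

(** Symmetry is not an axiom of [semi_inner]; it follows because [B] is real on the diagonal, tested
    at [f + g] and [f + 'i *: g]. *)
Lemma semi_innerC f g : B f g = (B g f)^*.
Proof.
have H k : complex.Im (k^* * B f g + k * B g f) = 0.
  have := sqnE (f + k *: g); rewrite semi_innerDl !semi_innerDr !semi_innerZl !semi_innerZr !sqnE.
  have -> : (sqn f)%:C + k^* * B f g + (k * B g f + k * (k^* * (sqn g)%:C)) =
     (sqn f)%:C + (k^* * B f g + k * B g f) + k * k^* * (sqn g)%:C by ring.
  move/(congr1 (@complex.Im R)); rewrite !raddfD /=.
  rewrite (_ : complex.Im (k * k^* * _) = 0) ?addr0 ?add0r //.
  by case: k => a b /=; ring.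
have := H 1; have := H (Complex 0 1); case: (B f g) (B g f) => a b [c d] /= h1 h2.
by apply/eqP; rewrite eq_complex /=; apply/andP; split; apply/eqP; lra.
Qed.

Lemma sqn_sub k f g : sqn (f - k *: g) =
  sqn f - 2 * complex.Re (k^* * B f g) + nm k ^+ 2 * sqn g.
Proof.
rewrite rnorm_sqr -scaleNr /sqn semi_innerDl !semi_innerDr !semi_innerZl !semi_innerZr !sqnE.
rewrite (semi_innerC g f); case: k => a b; case: (B f g) => c d /=; ring.
Qed.

Lemma sqnB f g : sqn (f - g) = sqn f - 2 * complex.Re (B f g) + sqn g.
Proof.
have := sqn_sub 1 f g; rewrite scale1r rmorph1 mul1r => ->.
by rewrite (rnorm_real 1) normr1 expr1n mul1r.
Qed.

Lemma sqnD f g : sqn (f + g) = sqn f + 2 * complex.Re (B f g) + sqn g.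
Proof.
have := sqn_sub (-1) f g; rewrite scaleN1r opprK rmorphN rmorph1 mulN1r raddfN mulrN opprK.
by rewrite rnormN (rnorm_real 1) normr1 expr1n mul1r.
Qed.

Lemma sqnZ k f : sqn (k *: f) = nm k ^+ 2 * sqn f.
Proof.
rewrite /sqn semi_innerZl semi_innerZr sqnE rnorm_sqr; case: k => a b /=; ring.
Qed.

Lemma sqnN f : sqn (- f) = sqn f.
Proof. by rewrite -scaleN1r sqnZ // rnormN (rnorm_real 1) normr1 expr1n mul1r. Qed.

Lemma semi_inner_CS f g : nm (B f g) ^+ 2 <= sqn f * sqn g.
Proof.
(* The multiple [t * B f g] of [g] makes the cross term real. The surplus factor [nm (B f g) ^+ 2]
   is cancelled afterwards. *)
have H t : 0 <= sqn f - 2 * t * nm (B f g) ^+ 2 + t ^+ 2 * (nm (B f g) ^+ 2 * sqn g).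
  have := sqn_ge0 (f - (t%:C * B f g) *: g); rewrite sqn_sub rnormM rnorm_real exprMn.
  rewrite real_normK ?num_real // rnorm_sqr => /le_trans; apply.
  by rewrite le_eqVlt; apply/orP; left; apply/eqP; case: (B f g) => a b /=; ring.
have := quadratic_ge0 (sqn_ge0 f) (mulr_ge0 (sqr_ge0 _) (sqn_ge0 g)) H.
rewrite mulrCA expr2; have [->|] := eqVneq (nm (B f g) ^+ 2) 0.
  by rewrite mulr_ge0 ?sqn_ge0.
by move=> n0; rewrite ler_pM2l // lt0r n0 sqr_ge0.
Qed.

End SemiInnerProduct.

Section CStarAlgebra.
Variables (R : realType) (A : unitalCStarAlgType R).
Implicit Types (a b c h : A) (k : R[i]).

Lemma cmulDl a b c : (a + b) ** c = a ** c + b ** c.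
Proof. by have := cmul_linearl 1 a b c; rewrite !scale1r. Qed.

Lemma cmulDr a b c : a ** (b + c) = a ** b + a ** c.
Proof. by have := cmul_linearr 1 a b c; rewrite !scale1r. Qed.

Lemma cmul0l a : 0 ** a = 0.
Proof. by apply: (addIr (0 ** a)); rewrite -cmulDl !add0r. Qed.

Lemma cmul0r a : a ** 0 = 0.
Proof. by apply: (addIr (a ** 0)); rewrite -cmulDr !add0r. Qed.

Lemma cmulZl k a b : (k *: a) ** b = k *: (a ** b).
Proof. by have := cmul_linearl k a 0 b; rewrite cmul0l !addr0. Qed.

Lemma cmulZr k a b : a ** (k *: b) = k *: (a ** b).
Proof. by have := cmul_linearr k a b 0; rewrite cmul0r !addr0. Qed.

Lemma cmulNl a b : (- a) ** b = - (a ** b).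
Proof. by rewrite -[- a]scaleN1r cmulZl scaleN1r. Qed.

Lemma cmulNr a b : a ** (- b) = - (a ** b).
Proof. by rewrite -[- b]scaleN1r cmulZr scaleN1r. Qed.

Lemma cmulBl a b c : (a - b) ** c = a ** c - b ** c.
Proof. by rewrite cmulDl cmulNl. Qed.

Lemma cmulBr a b c : a ** (b - c) = a ** b - a ** c.
Proof. by rewrite cmulDr cmulNr. Qed.

Lemma starD a b : star (a + b) = star a + star b.
Proof. by have := star_semilinear 1 a b; rewrite rmorph1 !scale1r. Qed.

Lemma star0 : star (0 : A) = 0.
Proof. by apply: (addIr (star (0 : A))); rewrite -starD !add0r. Qed.

Lemma starZ k a : star (k *: a) = k^* *: star a.
Proof. by have := star_semilinear k a 0; rewrite star0 !addr0. Qed.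

Lemma starN a : star (- a) = - star a.
Proof. by rewrite -[- a]scaleN1r starZ rmorphN rmorph1 scaleN1r. Qed.

Lemma starB a b : star (a - b) = star a - star b.
Proof. by rewrite starD starN. Qed.

Lemma star_cone : star cone = cone :> A.
Proof. by rewrite -[RHS]starK -[in RHS](cmul1l (star cone)) starM !starK cmul1l. Qed.

Lemma rnorm_cmul a b : rnorm (a ** b) <= rnorm a * rnorm b.
Proof. by have := cnormM a b; rewrite !rnormE -rmorphM lecR. Qed.

Lemma rnorm_cstar a : rnorm (star a ** a) = rnorm a ^+ 2.
Proof. by apply: complexI; rewrite -rnormE cstar_identity rnormE rmorphXn. Qed.

Lemma rnorm_star a : rnorm (star a) = rnorm a.
Proof.
have H b : rnorm b <= rnorm (star b).
  have := rnorm_cmul (star b) b; rewrite rnorm_cstar expr2.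
  have [->|b0] := eqVneq (rnorm b) 0; first by rewrite rnorm_ge0.
  by rewrite ler_pM2r // lt0r b0 rnorm_ge0.
by apply/eqP; rewrite eq_le H -[X in _ <= rnorm X]starK H.
Qed.

End CStarAlgebra.

Lemma lipschitz_cont (R : realType) (V W : normedModType R[i]) (f : V -> W) (c : R) :
  (forall u v, rnorm (f u - f v) <= c * rnorm (u - v)) -> continuous f.
Proof.
move=> H u; apply/cvgrPdist_lt => e e0.
have e1 : 0 < complex.Re e by move: e0; rewrite ltcE => /andP[].
have c0 : 0 < 1 + `|c| by rewrite ltr_pwDl.
have eE : (complex.Re e)%:C = e.
  by move: e0; rewrite ltcE; case: (e) => x y /= /andP[/eqP -> _].
apply/nbhs_ballP; exists (complex.Re e / (1 + `|c|))%:C => /=.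
  by rewrite ltcR divr_gt0.
move=> v; rewrite -ball_normE /ball_ /= rnormE ltcR ltr_pdivlMr // => uv.
rewrite rnormE -eE ltcR; apply: le_lt_trans (H u v) _; apply: le_lt_trans uv.
rewrite [_ * (1 + _)]mulrC; apply: ler_wpM2r; first exact: rnorm_ge0.
by apply: le_trans (ler_norm c) _; rewrite lerDr.
Qed.

Lemma geometric_cvg (R : realType) (V : completeNormedModType R[i]) (u : nat -> V) (c r : R) :
  0 <= r -> r < 1 -> 0 <= c -> (forall k, rnorm (u k.+1 - u k) <= c * r ^+ k) ->
  exists l, forall e : R, 0 < e -> exists N, forall k, (N <= k)%N -> rnorm (l - u k) < e.
Proof.
move=> r0 r1 c0 H; have r1' : 0 < 1 - r by rewrite subr_gt0.
have r1i : 0 <= (1 - r)^-1 by rewrite invr_ge0 ltW.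
have tail n k : rnorm (u (n + k)%N - u n) <= c * r ^+ n / (1 - r) * (1 - r ^+ k).
  elim: k => [|k IH]; first by rewrite addn0 subrr rnorm0 expr0 subrr mulr0.
  rewrite -(subrK (u (n + k)%N) (u (n + k.+1)%N)) -addrA.
  apply: le_trans (rnormD _ _) _; apply: le_trans (lerD _ IH) _; first by rewrite addnS; exact: H.
  rewrite le_eqVlt exprD exprS; apply/orP; left; apply/eqP; field.
  by rewrite gt_eqF.
have tail' n k : (n <= k)%N -> rnorm (u k - u n) <= c * r ^+ n / (1 - r).
  move=> nk; rewrite -(subnKC nk); apply: le_trans (tail _ _) _.
  rewrite ler_piMr // ?mulr_ge0 ?exprn_ge0 //.
  by rewrite gerBl exprn_ge0.
have small e : 0 < e -> exists N, c * r ^+ N / (1 - r) < e.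
  move=> e0; have : (fun k => c / (1 - r) * r ^+ k) @ \oo --> c / (1 - r) * 0.
    by apply: cvgMr; apply: cvg_expr; rewrite ger0_norm.
  rewrite mulr0 => /cvgrPdist_lt /(_ e e0)[k _ /(_ k (leqnn _))] /=.
  rewrite sub0r normrN ger0_norm ?mulr_ge0 ?exprn_ge0 //.
  by move=> He; exists k; rewrite mulrAC.
have cu : cvg (u @ \oo).
  apply: cauchy_cvg; apply: cauchy_exP => e e0.
  have e1 : 0 < complex.Re e by move: e0; rewrite ltcE => /andP[].
  have eE : (complex.Re e)%:C = e.
    by move: e0; rewrite ltcE; case: (e) => x y /= /andP[/eqP -> _].
  have [N NP] := small _ e1; exists (u N); exists N => // k /= Nk.
  rewrite -ball_normE /ball_ /= rnormE rnormB -eE ltcR.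
  exact: le_lt_trans (tail' _ _ Nk) NP.
exists (lim (u @ \oo)) => e e0; have e0' : 0 < e%:C by rewrite ltcR.
have /cvgrPdist_lt /(_ _ e0')[N _ NP] := cu; exists N => k /NP /=.
by rewrite rnormE ltcR.
Qed.

(** * Square roots of 1 - h and the norm of a state *)

Section PositiveFunctionals.
Variables (R : realType) (A : unitalCStarAlgType R).
Implicit Types (a b c h : A).
Local Notation nm z := (rnorm (z : R[i]^o)).

(* Writing y = 1 - s turns the equation into s = (h + s^2) / 2, whose right-hand
   side is a contraction of the ball of radius |h|. *)
Lemma cstar_sqrt h : star h = h -> rnorm h < 1 ->
  exists2 y : A, star y = y & y ** y = cone - h.
Proof.
move=> hh h1; set r := rnorm h in h1; have r0 : 0 <= r := rnorm_ge0 _.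
pose F (s : A) : A := (2^-1 : R[i]) *: (h + s ** s).
have n2 : nm (2^-1 : R[i]) = 2^-1.
  by rewrite (_ : 2^-1 = (2^-1 : R)%:C) ?rnorm_real ?gtr0_norm // fmorphV rmorph_nat.
have FB s t : rnorm s <= r -> rnorm t <= r -> rnorm (F s - F t) <= r * rnorm (s - t).
  move=> hs ht; rewrite /F -scalerBr rnormZ n2 opprD addrACA subrr add0r.
  have -> : s ** s - t ** t = (s - t) ** s + t ** (s - t).
    by rewrite cmulBl cmulBr addrA subrK.
  have := rnormD ((s - t) ** s) (t ** (s - t)).
  have := rnorm_cmul (s - t) s; have := rnorm_cmul t (s - t); have := rnorm_ge0 (s - t).
  by nra.
have Fr s : rnorm s <= r -> rnorm (F s) <= r.
  move=> hs; rewrite /F rnormZ n2; have := rnormD h (s ** s); rewrite -/r.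
  by have := rnorm_cmul s s; have := rnorm_ge0 s; nra.
pose s (k : nat) := iter k F 0.
have sr k : rnorm (s k) <= r by elim: k => [|k IH]; [rewrite /= rnorm0 | exact: Fr].
have sS k : rnorm (s k.+1 - s k) <= r * r ^+ k.
  elim: k => [|k IH]; first by rewrite expr0 mulr1 /= subr0; apply: (sr 1%N).
  apply: (@le_trans _ _ (r * rnorm (s k.+1 - s k))); first exact: (FB (s k.+1) (s k)).
  by rewrite exprS ler_wpM2l.
have ss k : star (s k) = s k.
  by elim: k => [|k IH] /=; rewrite ?star0 // /F starZ starD starM IH hh fmorphV rmorph_nat.
have [l lP] := geometric_cvg r0 h1 r0 sS.
have sl : star l = l.
  apply/eqP; rewrite -subr_eq0; apply/eqP; apply: rnorm_eq0; apply/eqP.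
  rewrite eq_le rnorm_ge0 andbT; apply/ler_addgt0Pr => e e0; rewrite add0r.
  have e2 : 0 < e / 2 by rewrite divr_gt0.
  have [N /(_ N (leqnn _)) NP] := lP _ e2.
  have -> : star l - l = star (l - s N) - (l - s N) by rewrite starB ss opprB addrA subrK.
  by have := rnormD (star (l - s N)) (- (l - s N)); rewrite rnormN rnorm_star; lra.
have Fl : F l = l.
  apply/eqP; rewrite eq_sym -subr_eq0; apply/eqP; apply: rnorm_eq0; apply/eqP.
  rewrite eq_le rnorm_ge0 andbT; apply/ler_addgt0Pr => e e0; rewrite add0r.
  have l0 := rnorm_ge0 l; have c0 : 0 < 1 + rnorm l + r by lra.
  have e2 : 0 < e / (1 + rnorm l + r) by rewrite divr_gt0.
  have [N NP] := lP _ e2; have := NP N (leqnn _); have := NP N.+1 (leqnSn _).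
  rewrite !ltr_pdivlMr // => N1 N2.
  have -> : l - F l = (l - s N.+1) + (F (s N) - F l) by rewrite addrA subrK.
  have : rnorm (F (s N) - F l) <= 2^-1 * ((rnorm l + r) * rnorm (l - s N)).
    rewrite /F -scalerBr rnormZ n2 opprD addrACA subrr add0r ler_pM2l ?invr_gt0 //.
    have -> : s N ** s N - l ** l = - ((l - s N) ** s N + l ** (l - s N)).
      by rewrite cmulBl cmulBr [in RHS]addrC [in RHS]addrA subrK opprB.
    rewrite rnormN; have := rnormD ((l - s N) ** s N) (l ** (l - s N)).
    have := rnorm_cmul (l - s N) (s N); have := rnorm_cmul l (l - s N).
    have := sr N; have := rnorm_ge0 (l - s N); nra.
  have := rnormD (l - s N.+1) (F (s N) - F l).
  have := rnorm_ge0 (l - s N.+1); have := rnorm_ge0 (l - s N); nra.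
exists (cone - l); first by rewrite starB star_cone sl.
have E : h + l ** l = l + l.
  have := congr1 (fun a => (2 : R[i]) *: a) Fl;
    rewrite /F scalerA divff ?pnatr_eq0 // scale1r => ->.
  by rewrite scaler_nat mulr2n.
have -> : h = l + l - l ** l by rewrite -E addrK.
by rewrite cmulBl !cmulBr !cmul1l cmul1r !opprB addrA opprD -!addrA [- l + _]addrC -addrA.
Qed.

Definition positive_functional (f : A -> R[i]) : Prop :=
  scalar f /\ forall a, 0 <= f (star a ** a).

Section Functional.
Variables (f : A -> R[i]) (posf : positive_functional f).

Lemma functionalD a b : f (a + b) = f a + f b.
Proof. by have := posf.1 1 a b; rewrite scale1r mul1r. Qed.

Lemma functional0 : f 0 = 0.
Proof. by have := functionalD 0 0; rewrite addr0 => /eqP;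
  rewrite -subr_eq0 opprD addrA subrr sub0r oppr_eq0 => /eqP. Qed.

Lemma functionalZ k a : f (k *: a) = k * f a.
Proof. by have := posf.1 k a 0; rewrite functional0 !addr0. Qed.

Lemma functionalB a b : f (a - b) = f a - f b.
Proof. by rewrite functionalD -[- b]scaleN1r functionalZ mulN1r. Qed.

Lemma semi_inner_functional : semi_inner (fun a b => f (star b ** a)).
Proof.
split=> [k a b c|k a b c|a]; last exact: posf.2.
  by rewrite cmulDr cmulZr functionalD functionalZ.
by rewrite starD starZ cmulDl cmulZl functionalD functionalZ.
Qed.

Lemma functional_star a : f (star a) = (f a)^*.
Proof.
by have := semi_innerC semi_inner_functional cone a; rewrite cmul1r star_cone cmul1l.
Qed.

(** For [c > rnorm h] the element [cone - c^-1 h] is a square [y ** y] with [y] selfadjoint, so [f]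
    is nonnegative on it and [f h <= c * f cone]; then [c] tends to [rnorm h]. *)
Lemma functional_le h : star h = h -> complex.Re (f h) <= rnorm h * complex.Re (f cone).
Proof.
move=> hh; have f1 : 0 <= complex.Re (f cone).
  by have := sqn_ge0 semi_inner_functional cone; rewrite /sqn star_cone cmul1l.
apply/ler_addgt0Pr => e e0.
have e'0 : 0 < e / (1 + complex.Re (f cone)) by rewrite divr_gt0 // ltr_pwDl.
set e' := e / _ in e'0; pose c := rnorm h + e'.
have c0 : 0 < c by rewrite ltr_wpDl // rnorm_ge0.
have [||y yy ye] := @cstar_sqrt ((c^-1)%:C *: h).
- by rewrite starZ hh; congr (_ *: _); apply/eqP; rewrite eq_complex /= oppr0 !eqxx.
- rewrite rnormZ rnorm_real gtr0_norm ?invr_gt0 // mulrC ltr_pdivrMr // mul1r.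
  by rewrite /c ltrDl.
have := sqn_ge0 semi_inner_functional y; rewrite /sqn yy ye functionalB functionalZ.
rewrite raddfB /= (_ : complex.Re (_ * _) = c^-1 * complex.Re (f h)); last first.
  by case: (f h) => p q /=; rewrite mul0r subr0.
rewrite subr_ge0 mulrC ler_pdivrMr // => /le_trans; apply.
have -> : complex.Re (f cone) * c = rnorm h * complex.Re (f cone) + e' * complex.Re (f cone).
  by rewrite /c; ring.
rewrite lerD2l /e' mulrAC ler_pdivrMr ?ltr_pwDl // mulrDr mulr1 lerDr.
exact: ltW.
Qed.

Lemma functional_conj c : positive_functional (fun a => f (star c ** a ** c)).
Proof.
split=> [k a b|a]; first by rewrite cmulDr cmulDl cmulZr cmulZl functionalD functionalZ.
by rewrite cmulA -cmulA -starM; exact: posf.2.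
Qed.

End Functional.

Lemma state_positive_functional (f : A -> R[i]) : is_state f -> positive_functional f.
Proof. by case. Qed.

Lemma state_CS (f : A -> R[i]) a b : is_state f ->
  nm (f (star b ** a)) ^+ 2 <= complex.Re (f (star a ** a)) * complex.Re (f (star b ** b)).
Proof.
by move=> sf; exact: (semi_inner_CS (semi_inner_functional (state_positive_functional sf)) a b).
Qed.

Lemma state_sqn_le (f : A -> R[i]) a : is_state f ->
  complex.Re (f (star a ** a)) <= rnorm a ^+ 2.
Proof.
move=> sf; have := functional_le (state_positive_functional sf) (h := star a ** a).
by rewrite (state1 sf) mulr1 rnorm_cstar; apply; rewrite starM starK.
Qed.

(** [functional_le] speaks of selfadjoint elements; Cauchy-Schwarz against the unit reduces a
    general [a] to [star a ** a]. *)
Lemma state_le (f : A -> R[i]) a : is_state f -> nm (f a) <= rnorm a.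
Proof.
move=> sf; rewrite -(@ler_pXn2r _ 2) ?nnegrE ?rnorm_ge0 //.
have := state_CS a cone sf; rewrite star_cone !cmul1l (state1 sf) mulr1 => /le_trans; apply.
exact: state_sqn_le.
Qed.

End PositiveFunctionals.

(** * Hilbert completion of a semi-inner product *)

Section AntilinearDual.
Variables (R : realType) (P : lmodType R[i]).
Implicit Types (f g h : P) (phi psi : P -> R[i]^o).
Local Notation nm z := (rnorm (z : R[i]^o)).

(** Antilinear, because [B] is so in its second argument and a vector [g] is to embed linearly as
    [B g]. *)
Definition bounded_antilinear (B : P -> P -> R[i]) : {pred (P -> R[i]^o)} :=
  fun phi => `[< (forall k f g, phi (k *: f + g) = k^* * phi f + phi g) /\
    exists2 c : R, 0 <= c & forall f, nm (phi f) ^+ 2 <= c * sqn B f >].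

Lemma bounded_antilinearP B phi : reflect
  ((forall k f g, phi (k *: f + g) = k^* * phi f + phi g) /\
    exists2 c : R, 0 <= c & forall f, nm (phi f) ^+ 2 <= c * sqn B f)
  (phi \in bounded_antilinear B).
Proof. exact: asboolP. Qed.

Variables (B : P -> P -> R[i]).

Lemma bounded_antilinear_submod : submod_closed (bounded_antilinear B).
Proof.
split=> [|k phi psi /bounded_antilinearP[phiL [c c0 phiB]] /bounded_antilinearP[psiL [d d0 psiB]]].
  apply/bounded_antilinearP; split=> [k f g|]; first by rewrite mulr0 addr0.
  by exists 0 => // f; rewrite mul0r rnorm0 expr0n.
apply/bounded_antilinearP; split=> [l f g|].
  have e u : (k *: phi + psi) u = k * phi u + psi u by [].
  by rewrite !e phiL psiL; ring.
exists (2 * nm k ^+ 2 * c + 2 * d).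
  by rewrite addr_ge0 // mulr_ge0 // mulr_ge0 // sqr_ge0.
move=> f; have e : (k *: phi + psi) f = k * phi f + psi f by [].
have := rnormD (k * phi f : R[i]^o) (psi f); rewrite rnormM -e => h1.
have := phiB f; have := psiB f; have := rnorm_ge0 ((k *: phi + psi) f).
move: (nm (_ f)) (nm k) (nm (phi f)) (nm (psi f)) (sqn B f) h1 => t z y x s h1 t0 h2 h3.
have : t ^+ 2 <= (z * y + x) ^+ 2 by rewrite ler_pXn2r // nnegrE // (le_trans t0).
have := sqr_ge0 (z * y - x); have : z ^+ 2 * y ^+ 2 <= z ^+ 2 * (c * s).
  by rewrite ler_wpM2l // sqr_ge0.
nra.
Qed.

HB.instance Definition _ := GRing.isSubmodClosed.Build R[i] _ (bounded_antilinear B)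
  bounded_antilinear_submod.

Definition antidual (semiB : semi_inner B) := {phi : P -> R[i]^o | phi \in bounded_antilinear B}.

Variable semiB : semi_inner B.
Local Notation H := (antidual semiB).

HB.instance Definition _ := SubType.on H.
HB.instance Definition _ := Choice.on H.
HB.instance Definition _ := [SubChoice_isSubLmodule of H by <:].

Implicit Types (u v : H).

Lemma Re_conj_real (r : R) (z : R[i]) : complex.Re ((r%:C)^* * z) = r * complex.Re z.
Proof. by case: z => a b /=; ring. Qed.

Lemma Re_conj_inv (k z : R[i]) : k != 0 ->
  nm k ^+ 2 * complex.Re ((k^-1)^* * z) = complex.Re (k * z).
Proof.
rewrite rnorm_sqr; case: k => a b; case: z => c d; rewrite eq_complex /= => ab0.
have n0 : a ^+ 2 + b ^+ 2 != 0 by rewrite paddr_eq0 ?sqr_ge0 // !sqrf_eq0.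
by field.
Qed.

Lemma antidual_linear u k f g : val u (k *: f + g) = k^* * val u f + val u g.
Proof. by have /bounded_antilinearP[] := valP u. Qed.

Lemma antidualD u f g : val u (f + g) = val u f + val u g.
Proof. by have := antidual_linear u 1 f g; rewrite scale1r rmorph1 mul1r. Qed.

Lemma antidual0 u : val u 0 = 0.
Proof.
have := antidualD u 0 0; rewrite addr0 => /eqP.
by rewrite -subr_eq0 opprD addrA subrr sub0r oppr_eq0 => /eqP.
Qed.

Lemma antidualZ u k f : val u (k *: f) = k^* * val u f.
Proof. by have := antidual_linear u k f 0; rewrite antidual0 !addr0. Qed.

Lemma antidualN u f : val u (- f) = - val u f.
Proof. by rewrite -scaleN1r antidualZ rmorphN rmorph1 mulN1r. Qed.

Lemma antidualE_D u v f : val (u + v) f = val u f + val v f.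
Proof. by []. Qed.

Lemma antidualE_Z k u f : val (k *: u) f = k * val u f.
Proof. by []. Qed.

Lemma antidualE_N u f : val (- u) f = - val u f.
Proof. by []. Qed.

Lemma antidualP u v : (forall f, val u f = val v f) -> u = v.
Proof. by move=> uv; apply: val_inj; apply/funext. Qed.

Local Notation q f := (sqn B f).

(* The square of the dual norm: for the functional <g, .> the supremum is <g, g>,
   attained at [f = g]. *)
Definition dsqn u : R := sup (range (fun f => 2 * complex.Re (val u f) - q f)).

Lemma dsqn_has_sup u : has_sup (range (fun f => 2 * complex.Re (val u f) - q f)).
Proof.
split; first by exists (2 * complex.Re (val u 0) - q 0); exists 0.
have /bounded_antilinearP[_ [c c0 uB]] := valP u; exists c => _ [f _ <-].
have := uB f; have := rnormC_ge (val u f); rewrite ler_norml => /andP[_].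
have := rnorm_ge0 (val u f : R[i]^o); have := sqn_ge0 semiB f.
move: (nm _) (q f) (complex.Re _) => x y z y0 x0 zx xy; rewrite lerBlDr.
apply: (@le_trans _ _ (2 * x)); first by rewrite ler_pM2l.
rewrite -(@ler_pXn2r _ 2) ?nnegrE ?mulr_ge0 ?addr_ge0 //.
by have := sqr_ge0 (c - y); rewrite sqrrB sqrrD exprMn; nra.
Qed.

Lemma dsqn_ub u f : 2 * complex.Re (val u f) - q f <= dsqn u.
Proof. by apply: sup_upper_bound; [exact: dsqn_has_sup | exists f]. Qed.

Lemma dsqn_le u c : (forall f, 2 * complex.Re (val u f) - q f <= c) -> dsqn u <= c.
Proof. by move=> H; apply: ge_sup; [case: (dsqn_has_sup u) | move=> _ [f _ <-]]. Qed.

Lemma dsqn_ge0 u : 0 <= dsqn u.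
Proof. by have := dsqn_ub u 0; rewrite antidual0 /sqn semi_inner0l //= mulr0 subr0. Qed.

(** Testing the supremum at the vectors [t * val u f] times [f], for all real [t], gives a quadratic
    inequality as in Cauchy-Schwarz. *)
Lemma dsqn_bound u f : nm (val u f) ^+ 2 <= dsqn u * q f.
Proof.
set X := nm _ ^+ 2; have H t : 0 <= dsqn u - 2 * t * X + t ^+ 2 * (X * q f).
  have := dsqn_ub u ((t%:C * val u f) *: f).
  rewrite sqnZ // antidualZ rnormM rnorm_real exprMn real_normK ?num_real // -/X.
  rewrite (_ : complex.Re (_ * _) = t * X); first lra.
  by rewrite /X rnorm_sqr; case: (val u f) => a b /=; ring.
have X0 : 0 <= X := sqr_ge0 _.
have := quadratic_ge0 (dsqn_ge0 u) (mulr_ge0 X0 (sqn_ge0 semiB _)) H.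
rewrite mulrCA expr2; have [->|n0] := eqVneq X 0.
  by rewrite mulr_ge0 ?sqn_ge0 ?dsqn_ge0.
by rewrite ler_pM2l // lt0r n0.
Qed.

Lemma dsqn_eq0 u : dsqn u = 0 -> u = 0.
Proof.
move=> u0; apply: antidualP => f; apply: (@rnorm_eq0 R R[i]^o); apply/eqP.
rewrite -(@sqrf_eq0) eq_le sqr_ge0 andbT.
by apply: le_trans (dsqn_bound u f) _; rewrite u0 mul0r.
Qed.

Lemma dsqnZ_le k u : k != 0 -> dsqn (k *: u) <= nm k ^+ 2 * dsqn u.
Proof.
move=> k0; apply: dsqn_le => f; rewrite antidualE_Z.
have nk0 : 0 < nm k ^+ 2.
  by rewrite exprn_gt0 // lt0r rnorm_ge0 andbT; apply: contraNneq k0 => /(@rnorm_eq0 R R[i]^o) ->.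
have := dsqn_ub u (k^-1 *: f); rewrite -(ler_pM2l nk0) => H; apply: (le_trans _ H).
rewrite antidualZ sqnZ // mulrBr le_eqVlt; apply/orP; left; apply/eqP; congr (_ - _); last first.
  rewrite mulrA -exprMn -rnormM mulrV ?unitfE //.
  by rewrite (rnorm_real 1) normr1 expr1n mul1r.
rewrite mulrCA; congr (_ * _).
by rewrite Re_conj_inv.
Qed.

Lemma dsqn0 : dsqn 0 = 0.
Proof.
apply/eqP; rewrite eq_le dsqn_ge0 andbT; apply: dsqn_le => f.
by rewrite mulr0 sub0r oppr_le0 sqn_ge0.
Qed.

Lemma dsqnZ k u : dsqn (k *: u) = nm k ^+ 2 * dsqn u.
Proof.
have [->|k0] := eqVneq k 0; first by rewrite scale0r dsqn0 rnorm0 expr0n mul0r.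
apply/eqP; rewrite eq_le dsqnZ_le //=.
have nk0 : 0 < nm k ^+ 2.
  by rewrite exprn_gt0 // lt0r rnorm_ge0 andbT; apply: contraNneq k0 => /(@rnorm_eq0 R R[i]^o) ->.
have := dsqnZ_le (k *: u) (invr_neq0 k0); rewrite scalerA mulVf // scale1r -(ler_pM2l nk0).
move=> /le_trans; apply; rewrite mulrA -exprMn -rnormM mulfV //.
by rewrite (rnorm_real 1) normr1 expr1n mul1r.
Qed.

Lemma dsqnN u : dsqn (- u) = dsqn u.
Proof. by rewrite -scaleN1r dsqnZ rnormN (rnorm_real 1) normr1 expr1n mul1r. Qed.

(** If [f] tests [u + v] and [g] tests [u - v], then [(f + g) / 2] tests [u] and [(f - g) / 2] tests
    [v]; the parallelogram identity of [B] balances the quadratic terms. *)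
Lemma dsqn_parallelogram_le u v :
  dsqn (u + v) + dsqn (u - v) <= 2 * dsqn u + 2 * dsqn v.
Proof.
rewrite -lerBrDr; apply: dsqn_le => f; rewrite lerBrDr -lerBrDl; apply: dsqn_le => g.
pose hf : R[i] := (2^-1 : R)%:C.
have := dsqn_ub u (hf *: (f + g)); have := dsqn_ub v (hf *: (f - g)).
rewrite !antidualZ !sqnZ // !antidualE_D antidualE_N !antidualD antidualN sqnB // sqnD //.
have -> : nm hf ^+ 2 = 4^-1 by rewrite rnorm_real gtr0_norm // exprVn -natrX.
rewrite !Re_conj_real.
by rewrite !raddfD !raddfN /=; lra.
Qed.

(** The reverse inequality is the same one applied to [u + v] and [u - v]. *)
Lemma dsqn_parallelogram u v : dsqn (u + v) + dsqn (u - v) = 2 * dsqn u + 2 * dsqn v.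
Proof.
apply/eqP; rewrite eq_le dsqn_parallelogram_le /=.
have := dsqn_parallelogram_le (u + v) (u - v).
have dbl w : dsqn (w + w) = 4 * dsqn w.
  have -> : w + w = (2 : R[i]) *: w by rewrite scaler_nat mulr2n.
  rewrite dsqnZ; congr (_ * _).
  rewrite (_ : 2 = (2 : R)%:C) ?rnorm_real ?ger0_norm -?natrX //.
  by rewrite rmorph_nat.
rewrite addrACA subrr addr0 dbl opprB [u + v + (v - u)]addrC [v - u + _]addrA subrK dbl.
lra.
Qed.

End AntilinearDual.

(** * The antilinear dual as a Hilbert space *)

Section AntilinearDualNorm.
Variables (R : realType) (P : lmodType R[i]) (B : P -> P -> R[i]).
Variable semiB : semi_inner B.
Local Notation H := (antidual semiB).
Implicit Types (f g h : P) (u v w : H).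
Local Notation nm z := (rnorm (z : R[i]^o)).
Local Notation q f := (sqn B f).

Definition adnorm u : R := Num.sqrt (dsqn u).

Lemma adnorm_ge0 u : 0 <= adnorm u.
Proof. exact: sqrtr_ge0. Qed.

Lemma adnorm_sqr u : adnorm u ^+ 2 = dsqn u.
Proof. by rewrite sqr_sqrtr // dsqn_ge0. Qed.

Lemma adnorm_bound u f : nm (val u f) <= adnorm u * Num.sqrt (q f).
Proof.
rewrite -(@ler_pXn2r _ 2) ?nnegrE ?rnorm_ge0 ?mulr_ge0 ?sqrtr_ge0 //.
by rewrite exprMn adnorm_sqr sqr_sqrtr ?sqn_ge0 // dsqn_bound.
Qed.

Lemma adnorm_le u c : 0 <= c -> (forall f, nm (val u f) <= c * Num.sqrt (q f)) -> adnorm u <= c.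
Proof.
move=> c0 uc; rewrite -(@ler_pXn2r _ 2) ?nnegrE ?adnorm_ge0 // adnorm_sqr.
apply: dsqn_le => f; have := uc f; have := rnormC_ge (val u f); rewrite ler_norml => /andP[_].
have := sqr_sqrtr (sqn_ge0 semiB f); move: (Num.sqrt _) => s <- h1 h2.
have := sqr_ge0 (c - s); rewrite sqrrB; lra.
Qed.

Lemma adnormD u v : adnorm (u + v) <= adnorm u + adnorm v.
Proof.
apply: adnorm_le => [|f]; first by rewrite addr_ge0 ?adnorm_ge0.
rewrite antidualE_D mulrDl; apply: le_trans (rnormD _ _) _.
by apply: lerD; exact: adnorm_bound.
Qed.

Lemma adnormB u v : adnorm (u - v) = adnorm (v - u).
Proof. by rewrite -opprB /adnorm dsqnN. Qed.

Lemma adnormZ k u : adnorm (k *: u) = nm k * adnorm u.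
Proof.
by rewrite /adnorm dsqnZ sqrtrM ?sqr_ge0 // sqrtr_sqr ger0_norm // rnorm_ge0.
Qed.

Lemma adnorm_eq0 u : adnorm u = 0 -> u = 0.
Proof. by move=> u0; apply: dsqn_eq0; rewrite -adnorm_sqr u0 expr0n. Qed.

Let normH u : R[i] := (adnorm u)%:C.

Lemma normH_triangle u v : normH (u + v) <= normH u + normH v.
Proof. by rewrite /normH -rmorphD lecR adnormD. Qed.

Lemma normHZ (k : R[i]) u : normH (k *: u) = `|k| * normH u.
Proof. by rewrite /normH adnormZ rmorphM (rnormE (k : R[i]^o)). Qed.

Lemma normH_eq0 u : normH u = 0 -> u = 0.
Proof. by move=> /complexI /adnorm_eq0. Qed.

HB.instance Definition _ := Lmodule_isNormed.Build R[i] H normH_triangle normHZ normH_eq0.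

Lemma antidual_rnorm u : rnorm u = adnorm u.
Proof. by []. Qed.

(** By [adnorm_bound] the evaluation at each [f] is Lipschitz, so it converges along [F] to some
    [L f]; [L] inherits antilinearity and a bound, and is then the limit in norm. *)
Lemma antidual_complete (F : set_system H) : ProperFilter F -> cauchy F -> cvg F.
Proof.
move=> FF /cauchyP cF.
have cF' e : 0 < e -> exists x : H, F [set y | adnorm (x - y) < e].
  move=> e0; have e0' : 0 < e%:C by rewrite ltcR.
  have [x Fx] := cF _ e0'; exists x; apply: filterS Fx => y.
  by rewrite -ball_normE /ball_ /= rnormE ltcR.
have cG (G : H -> R) f : (forall x y, `|G x - G y| <= nm (val (x - y) f)) ->
    exists l, forall e : R, 0 < e -> F [set y | `|l - G y| < e].
  move=> GB; have /cvg_ex[l lP] : cvg (G @ F).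
    apply: R_complete; apply/cauchy_exP => e e0.
    have s0 : 0 < 1 + Num.sqrt (q f) by rewrite ltr_pwDl // sqrtr_ge0.
    have [x Fx] := cF' _ (divr_gt0 e0 s0); exists (G x).
    rewrite -[_ (ball _ _)]/(F (G @^-1` ball (G x) e)); apply: filterS Fx => y.
    rewrite -ball_normE /ball_ /= ltr_pdivlMr // => xy; apply: le_lt_trans (GB x y) _.
    apply: le_lt_trans (adnorm_bound _ _) _; apply: le_lt_trans xy.
    by rewrite ler_wpM2l ?adnorm_ge0 // lerDr.
  by exists l => e e0; move/cvgrPdist_lt : lP; apply.
have /choice[L LP] : forall f, exists z : R[i], forall e : R, 0 < e ->
    F [set y | nm (val y f - z) < e].
  move=> f.
  have [x y|a aP] := @cG (fun u => complex.Re (val u f)) f.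
    by rewrite -raddfB; exact: rnormC_ge.
  have [x y|b bP] := @cG (fun u => complex.Im (val u f)) f.
    by rewrite -raddfB; exact: rnormC_ge_Im.
  exists (Complex a b) => e e0; have e2 : 0 < e / 2 by rewrite divr_gt0.
  apply: filterS2 (aP _ e2) (bP _ e2) => y /= h1 h2.
  apply: le_lt_trans (rnorm_le_sum _) _; rewrite !raddfB /= distrC [X in _ + X]distrC.
  lra.
have Lle (z : R[i]) (c : R) : (forall e : R, 0 < e -> nm z <= c + e) -> nm z <= c.
  by move=> zc; apply/ler_addgt0Pr => e e0; exact: zc.
have LL : (L : P -> R[i]^o) \in bounded_antilinear B.
  apply/bounded_antilinearP; split=> [k f g|].
    apply/eqP; rewrite -subr_eq0; apply/eqP; apply: (@rnorm_eq0 R R[i]^o); apply/eqP.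
    rewrite eq_le rnorm_ge0 andbT; apply: Lle => e e0; rewrite add0r.
    have k0 : 0 < 2 + nm k by rewrite ltr_pwDl // rnorm_ge0.
    have e1 : 0 < e / (2 + nm k) by rewrite divr_gt0.
    have [y /= [[h1 h2] h3]] := filter_ex (filterI (filterI (LP f _ e1) (LP g _ e1)) (LP (k *: f + g) _ e1)).
    rewrite (_ : _ - _ = - (val y (k *: f + g) - L (k *: f + g)) + k^* * (val y f - L f) + (val y g - L g)); last first.
      by rewrite antidual_linear; ring.
    move: h1 h2 h3; rewrite !ltr_pdivlMr // => h1 h2 h3.
    apply: le_trans (rnormD _ _) _; apply: le_trans (lerD (rnormD _ _) (lexx _)) _.
    rewrite rnormN rnormM.
    have -> : nm (k^*) = nm k by rewrite /rnorm normcJ.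
    have n1 := rnorm_ge0 (val y f - L f : R[i]^o); have n2 := rnorm_ge0 (val y g - L g : R[i]^o).
    have n3 := rnorm_ge0 (val y (k *: f + g) - L (k *: f + g) : R[i]^o);
      have nk := rnorm_ge0 (k : R[i]^o).
    move: (nm (_ - L f)) (nm (_ - L g)) (nm (_ - L (_ + _))) (nm k) k0 {e1} h1 h2 h3 n1 n2 n3 nk => a b c d k0 h1 h2 h3 a0 b0 c0 d0.
    have a1 : a < e / (2 + d) by rewrite ltr_pdivlMr.
    have b1 : b < e / (2 + d) by rewrite ltr_pdivlMr.
    have c1 : c < e / (2 + d) by rewrite ltr_pdivlMr.
    have E : e = 2 * (e / (2 + d)) + d * (e / (2 + d)) by field; rewrite gt_eqF.
    have : d * a <= d * (e / (2 + d)) by rewrite ler_wpM2l // ltW.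
    lra.
  have [x Fx] := cF' 1 ltr01; exists ((adnorm x + 1) ^+ 2); first exact: sqr_ge0.
  move=> f; have x1 : 0 <= adnorm x + 1 by rewrite addr_ge0 ?adnorm_ge0.
  rewrite -[X in _ * X](sqr_sqrtr (sqn_ge0 semiB f)) -exprMn.
  rewrite ler_pXn2r ?nnegrE ?rnorm_ge0 ?mulr_ge0 ?sqrtr_ge0 //.
  apply: Lle => e e0; have [y /= [h1 h2]] := filter_ex (filterI Fx (LP f _ e0)).
  rewrite (_ : L f = val y f - (val y f - L f)); last by ring.
  apply: le_trans (rnormD _ _) _; rewrite rnormN; apply: lerD; last exact: ltW.
  apply: le_trans (adnorm_bound _ _) _; rewrite ler_wpM2r ?sqrtr_ge0 //.
  rewrite -[y](subrK x); apply: le_trans (adnormD _ _) _.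
  by rewrite addrC lerD2l -opprB /adnorm dsqnN -/(adnorm _) ltW.
have [l lE] : exists l : H, forall f, val l f = L f by exists (exist _ (L : P -> R[i]^o) LL).
apply/cvg_ex; exists l; apply/cvgrPdist_le => e e0.
have e1 : 0 < complex.Re e by move: e0; rewrite ltcE => /andP[].
have eE : (complex.Re e)%:C = e.
  by move: e0; rewrite ltcE; case: (e) => a b /= /andP[/eqP -> _].
have e2 : 0 < complex.Re e / 2 by rewrite divr_gt0.
have [x Fx] := cF' _ e2; apply: filterS (Fx) => u /= xu; rewrite rnormE -eE lecR antidual_rnorm.
apply: adnorm_le => [|f]; first exact: ltW.
(* [y] depends on [f] and only transports the bound: [u] and [y] both lie within [complex.Re e / 2]
   of the fixed [x]. *)
have E (y : H) : val (l - u) f = (val (y - x) f + val (x - u) f) - (val y f - L f).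
  by rewrite !antidualE_D !antidualE_N lE; ring.
apply: Lle => d d0; have [y [h1 h2]] := filter_ex (filterI Fx (LP f _ d0)).
have {}h1 : adnorm (x - y) < complex.Re e / 2 := h1.
rewrite (E y).
apply: le_trans (rnormD _ _) _; rewrite rnormN; apply: lerD; last exact: ltW.
apply: le_trans (rnormD _ _) _.
have := adnorm_bound (y - x) f; have := adnorm_bound (x - u) f.
rewrite adnormB in h1.
have := sqrtr_ge0 (q f); move: (Num.sqrt (q f)) => s s0.
have : adnorm (y - x) * s <= complex.Re e / 2 * s by rewrite ler_wpM2r // ltW.
have : adnorm (x - u) * s <= complex.Re e / 2 * s by rewrite ler_wpM2r // ltW.
lra.
Qed.

HB.instance Definition _ := Uniform_isComplete.Build H antidual_complete.

Lemma dual_embed_subproof g : ((fun f => B g f) : P -> R[i]^o) \in bounded_antilinear B.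
Proof.
apply/bounded_antilinearP; split=> [k f h|]; first exact: (semi_inner_linearr semiB).
by exists (q g) => [|f]; [exact: sqn_ge0 | exact: semi_inner_CS].
Qed.

Definition dual_embed g : H :=
  exist (fun phi : P -> R[i]^o => phi \in bounded_antilinear B) _ (dual_embed_subproof g).
Local Notation J := dual_embed.

Lemma dual_embedE g f : val (J g) f = B g f.
Proof. by []. Qed.

Lemma dual_embedN g : J (- g) = - J g.
Proof.
apply: antidualP => f; rewrite antidualE_N !dual_embedE.
by rewrite -scaleN1r semi_innerZl // mulN1r.
Qed.

Lemma dual_embedZ k g : J (k *: g) = k *: J g.
Proof. by apply: antidualP => f; rewrite antidualE_Z !dual_embedE semi_innerZl. Qed.

Lemma dsqn_add_embed_le u g : dsqn (u + J g) <= dsqn u + 2 * complex.Re (val u g) + q g.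
Proof.
apply: dsqn_le => f; have := dsqn_ub u (f - g).
rewrite antidualD antidualN sqnB // antidualE_D dual_embedE (semi_innerC semiB g f) !raddfD !raddfN /=.
by case: (B f g) => a b /=; lra.
Qed.

(** The reverse inequality is the preceding one at [u + J g] and [- g]. The formula expresses
    [val u g] through norms; density of the embedding and [reip_embed] both come from it. *)
Lemma dsqn_add_embed u g : dsqn (u + J g) = dsqn u + 2 * complex.Re (val u g) + q g.
Proof.
apply/eqP; rewrite eq_le dsqn_add_embed_le /=.
have := dsqn_add_embed_le (u + J g) (- g); rewrite dual_embedN addrK.
rewrite antidualE_D !antidualN dual_embedE sqnE //.
rewrite (sqnN semiB).
by rewrite raddfD !raddfN /=; lra.
Qed.

(** A vector [f] that nearly attains the supremum [dsqn u] is already close to [u]: the squared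
    distance equals the defect. *)
Lemma dual_embed_dense u (e : R) : 0 < e -> exists g, adnorm (u - J g) <= e.
Proof.
move=> e0; have [_ [f _ <-] fe] := sup_adherent (exprn_gt0 2 e0) (dsqn_has_sup u).
exists f; rewrite -(@ler_pXn2r _ 2) ?nnegrE ?adnorm_ge0 ?(ltW e0) // adnorm_sqr.
rewrite -dual_embedN dsqn_add_embed antidualN.
rewrite (sqnN semiB).
by move: fe; rewrite -/(dsqn u) raddfN /=; lra.
Qed.

(* Jordan and von Neumann: the parallelogram law makes [reip] biadditive. *)
Definition reip u v : R := (dsqn (u + v) - dsqn (u - v)) / 4.

Lemma reipC u v : reip u v = reip v u.
Proof. by rewrite /reip [v + u]addrC -[v - u]opprB dsqnN. Qed.

Lemma reipDl u v w : reip (u + v) w = reip u w + reip v w.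
Proof.
rewrite /reip.
have := dsqn_parallelogram (u + w) v; have := dsqn_parallelogram (v + w) u.
have := dsqn_parallelogram (u - w) v; have := dsqn_parallelogram (v - w) u.
have -> : u + w + v = u + v + w by rewrite addrAC.
have -> : v + w + u = u + v + w by rewrite addrC addrA.
have -> : u - w + v = u + v - w by rewrite addrAC.
have -> : v - w + u = u + v - w by rewrite addrC addrA.
have -> : dsqn (v - w - u) = dsqn (u + w - v) by rewrite -dsqnN !opprB addrA.
have -> : dsqn (u - w - v) = dsqn (v + w - u) by rewrite -dsqnN !opprB addrA.
move: (dsqn (u + v + w)) (dsqn (u + v - w)) (dsqn (u + w - v)) (dsqn (v + w - u)).
move: (dsqn (u + w)) (dsqn (u - w)) (dsqn (v + w)) (dsqn (v - w)) (dsqn u) (dsqn v).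
by move=> *; lra.
Qed.

Lemma reip0l w : reip 0 w = 0.
Proof. by rewrite /reip add0r sub0r dsqnN subrr mul0r. Qed.

Lemma reipNl u w : reip (- u) w = - reip u w.
Proof. by apply/eqP; rewrite -subr_eq0 opprK -reipDl addNr reip0l. Qed.

Lemma reipBr u v w : reip u (v - w) = reip u v - reip u w.
Proof. by rewrite reipC reipDl reipNl ![reip _ u]reipC. Qed.

Lemma reip_le u v : `|reip u v| <= adnorm u * adnorm v.
Proof.
have H a b : reip a b <= adnorm a * adnorm b.
  rewrite /reip; have := dsqn_parallelogram a b; have := adnormD a b.
  have := adnorm_ge0 (a + b); rewrite -!adnorm_sqr => h0 h1.
  have : adnorm (a + b) ^+ 2 <= (adnorm a + adnorm b) ^+ 2 by rewrite ler_pXn2r ?nnegrE // (le_trans h0).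
  rewrite sqrrD; lra.
rewrite ler_norml H andbT lerNl -reipNl; apply: le_trans (H _ _) _.
by rewrite /adnorm dsqnN.
Qed.

Lemma reip_embed u g : reip u (J g) = complex.Re (val u g).
Proof.
rewrite /reip -dual_embedN !dsqn_add_embed antidualN raddfN /=.
rewrite (sqnN semiB).
by field.
Qed.

(** At [v = J g] the form is [complex.Re (val u g)], visibly homogeneous in [u]; density and
    [reip_le] give the general case, in place of the usual passage through rationals. *)
Lemma reipZl (r : R) u v : reip (r%:C *: u) v = r * reip u v.
Proof.
apply/eqP; rewrite -subr_eq0 -normr_le0; apply/ler_addgt0Pr => e e0; rewrite add0r.
have c0 : 0 < 1 + 2 * `|r| * adnorm u by rewrite ltr_pwDl // !mulr_ge0 ?adnorm_ge0.
have [g gv] := dual_embed_dense v (divr_gt0 e0 c0).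
have -> : reip (r%:C *: u) v - r * reip u v = reip (r%:C *: u) (v - J g) - r * reip u (v - J g).
  rewrite !reipBr !reip_embed antidualE_Z mulrBr.
  rewrite (_ : complex.Re (r%:C * _) = r * complex.Re (val u g)); first by ring.
  by case: (val u g) => a b /=; rewrite mul0r subr0.
apply: le_trans (ler_normB _ _) _; rewrite [X in _ + X]normrM.
have := reip_le (r%:C *: u) (v - J g); have := reip_le u (v - J g); rewrite adnormZ rnorm_real.
have := adnorm_ge0 (v - J g); have := adnorm_ge0 u; have r0 := normr_ge0 r.
move: (adnorm (v - _)) (adnorm u) (`|r| : R) gv c0 r0 => x y z gv c0 r0 y0 x0.
move: `|reip (_ *: _) _| `|reip u _| => s p h1 h2.
have : z * p <= z * (y * x) by rewrite ler_wpM2l.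
move: gv; rewrite ler_pdivlMr //; lra.
Qed.

Lemma reipZi u v : reip ('i *: u) ('i *: v) = reip u v.
Proof.
have ni : nm 'i ^+ 2 = 1 by rewrite rnorm_sqr /= expr0n add0r expr1n.
by rewrite /reip -scalerDr -scalerBr !dsqnZ ni !mul1r.
Qed.

Lemma reipiN u v : reip ('i *: u) v = - reip u ('i *: v).
Proof. by rewrite -reipZi scalerA -expr2 sqr_i scaleN1r reipNl. Qed.

(** The product is antilinear in [v], so its imaginary part is the real part of its value at
    ['i *: v]. *)
Definition dual_inner u v : R[i] := Complex (reip u v) (reip u ('i *: v)).

Lemma dual_inner_embed u g : dual_inner u (J g) = val u g.
Proof.
rewrite /dual_inner -dual_embedZ !reip_embed antidualZ.
by case: (val u g) => a b /=; apply/eqP; rewrite eq_complex /=; apply/andP; split; apply/eqP; ring.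
Qed.

Lemma dual_innerC u v : dual_inner u v = (-1) ^+ false * (dual_inner v u)^*.
Proof.
rewrite expr0 mul1r /dual_inner; apply/eqP; rewrite eq_complex /= reipC eqxx /=.
by rewrite -reipiN reipC.
Qed.

Lemma dual_innerDl u v w : dual_inner (u + v) w = dual_inner u w + dual_inner v w.
Proof. by rewrite /dual_inner !reipDl. Qed.

Lemma dual_innerZl k u w : dual_inner (k *: u) w = k * dual_inner u w.
Proof.
have -> : k *: u = (complex.Re k)%:C *: u + (complex.Im k)%:C *: ('i *: u).
  by rewrite scalerA -scalerDl; congr (_ *: _); rewrite [in LHS](complexE k) [in RHS]mulrC.
rewrite dual_innerDl /dual_inner !reipZl !reipiN.
rewrite scalerA -expr2 sqr_i scaleN1r.
have -> : reip u (- w) = - reip u w by rewrite reipC reipNl reipC.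
case: k => a b; apply/eqP; rewrite eq_complex /=; apply/andP; split; apply/eqP; ring.
Qed.

Lemma dual_inner_linearl w : linear_for *%R (dual_inner^~ w).
Proof. by move=> k u v; rewrite dual_innerDl dual_innerZl. Qed.

Lemma dual_inner_linearr w : linear_for (@conjc R \; *%R) (dual_inner w).
Proof.
move=> k u v; rewrite dual_innerC expr0 mul1r dual_inner_linearl rmorphD rmorphM /=.
by rewrite (dual_innerC w u) (dual_innerC w v) !expr0 !mul1r.
Qed.

Lemma dual_inner_sqr u : dual_inner u u = (adnorm u ^+ 2)%:C.
Proof.
have d2 : dsqn (u + u) = 4 * dsqn u.
  by have := dsqn_parallelogram u u; rewrite subrr dsqn0; lra.
rewrite /dual_inner adnorm_sqr; apply/eqP; rewrite eq_complex /=; apply/andP; split; apply/eqP.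
  by rewrite /reip subrr dsqn0 d2; field.
by have := reipiN u u; rewrite reipC; lra.
Qed.

Lemma dual_inner_gt0 u : u != 0 -> 0 < dual_inner u u.
Proof.
move=> u0; rewrite dual_inner_sqr ltcR exprn_gt0 // lt0r adnorm_ge0 andbT.
by apply: contraNneq u0 => /adnorm_eq0 ->.
Qed.

HB.instance Definition _ := bilinear_isBilinear.Build R[i] H H R[i]
  (GRing.Scale.Law.clone _ _ ( *%R ) _) (GRing.Scale.Law.clone _ _ (@conjc R \; *%R ) _)
  dual_inner (conj dual_inner_linearl dual_inner_linearr).

HB.instance Definition _ := isHermitianSesquilinear.Build R[i] H false (@conjc R) dual_inner dual_innerC.

HB.instance Definition _ := isDotProduct.Build R[i] H dual_inner dual_inner_gt0.

Lemma dual_inner_norm u : (dual_inner : {dot H for (@conjc R)}) u u = `|u| ^+ 2.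
Proof. by rewrite /= dual_inner_sqr rmorphXn. Qed.

HB.instance Definition _ := isHilbertSpace.Build R H dual_inner_norm.

End AntilinearDualNorm.

(** * Extension of operators to the completion *)

Section DualOperators.
Variables (R : realType) (P : lmodType R[i]) (B : P -> P -> R[i]).
Variable semiB : semi_inner B.
Local Notation H := (antidual semiB).
Implicit Types (f g h : P) (u v w : H) (S T : P -> P).
Local Notation nm z := (rnorm (z : R[i]^o)).
Local Notation q f := (sqn B f).

Record bounded_op S : Prop := {
  bounded_op_linear : linear S;
  bounded_op_le : exists2 c : R, 0 <= c & forall f, q (S f) <= c * q f
}.

Lemma dual_ext_subproof S (bS : bounded_op S) u :
  ((fun f => val u (S f)) : P -> R[i]^o) \in bounded_antilinear B.
Proof.
apply/bounded_antilinearP; split=> [k f g|].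
  by rewrite (bounded_op_linear bS) antidual_linear.
have [c c0 cS] := bounded_op_le bS; exists (dsqn u * c); first by rewrite mulr_ge0 ?dsqn_ge0.
move=> f; apply: le_trans (dsqn_bound u (S f)) _.
by rewrite -mulrA ler_wpM2l ?dsqn_ge0.
Qed.

(* Extends to the completion the operator on [P] whose adjoint is [S]. *)
Definition dual_ext S (bS : bounded_op S) u : H :=
  exist (fun phi : P -> R[i]^o => phi \in bounded_antilinear B) _ (dual_ext_subproof bS u).

Lemma dual_extE S (bS : bounded_op S) u f : val (dual_ext bS u) f = val u (S f).
Proof. by []. Qed.

Lemma dual_ext_linear S (bS : bounded_op S) : linear (dual_ext bS).
Proof. by move=> k u v; apply: antidualP => f. Qed.

Lemma dual_ext_bounded S (bS : bounded_op S) :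
  exists2 c : R, 0 <= c & forall u, adnorm (dual_ext bS u) <= c * adnorm u.
Proof.
have [c c0 cS] := bounded_op_le bS; exists (Num.sqrt c); first exact: sqrtr_ge0.
move=> u; apply: adnorm_le => [|f]; first by rewrite mulr_ge0 ?sqrtr_ge0 ?adnorm_ge0.
rewrite dual_extE; apply: le_trans (adnorm_bound _ _) _.
rewrite -mulrA mulrCA ler_wpM2l ?adnorm_ge0 // -sqrtrM //.
by rewrite ler_wsqrtr.
Qed.

Lemma dual_ext_continuous S (bS : bounded_op S) : continuous (dual_ext bS : H -> H).
Proof.
have [c c0 cS] := dual_ext_bounded bS; apply: (@lipschitz_cont R H H _ c) => u v.
rewrite (_ : dual_ext bS u - dual_ext bS v = dual_ext bS (u - v)); last first.
  by apply: antidualP => f.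
by rewrite !antidual_rnorm.
Qed.

Lemma inner_antidual u v : inner u v = dual_inner u v.
Proof. by []. Qed.

Lemma inner_dual_embed u g : inner u (dual_embed semiB g) = val u g.
Proof. by rewrite inner_antidual dual_inner_embed. Qed.

Lemma dual_inner_le u v : nm (dual_inner u v) <= adnorm u * adnorm v.
Proof.
have semi : semi_inner (@dual_inner R P B semiB).
  split=> [k f g h|k f g h|f]; first exact: dual_inner_linearl.
    exact: dual_inner_linearr.
  by rewrite dual_inner_sqr lecR sqr_ge0.
rewrite -(@ler_pXn2r _ 2) ?nnegrE ?rnorm_ge0 ?mulr_ge0 ?adnorm_ge0 //.
apply: le_trans (semi_inner_CS semi u v) _.
by rewrite /sqn !dual_inner_sqr /= exprMn.
Qed.

(** [dual_ext bT] maps the image of [g] to the image of [S g], so the identity holds for [v] in the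
    image of [P]; boundedness and density do the rest. *)
Lemma dual_ext_adjoint S T (bS : bounded_op S) (bT : bounded_op T) :
  (forall f g, B (T f) g = B f (S g)) ->
  is_adjoint (dual_ext bS : H -> H) (dual_ext bT : H -> H).
Proof.
move=> ST u v; rewrite !inner_antidual.
have TJ g : dual_ext bT (dual_embed semiB g) = dual_embed semiB (S g).
  apply: antidualP => f; rewrite dual_extE !dual_embedE.
  by rewrite semi_innerC // ST -semi_innerC.
have [c c0 cS] := dual_ext_bounded bS; have [d d0 dT] := dual_ext_bounded bT.
apply/eqP; rewrite -subr_eq0; apply/eqP; apply: (@rnorm_eq0 R R[i]^o); apply/eqP.
rewrite eq_le rnorm_ge0 andbT; apply/ler_addgt0Pr => e e0; rewrite add0r.
have n0 : 0 < 1 + (c + d) * adnorm u by rewrite ltr_pwDl // mulr_ge0 ?addr_ge0 ?adnorm_ge0.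
have [g gv] := dual_embed_dense v (divr_gt0 e0 n0).
have Br a x y : dual_inner (semiB := semiB) a (x - y) = dual_inner a x - dual_inner a y.
  have := dual_inner_linearr a (-1) y x; rewrite scaleN1r [- y + x]addrC => ->.
  rewrite [LHS]addrC; congr (_ + _); case: (dual_inner a y) => p r.
  by apply/eqP; rewrite eq_complex /=; apply/andP; split; apply/eqP; ring.
have -> : dual_inner (dual_ext bS u) v - dual_inner u (dual_ext bT v) =
   dual_inner (dual_ext bS u) (v - dual_embed semiB g) - dual_inner u (dual_ext bT (v - dual_embed semiB g)).
  rewrite (_ : dual_ext bT (v - _) = dual_ext bT v - dual_ext bT (dual_embed semiB g)); last first.
    by apply: antidualP => f.
  by rewrite TJ !Br !dual_inner_embed dual_extE; ring.
apply: le_trans (rnormD _ _) _; rewrite rnormN.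
have h1 := dual_inner_le (dual_ext bS u) (v - dual_embed semiB g).
have h2 := dual_inner_le u (dual_ext bT (v - dual_embed semiB g)).
have h3 := cS u; have h4 := dT (v - dual_embed semiB g).
move: (nm _) (nm _) (adnorm (dual_ext bS u)) (adnorm (dual_ext bT _)) h1 h2 h3 h4 => a b x y.
have := adnorm_ge0 (v - dual_embed semiB g); have := adnorm_ge0 u.
move: gv; rewrite ler_pdivlMr //; move: (adnorm (v - _)) (adnorm u) => s t H1 t0 s0 h1 h2 h3 h4.
have : x * s <= c * t * s by rewrite ler_wpM2r.
have : t * y <= t * (d * s) by rewrite ler_wpM2l.
lra.
Qed.

(** Since [T] is adjoint to [S] and [S T = 1], expanding the square of [f - T (S f)] leaves
    [q f - q (S f)]. *)
Lemma sqn_coisometry S T : (forall f g, B (T f) g = B f (S g)) -> (forall f, S (T f) = f) ->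
  forall f, q (S f) <= q f.
Proof.
move=> ST K f; have := sqn_ge0 semiB (f - T (S f)); rewrite sqnB //.
rewrite semi_innerC // ST (sqnE semiB) /= /sqn ST K; lra.
Qed.

(** In the supremum defining [dsqn], contractivity of [S] gives one inequality and the test vectors
    [T f] the other. *)
Lemma dual_ext_isometry S T (bS : bounded_op S) :
  (forall f g, B (T f) g = B f (S g)) -> (forall f, S (T f) = f) ->
  isometry_op (dual_ext bS : H -> H).
Proof.
move=> ST K; split; first exact: dual_ext_linear.
move=> u; rewrite !rnormE !antidual_rnorm /adnorm; congr (Num.sqrt _)%:C.
apply/eqP; rewrite eq_le; apply/andP; split; apply: dsqn_le => f.
  rewrite dual_extE; apply: le_trans (dsqn_ub u (S f)).
  by rewrite lerD2l lerN2; exact: (sqn_coisometry ST K).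
have := dsqn_ub (dual_ext bS u) (T f); rewrite dual_extE K; apply: le_trans.
by rewrite /sqn ST K.
Qed.

End DualOperators.

(** * The Fock representation *)

Section FockSpace.
Variables (R : realType) (n : nat) (A : unitalCStarAlgType R).
Local Notation Zn := {ffun 'I_n -> nat}.
Implicit Types (x y z : Zn) (a b c : A).

Definition finsupp_pred : {pred (Zn -> A)} :=
  fun f => `[< exists s : {fset Zn}, forall x, x \notin s -> f x = 0 >].

Lemma finsuppP (f : Zn -> A) :
  reflect (exists s : {fset Zn}, forall x, x \notin s -> f x = 0) (f \in finsupp_pred).
Proof. exact: asboolP. Qed.

Lemma finsupp_submod : submod_closed finsupp_pred.
Proof.
split=> [|k f g /finsuppP[s sf] /finsuppP[t tg]]; first by apply/finsuppP; exists fset0.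
apply/finsuppP; exists (s `|` t)%fset => x; rewrite in_fsetU negb_or => /andP[xs xt].
have -> : (k *: f + g) x = k *: f x + g x by [].
by rewrite sf // tg // scaler0 addr0.
Qed.

HB.instance Definition _ := GRing.isSubmodClosed.Build R[i] _ finsupp_pred finsupp_submod.

Definition fock := {f : Zn -> A | f \in finsupp_pred}.

HB.instance Definition _ := SubType.on fock.
HB.instance Definition _ := Choice.on fock.
HB.instance Definition _ := [SubChoice_isSubLmodule of fock by <:].

Implicit Types (f g h : fock).

Lemma fockP f g : (forall x, val f x = val g x) -> f = g.
Proof. by move=> fg; apply: val_inj; apply/funext. Qed.

Lemma fockE_D f g x : val (f + g) x = val f x + val g x.
Proof. by []. Qed.

Lemma fockE_Z k f x : val (k *: f) x = k *: val f x.
Proof. by []. Qed.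

Lemma fock0 x : val (0 : fock) x = 0.
Proof. by []. Qed.

Lemma fock_support f : exists s : {fset Zn}, forall x, x \notin s -> val f x = 0.
Proof. by have /finsuppP := valP f. Qed.

Variables (alpha : Zn -> A -> A) (dyn : unital_dynamical_system alpha).
Variables (tau : A -> R[i]) (state_tau : is_state tau).
Let pos := state_positive_functional state_tau.

(** The GNS form of [tau] in each coordinate, summed over the finite support. *)
Definition fock_form f g : R[i] := \sum_(x \in [set: Zn]) tau (star (val g x) ** val f x).
Local Notation B := fock_form.

Lemma fock_formE f g (s : {fset Zn}) : (forall x, x \notin s -> val f x = 0) ->
  B f g = \sum_(x <- s) tau (star (val g x) ** val f x).
Proof.
move=> sf; apply: fsbigTE => x xs.
by rewrite sf // cmul0r (functional0 pos).
Qed.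

Lemma fock_formEr f g (s : {fset Zn}) : (forall x, x \notin s -> val g x = 0) ->
  B f g = \sum_(x <- s) tau (star (val g x) ** val f x).
Proof.
move=> sf; apply: fsbigTE => x xs.
by rewrite sf // star0 cmul0l (functional0 pos).
Qed.

Lemma fock_semi_inner : semi_inner B.
Proof.
split=> [k f g h|k f g h|f].
- have [s sh] := fock_support h; rewrite !(fock_formEr _ sh) mulr_sumr -big_split /=.
  by apply: eq_bigr => x _; rewrite cmulDr cmulZr (functionalD pos) (functionalZ pos).
- have [s sh] := fock_support h; rewrite !(fock_formE _ sh) mulr_sumr -big_split /=.
  apply: eq_bigr => x _.
  by rewrite starD starZ cmulDl cmulZl (functionalD pos) (functionalZ pos).
- have [s sf] := fock_support f; rewrite (fock_formE _ sf).
  by apply: sumr_ge0 => x _; exact: pos.2.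
Qed.

Lemma fock_sqn f (s : {fset Zn}) : (forall x, x \notin s -> val f x = 0) ->
  sqn B f = \sum_(x <- s) complex.Re (tau (star (val f x) ** val f x)).
Proof. by move=> sf; rewrite /sqn (fock_formE _ sf) raddf_sum. Qed.

Lemma fock_left_subproof a f : (fun x => alpha x (star a) ** val f x) \in finsupp_pred.
Proof.
have [s sf] := fock_support f; apply/finsuppP; exists s => x xs.
by rewrite sf // cmul0r.
Qed.

(** The adjoint [star a] appears because [dual_ext] passes to adjoints; [fock_pi a] thus acts in
    coordinate [x] as [alpha x a]. *)
Definition fock_left a f : fock := exist (fun phi : Zn -> A => phi \in finsupp_pred) _ (fock_left_subproof a f).

Lemma fock_leftE a f x : val (fock_left a f) x = alpha x (star a) ** val f x.
Proof. by []. Qed.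

(** The functional sending [d] to [tau (star b ** alpha x d ** b)] is positive, with value
    [tau (star b ** b)] at the unit as [alpha x] is unital; [functional_le] is applied to it at
    [star a ** a]. *)
Lemma alpha_conj_le x a b : complex.Re (tau (star (alpha x a ** b) ** (alpha x a ** b))) <=
  rnorm a ^+ 2 * complex.Re (tau (star b ** b)).
Proof.
have hx := dynsys_hom dyn x.
have posx : positive_functional (fun d => tau (star b ** alpha x d ** b)).
  have posb := functional_conj pos b; split=> [k c d|c].
    by rewrite (star_hom_linear hx) posb.1.
  by rewrite (star_homM hx) (star_hom_star hx); exact: posb.2.
have := functional_le posx (h := star a ** a); rewrite rnorm_cstar (dynsys_unital dyn) cmul1r.
rewrite (star_homM hx) (star_hom_star hx) starM !cmulA => /(_ _).
by rewrite starM starK -!cmulA; apply.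
Qed.

Lemma fock_left_bounded a : bounded_op B (fock_left a).
Proof.
split=> [k f g|].
  by apply: fockP => x; rewrite fockE_D fockE_Z !fock_leftE fockE_D fockE_Z cmulDr cmulZr.
exists (rnorm (star a) ^+ 2) => [|f]; first exact: sqr_ge0.
have [s sf] := fock_support f; rewrite (fock_sqn sf) (fock_sqn (s := s)); last first.
  by move=> x xs; rewrite fock_leftE sf // cmul0r.
by rewrite mulr_sumr; apply: ler_sum => x _; exact: alpha_conj_le.
Qed.

Lemma fock_left_adjoint a f g : B (fock_left (star a) f) g = B f (fock_left a g).
Proof.
apply: eq_fsbigr => x _; rewrite !fock_leftE starK starM -(star_hom_star (dynsys_hom dyn x)).
by rewrite starK cmulA.
Qed.

Definition subz x y : Zn := [ffun i => (x i - y i)%N].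
Definition lez x y : bool := [forall i, (x i <= y i)%N].

Lemma addzK x y : subz (x + y) y = x.
Proof. by apply/ffunP => i; rewrite !ffunE addnK. Qed.

Lemma subzK x y : lez y x -> subz x y + y = x.
Proof. by move=> /forallP yx; apply/ffunP => i; rewrite !ffunE; exact: subnK. Qed.

Lemma lez_addl x y : lez y (x + y).
Proof. by apply/forallP => i; rewrite ffunE; exact: leq_addl. Qed.

Lemma addz_inj y : injective (fun x => x + y).
Proof. by move=> x z /(congr1 (subz^~ y)); rewrite !addzK. Qed.

Lemma fock_down_subproof y f : (fun x => val f (x + y)) \in finsupp_pred.
Proof.
have [s sf] := fock_support f; apply/finsuppP; exists [fset subz x y | x in s]%fset => x xs.
apply: sf; apply: contra xs => xs; apply/imfsetP; exists (x + y) => //=.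
by rewrite addzK.
Qed.

Definition fock_down y f : fock := exist (fun phi : Zn -> A => phi \in finsupp_pred) _ (fock_down_subproof y f).

Lemma fock_up_subproof y f : (fun x => if lez y x then val f (subz x y) else 0) \in finsupp_pred.
Proof.
have [s sf] := fock_support f; apply/finsuppP; exists [fset ((x : Zn) + y)%R | x in s]%fset => x xs.
case: ifP => // yx; apply: sf; apply: contra xs => xs; apply/imfsetP; exists (subz x y) => //=.
by rewrite subzK.
Qed.

Definition fock_up y f : fock := exist (fun phi : Zn -> A => phi \in finsupp_pred) _ (fock_up_subproof y f).

Lemma fock_downE y f x : val (fock_down y f) x = val f (x + y).
Proof. by []. Qed.

Lemma fock_upE y f x : val (fock_up y f) x = if lez y x then val f (subz x y) else 0.
Proof. by []. Qed.

Lemma fock_downK y f : fock_down y (fock_up y f) = f.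
Proof. by apply: fockP => x; rewrite fock_downE fock_upE lez_addl addzK. Qed.

Lemma fock_up_adjoint y f g : B (fock_up y f) g = B f (fock_down y g).
Proof.
rewrite /fock_form -(@fsbig_widen _ _ _ _ (range (fun x => x + y)) setT) //; last first.
  move=> x [_ xy]; change (tau (star (val g x) ** val (fock_up y f) x) = 0); rewrite fock_upE;
    case: ifPn => [yx|_]; last by rewrite cmul0r (functional0 pos).
  by case: xy; exists (subz x y) => //; rewrite subzK.
rewrite (reindex_fsbig (fun x => x + y) setT); last first.
  by apply: inj_bij => x z _ _; exact: addz_inj.
by apply: eq_fsbigr => x _; rewrite fock_upE lez_addl addzK fock_downE.
Qed.

Lemma fock_down_linear y : linear (fock_down y).
Proof. by move=> k f g; apply: fockP. Qed.

Lemma fock_up_linear y : linear (fock_up y).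
Proof.
move=> k f g; apply: fockP => x; rewrite fockE_D fockE_Z !fock_upE.
by case: ifP; rewrite ?fockE_D ?fockE_Z // scaler0 addr0.
Qed.

Lemma fock_down_bounded y : bounded_op B (fock_down y).
Proof.
split; first exact: fock_down_linear.
exists 1 => // f; rewrite mul1r.
exact: (sqn_coisometry fock_semi_inner (fock_up_adjoint y) (fock_downK y)).
Qed.

Lemma fock_up_bounded y : bounded_op B (fock_up y).
Proof.
split; first exact: fock_up_linear.
by exists 1 => // f; rewrite mul1r /sqn fock_up_adjoint fock_downK.
Qed.

Local Notation H := (antidual fock_semi_inner).

(* [dual_ext S] extends the adjoint of [S], hence the downward shift in [fock_V]. *)
Definition fock_pi a : H -> H := dual_ext (fock_left_bounded a).
Definition fock_V y : H -> H := dual_ext (fock_down_bounded y).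

Lemma generator_lez i x : lez (generator i) x = (0 < x i)%N.
Proof.
apply/forallP/idP => [/(_ i)|xi j]; first by rewrite ffunE eqxx.
by rewrite ffunE; case: eqVneq => // ->.
Qed.

(** Covariance is the law [alpha (x + generator i) = alpha x \o alpha (generator i)] read in
    coordinate [x]; the Nica relation holds because shifts along different coordinates commute, one
    up and one down. *)
Lemma fock_nica : nica_covariant_pair alpha fock_pi fock_V.
Proof.
split.
- split=> [a|a|k a b u|a b u|a].
  + exact: dual_ext_linear.
  + exact: dual_ext_continuous.
  + apply: antidualP => f; rewrite antidualE_D antidualE_Z !dual_extE.
    rewrite (_ : fock_left _ f = k^* *: fock_left a f + fock_left b f); last first.
      apply: fockP => x; rewrite fockE_D fockE_Z !fock_leftE starD starZ.
      by rewrite (star_hom_linear (dynsys_hom dyn x)) cmulDl cmulZl.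
    rewrite antidual_linear; congr (_ * _ + _).
    by case: (k) => p r; apply/eqP; rewrite eq_complex /= opprK !eqxx.
  + apply: antidualP => f; rewrite !dual_extE; congr (val u _).
    by apply: fockP => x; rewrite !fock_leftE starM (star_homM (dynsys_hom dyn x)) cmulA.
  + by apply: dual_ext_adjoint => f g; exact: fock_left_adjoint.
- move=> y; apply: (@dual_ext_isometry _ _ _ _ _ (fock_up y)); first exact: fock_up_adjoint.
  exact: fock_downK.
- move=> u; apply: antidualP => f; rewrite dual_extE; congr (val u _).
  by apply: fockP => x; rewrite fock_downE addr0.
- move=> x y u; apply: antidualP => f; rewrite !dual_extE; congr (val u _).
  by apply: fockP => z; rewrite !fock_downE; congr (val f _); rewrite -addrA [y + x]addrC.
- move=> i j ij; exists (dual_ext (fock_up_bounded (generator j))).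
    by apply: dual_ext_adjoint => f g; exact: fock_up_adjoint.
  move=> u; apply: antidualP => f; rewrite !dual_extE; congr (val u _).
  apply: fockP => x; rewrite !(fock_upE, fock_downE) !generator_lez !ffunE.
  rewrite [j == i]eq_sym (negbTE ij) (_ : (x j + false)%R = x j :> nat); last exact: addn0.
  case: ifP => // xj; congr (val f _); apply/ffunP => k; rewrite !ffunE.
  change ((x k - (k == j) + (k == i))%N = (x k + (k == i) - (k == j))%N).
  have [->|kj] := eqVneq k j; last by rewrite !subn0.
  by rewrite eq_sym (negbTE ij) !addn0.
- move=> a i u; apply: antidualP => f; rewrite !dual_extE; congr (val u _).
  apply: fockP => x; rewrite !(fock_leftE, fock_downE) (dynsysD dyn).
  by rewrite (star_hom_star (dynsys_hom dyn (generator i))).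
Qed.

Lemma fock_delta_subproof a : (fun x : Zn => if x == 0 then a else 0) \in finsupp_pred.
Proof.
by apply/finsuppP; exists [fset 0]%fset => x; rewrite in_fset1 => /negbTE ->.
Qed.

Definition fock_delta a : fock := exist (fun phi : Zn -> A => phi \in finsupp_pred) _ (fock_delta_subproof a).
Definition fock_vacuum : H := dual_embed fock_semi_inner (fock_delta cone).

Lemma fock_down_delta y a : y != 0 -> fock_down y (fock_delta a) = 0.
Proof.
move=> y0; apply: fockP => x; rewrite fock_downE fock0 -[LHS]/(if x + y == 0 then a else 0);
  case: eqP => // xy.
case/eqP: y0; apply/ffunP => i; have /ffunP/(_ i) := xy; rewrite !ffunE.
by move/eqP; rewrite addn_eq0 => /andP[_ /eqP].
Qed.

Lemma inner_fock_V y u : y != 0 -> inner (fock_V y u) fock_vacuum = 0.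
Proof. by move=> y0; rewrite inner_dual_embed dual_extE fock_down_delta // antidual0. Qed.

Lemma inner_fock_pi a : inner (fock_pi a fock_vacuum) fock_vacuum = tau a.
Proof.
rewrite inner_dual_embed dual_extE dual_embedE (@fock_formE _ _ [fset 0]%fset); last first.
  by move=> x; rewrite in_fset1 /= => /negbTE ->.
rewrite big_seq_fset1 fock_leftE /= eqxx cmul1r (dynsys0 dyn) starM starK star_cone.
by rewrite cmul1l.
Qed.

End FockSpace.

(** * Relations in the Toeplitz-Nica-Pimsner algebra *)

Lemma closed_rnormP (R : realType) (V : normedModType R[i]) (D : set V) :
  closed D <-> forall b, (forall e : R, 0 < e -> exists2 c, D c & rnorm (b - c) < e) -> D b.
Proof.
split=> [cD b H|H b clb].
  apply: cD => N /nbhs_ballP[e /= e0 eN].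
  have e1 : 0 < complex.Re e by move: e0; rewrite ltcE => /andP[].
  have eE : (complex.Re e)%:C = e.
    by move: e0; rewrite ltcE; case: (e) => p r /= /andP[/eqP -> _].
  have [c Dc bc] := H _ e1; exists c; split=> //; apply: eN.
  by rewrite -ball_normE /ball_ /= rnormE -eE ltcR.
apply: H => e e0; have e0' : 0 < e%:C by rewrite ltcR.
have [c [Dc]] := clb _ (nbhsx_ballx b _ e0').
by rewrite -ball_normE /ball_ /= rnormE ltcR; exists c.
Qed.

Lemma closed_preimage_lipschitz (R : realType) (V W : normedModType R[i]) (f : V -> W) (c : R)
    (D : set W) : (forall u v, rnorm (f u - f v) <= c * rnorm (u - v)) -> closed D ->
  closed (f @^-1` D).
Proof.
by move=> H; apply: preimage_closed => x _; exact: (lipschitz_cont H).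
Qed.

Lemma closed_eq_lipschitz (R : realType) (V W : normedModType R[i]) (f g : V -> W) (c d : R) :
  (forall u v, rnorm (f u - f v) <= c * rnorm (u - v)) ->
  (forall u v, rnorm (g u - g v) <= d * rnorm (u - v)) ->
  closed [set b | f b = g b].
Proof.
move=> fc gd; apply/closed_rnormP => b H /=.
apply/eqP; rewrite -subr_eq0; apply/eqP; apply: rnorm_eq0; apply/eqP.
rewrite eq_le rnorm_ge0 andbT; apply/ler_addgt0Pr => e e0; rewrite add0r.
have n0 : 0 < 1 + `|c| + `|d| by rewrite -addrA ltr_pwDl // addr_ge0.
have [x /= fgx xb] := H _ (divr_gt0 e0 n0).
have -> : f b - g b = (f b - f x) - (g b - g x) by rewrite fgx opprB addrA subrK.
apply: le_trans (rnormD _ _) _; rewrite rnormN.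
have := fc b x; have := gd b x; move: xb; rewrite ltr_pdivlMr //.
have := rnorm_ge0 (b - x); move: (rnorm (b - x)) (rnorm (f b - _)) (rnorm (g b - _)) => r s t r0 h1 h2 h3.
have : c * r <= `|c| * r by rewrite ler_wpM2r // ler_norm.
have : d * r <= `|d| * r by rewrite ler_wpM2r // ler_norm.
lra.
Qed.

Section HilbertSpaceInner.
Variables (R : realType) (H : hilbertType R).
Implicit Types (u v w : H).

Lemma hilbert_semi_inner : semi_inner (fun u v : H => inner u v).
Proof.
split=> [k f g h|k f g h|f]; first by rewrite linearPl.
  by rewrite linearPr.
by rewrite inner_norm exprn_ge0.
Qed.

Lemma inner_ext u v : (forall w, inner u w = inner v w) -> u = v.
Proof.
move=> uv; apply/eqP; rewrite -subr_eq0 -normr_eq0 -sqrf_eq0 -inner_norm; apply/eqP.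
by rewrite [LHS](semi_innerDl hilbert_semi_inner) uv -(semi_innerDl hilbert_semi_inner) subrr (semi_inner0l hilbert_semi_inner).
Qed.

Lemma sqn_inner u : sqn (fun u v : H => inner u v) u = rnorm u ^+ 2.
Proof. by rewrite /sqn inner_norm rnormE -rmorphXn. Qed.

Lemma isometry_inner (T : H -> H) u v : isometry_op T -> inner (T u) (T v) = inner u v.
Proof.
move=> [linT isoT]; have rT w : rnorm (T w) = rnorm w by rewrite /rnorm isoT.
have TD w w' : T (w + w') = T w + T w' by have := linT 1 w w'; rewrite !scale1r.
have T0 : T 0 = 0 by apply: (addIr (T 0)); rewrite -TD !add0r.
have TZ k w : T (k *: w) = k *: T w by have := linT k w 0; rewrite T0 !addr0.
have Re_eq w w' : complex.Re (inner (T w) (T w')) = complex.Re (inner w w').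
  have := sqnD hilbert_semi_inner (T w) (T w'); have := sqnD hilbert_semi_inner w w'.
  by rewrite -TD !sqn_inner !rT; lra.
have := Re_eq u v; have := Re_eq u ((Complex 0 1 : R[i]) *: v).
rewrite TZ !(semi_innerZr hilbert_semi_inner).
case: (inner (T u) (T v)) => a b; case: (inner u v) => c d /= h1 h2.
by apply/eqP; rewrite eq_complex /=; apply/andP; split; apply/eqP; lra.
Qed.

End HilbertSpaceInner.

Section MultiIndex.
Variable n : nat.
Local Notation Zn := {ffun 'I_n -> nat}.

(** Covariance and the Nica relation are given for generators; this induction, on the coordinate
    sum, extends them to all of Z_+^n. *)
Lemma Zn_ind (P : Zn -> Prop) : P 0 -> (forall x i, P x -> P (x + generator i)) -> forall x, P x.
Proof.
move=> P0 PS x; have [m] := ubnP (\sum_i x i); elim: m x => // m IH x; rewrite ltnS => xm.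
have [i xi|x0] := pickP (fun i => 0 < x i)%N; last first.
  by rewrite (_ : x = 0) //; apply/ffunP => i; rewrite !ffunE; have /negbT := x0 i;
    rewrite lt0n negbK => /eqP.
pose y : Zn := [ffun j => (x j - (j == i))%N].
have xE : x = y + generator i.
  apply/ffunP => j; rewrite !ffunE -[RHS]/((x j - (j == i)) + (j == i))%N subnK //.
  by case: eqVneq => [->|].
rewrite xE; apply: PS; apply: IH; apply: leq_trans xm.
rewrite xE [X in (_ < X)%N](eq_bigr (fun j => y j + (j == i))%N); last by move=> j _;
  rewrite !ffunE.
rewrite big_split /= (bigD1 i) //= [X in (_ < _ + X)%N](bigD1 i) //= eqxx.
by rewrite [X in (_ < _ + (_ + X))%N]big1 ?addn0 ?addn1 // => j /negbTE ->.
Qed.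

End MultiIndex.

Section Relations.
Variables (R : realType) (n : nat) (A : unitalCStarAlgType R).
Local Notation Zn := {ffun 'I_n -> nat}.
Variables (alpha : Zn -> A -> A) (NT : unitalCStarAlgType R) (gen : Zn -> A -> NT).
Hypotheses (dyn : unital_dynamical_system alpha) (tnp : is_toeplitz_nica_pimsner alpha gen).
Implicit Types (x y z : Zn) (a : A) (b c d : NT).

Section Representation.
Variables (H : hilbertType R) (pi : A -> H -> H) (V : Zn -> H -> H) (Phi : NT -> H -> H).
Hypotheses (nica : nica_covariant_pair alpha pi V) (form : integrated_form gen pi V Phi).
Implicit Types (u w : H).

Lemma rep_gen x a u : Phi (gen x a) u = V x (pi a u).
Proof. by case: form. Qed.

Lemma rep_mul b c u : Phi (b ** c) u = Phi b (Phi c u).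
Proof. by case: form => rep _; exact: star_repM. Qed.

Lemma rep_linear k b c u : Phi (k *: b + c) u = k *: Phi b u + Phi c u.
Proof. by case: form => rep _; exact: star_rep_linear. Qed.

Lemma rep_star b u w : inner (Phi b u) w = inner u (Phi (star b) w).
Proof. by case: form => rep _; exact: star_rep_star. Qed.

Lemma rep_starl b u w : inner (Phi (star b) u) w = inner u (Phi b w).
Proof. by rewrite rep_star starK. Qed.

Lemma pi_mul a a' u : pi (a ** a') u = pi a (pi a' u).
Proof. exact: (star_repM (nica_rep nica)). Qed.

Lemma pi_cone a u : pi cone (pi a u) = pi a u.
Proof. by rewrite -pi_mul cmul1l. Qed.

Lemma pi_coner a u : pi a (pi cone u) = pi a u.
Proof. by rewrite -pi_mul cmul1r. Qed.

Lemma pi_star a u w : inner (pi a u) w = inner u (pi (star a) w).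
Proof. exact: (star_rep_star (nica_rep nica)). Qed.

Lemma pi_V a x u : pi a (V x u) = V x (pi (alpha x a) u).
Proof.
elim/Zn_ind: x a u => [|x i IH] a u.
  by rewrite !(nica_V0 nica) (dynsys0 dyn).
rewrite !(nica_VD nica) IH (nica_covariant nica) -(dynsysD dyn).
by rewrite [generator i + x]addrC.
Qed.

(** Representations may be degenerate, so [pi cone] is only a projection; unitality of [alpha x]
    makes it commute with the isometries, and it can be moved out of the way in the relations
    below. *)
Lemma pi_cone_V x u : pi cone (V x u) = V x (pi cone u).
Proof. by rewrite pi_V (dynsys_unital dyn). Qed.

Lemma V_inner x u w : inner (V x u) (V x w) = inner u w.
Proof. exact: isometry_inner (nica_isometry nica x). Qed.

Lemma pi_cone_inner u w : inner (pi cone u) (pi cone w) = inner (pi cone u) w.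
Proof. by rewrite -[in RHS](pi_cone cone u) [in RHS]pi_star star_cone. Qed.

Lemma rep_star_generator i (Vi_adj : H -> H) u : is_adjoint (V (generator i)) Vi_adj ->
  Phi (star (gen (generator i) cone)) u = Vi_adj (pi cone u).
Proof.
move=> adj; apply: inner_ext => w; rewrite rep_starl rep_gen -pi_cone_V.
rewrite -{1}[cone]star_cone -pi_star.
have adj' p r : inner (Vi_adj p) r = inner p (V (generator i) r).
  rewrite (semi_innerC (hilbert_semi_inner H)) -adj.
  by rewrite -(semi_innerC (hilbert_semi_inner H)).
by rewrite adj'.
Qed.

Lemma adjoint_pi_cone i (Vi_adj : H -> H) u : is_adjoint (V (generator i)) Vi_adj ->
  pi cone (Vi_adj u) = Vi_adj (pi cone u).
Proof.
move=> adj; apply: inner_ext => w.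
have adj' p r : inner (Vi_adj p) r = inner p (V (generator i) r).
  rewrite (semi_innerC (hilbert_semi_inner H)) -adj.
  by rewrite -(semi_innerC (hilbert_semi_inner H)).
by rewrite pi_star star_cone !adj' -pi_cone_V pi_star star_cone.
Qed.

End Representation.

(** The norm of [b - c] is at most 0 by [tnp_norm_lub] with bound 0, so identities may be checked in
    representations. *)
Lemma tnp_eq b c : (forall (H : hilbertType R) pi (V : Zn -> H -> H) Phi,
    nica_covariant_pair alpha pi V -> integrated_form gen pi V Phi -> forall u, Phi b u = Phi c u) ->
  b = c.
Proof.
move=> bc; apply/eqP; rewrite -subr_eq0 -normr_le0;
  apply: (tnp_norm_lub tnp) => // H pi V Phi N F u.
by rewrite addrC -scaleN1r (rep_linear F) (bc _ _ _ _ N F) scaleN1r addNr normr0 mul0r.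
Qed.

Local Notation v x := (gen x cone).
Local Notation io a := (gen 0 a).

Lemma star_io_cone : star (io cone) = io cone.
Proof.
apply: tnp_eq => H pi V Phi N F u; apply: inner_ext => w.
by rewrite (rep_starl F) !(rep_gen F) !(nica_V0 N) (pi_star N) star_cone.
Qed.

(** The action of [Phi cone] is not given by the generators, so [tnp_eq] cannot be applied directly.
    The elements fixed by [io cone] on both sides form a closed star-subalgebra containing the
    generators, hence they include [cone]; both sides are needed for stability under [star]. *)
Lemma io_cone : io cone = cone.
Proof.
have lipl d b c : rnorm (d ** b - d ** c) <= rnorm d * rnorm (b - c).
  by rewrite -cmulBr; exact: rnorm_cmul.
have lipr d b c : rnorm (b ** d - c ** d) <= rnorm d * rnorm (b - c).
  by rewrite -cmulBl mulrC; exact: rnorm_cmul.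
have lip1 b c : rnorm (b - c) <= 1 * rnorm (b - c) by rewrite mul1r.
have [] : [set b | io cone ** b = b] cone /\ [set b | b ** io cone = b] cone; last first.
  by rewrite /= cmul1r.
apply: (tnp_generated tnp (D := [set b | io cone ** b = b] `&` [set b | b ** io cone = b])).
- by apply: closedI; apply: closed_eq_lipschitz lip1; [exact: lipl | exact: lipr].
- move=> k b c [/= b1 b2] [/= c1 c2]; split=> /=.
    by rewrite cmul_linearr b1 c1.
  by rewrite cmul_linearl b2 c2.
- move=> b c [/= b1 b2] [/= c1 c2]; split=> /=; first by rewrite cmulA b1.
  by rewrite -cmulA c2.
- move=> b [/= b1 b2]; split=> /=; first by rewrite -star_io_cone -starM b2.
  by rewrite -star_io_cone -starM b1.
- move=> x a; split=> /=; apply: tnp_eq => H pi V Phi N F u;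
    rewrite (rep_mul F) !(rep_gen F) !(nica_V0 N).
    by rewrite (pi_cone_V N) (pi_cone N).
  by rewrite (pi_coner N).
Qed.

Lemma gen_factor x a : gen x a = v x ** io a.
Proof.
apply: tnp_eq => H pi V Phi N F u; rewrite (rep_mul F) !(rep_gen F) !(nica_V0 N).
by rewrite (pi_cone N).
Qed.

Lemma io_linear k a a' : io (k *: a + a') = k *: io a + io a'.
Proof.
apply: tnp_eq => H pi V Phi N F u; rewrite (rep_linear F) !(rep_gen F) !(nica_V0 N).
by rewrite (star_rep_linear (nica_rep N)).
Qed.

Lemma ioM a a' : io (a ** a') = io a ** io a'.
Proof.
apply: tnp_eq => H pi V Phi N F u; rewrite (rep_mul F) !(rep_gen F) !(nica_V0 N).
by rewrite (pi_mul N).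
Qed.

Lemma io_star a : io (star a) = star (io a).
Proof.
apply: tnp_eq => H pi V Phi N F u; apply: inner_ext => w.
by rewrite (rep_starl F) !(rep_gen F) !(nica_V0 N) (pi_star N) starK.
Qed.

Lemma v_isometry x : star (v x) ** v x = cone.
Proof.
rewrite -io_cone; apply: tnp_eq => H pi V Phi N F u; apply: inner_ext => w.
rewrite (rep_mul F) (rep_starl F) !(rep_gen F) (V_inner N) (nica_V0 N).
exact: pi_cone_inner N _ _.
Qed.

Lemma vD x y : v (x + y) = v x ** v y.
Proof.
apply: tnp_eq => H pi V Phi N F u; rewrite (rep_mul F) !(rep_gen F) (nica_VD N).
by rewrite (pi_cone_V N) (pi_cone N).
Qed.

Lemma io_v a x : io a ** v x = v x ** io (alpha x a).
Proof.
apply: tnp_eq => H pi V Phi N F u; rewrite !(rep_mul F) !(rep_gen F) !(nica_V0 N).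
by rewrite (pi_V N) (pi_coner N) (pi_cone N).
Qed.

Lemma star_v_io a x : star (v x) ** io a = io (alpha x a) ** star (v x).
Proof.
have := congr1 star (io_v (star a) x); rewrite !starM -!io_star starK => ->.
by rewrite (star_hom_star (dynsys_hom dyn x)) starK.
Qed.

Lemma star_v_v_generator i j : i != j ->
  star (v (generator i)) ** v (generator j) = v (generator j) ** star (v (generator i)).
Proof.
move=> ij; apply: tnp_eq => H pi V Phi N F u; rewrite !(rep_mul F) !(rep_gen F).
have [|Vi adj comm] := nica_commute N (i := j) (j := i); first by rewrite eq_sym.
rewrite !(rep_star_generator N F _ adj) (pi_cone_V N) (pi_cone N).
by rewrite (adjoint_pi_cone N _ adj) (pi_cone N) comm.
Qed.

Lemma star_v_v i x : x i = 0%N -> star (v (generator i)) ** v x = v x ** star (v (generator i)).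
Proof.
elim/Zn_ind: x => [|x j IH]; first by rewrite io_cone cmul1r cmul1l.
rewrite ffunE => /eqP; rewrite [(_ + _)%R]/(_ + _)%N addn_eq0 ffunE => /andP[/eqP xi ij].
have ij' : i != j by move: ij; case: (i == j).
by rewrite vD cmulA IH // -cmulA star_v_v_generator // cmulA.
Qed.

Local Notation W := (VaV gen).

Lemma VaVE x a y : W x a y = v x ** io a ** star (v y).
Proof. by []. Qed.

Lemma VaV00 a : W 0 a 0 = io a.
Proof. by rewrite VaVE io_cone star_cone cmul1l cmul1r. Qed.

Lemma VaV_star x a y : star (W x a y) = W y (star a) x.
Proof. by rewrite !VaVE !starM starK io_star cmulA. Qed.

Lemma VaV_left x a y : W x a y = v x ** W 0 a y.
Proof. by rewrite !VaVE io_cone cmul1l cmulA. Qed.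

Lemma v_VaV x y a z : v x ** W y a z = W (x + y) a z.
Proof. by rewrite !VaVE vD !cmulA. Qed.

Lemma io_VaV a x a' y : io a ** W x a' y = W x (alpha x a ** a') y.
Proof. by rewrite !VaVE !cmulA io_v ioM !cmulA. Qed.

(** If [x i = 0], the adjoint passes through [v x] by the Nica relation, turns [a] into
    [alpha (generator i) a] and joins the right factor; otherwise it cancels one factor of [v x]. *)
Lemma star_v_VaV i x a y : exists x' a' y', star (v (generator i)) ** W x a y = W x' a' y'.
Proof.
have [xi|xi] := posnP (x i).
  exists x, (alpha (generator i) a), (y + generator i).
  rewrite !VaVE vD starM !cmulA star_v_v // -2!cmulA [star _ ** (_ ** _)]cmulA.
  by rewrite star_v_io !cmulA.
pose x' : Zn := [ffun j => (x j - (j == i))%N]; exists x', a, y.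
have -> : x = generator i + x'.
  apply/ffunP => j; rewrite !ffunE -[RHS]/((j == i) + (x j - (j == i)))%N subnKC //.
  by case: eqVneq => [->|].
by rewrite -v_VaV cmulA v_isometry cmul1l.
Qed.

Lemma VaV_sqn x a y : star (W x a y) ** W x a y = W y (star a ** a) y.
Proof.
rewrite VaV_star !VaVE -!cmulA [star (v x) ** _]cmulA v_isometry cmul1l.
by rewrite ioM !cmulA.
Qed.

(* The closed linear span L of the V_x a V_y^* absorbs left multiplication by
   V_i, a and V_i^*, hence by everything in L. *)
Lemma tnp_span (D : set NT) : closed D ->
  (forall (k : R[i]) b c, D b -> D c -> D (k *: b + c)) ->
  (forall x a y, D (W x a y)) -> forall b, D b.
Proof.
pose lin (D : set NT) := forall (k : R[i]) b c, D b -> D c -> D (k *: b + c).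
pose good D := [/\ closed D, lin D & forall x a y, D (W x a y)].
(* Being the smallest good set, [L] lies in every good set; this is used for several auxiliary sets
   below. *)
pose L : set NT := \bigcap_(D in [set D | good D]) D.
suff LT : forall b, L b by move=> cD lD WD b; apply: (LT b D).
have goodL : good L.
  split; first by apply: closed_bigI => D' [].
    by move=> k b c Lb Lc D' gD'; have [_ l _] := gD'; apply: l; [exact: Lb|exact: Lc].
  by move=> x a y D' [].
have [cL lL WL] := goodL.
have Lmin D' b : good D' -> L b -> D' b by move=> gD'; exact.
have lipl d b c : rnorm (d ** b - d ** c) <= rnorm d * rnorm (b - c).
  by rewrite -cmulBr; exact: rnorm_cmul.
have lipr d b c : rnorm (b ** d - c ** d) <= rnorm d * rnorm (b - c).
  by rewrite -cmulBl mulrC; exact: rnorm_cmul.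
pose M : set NT := [set d | forall b, L b -> L (d ** b)].
have MW d : (forall x a y, L (d ** W x a y)) -> M d.
  move=> dW b; apply: (Lmin [set b | L (d ** b)]); split=> //.
    exact: (closed_preimage_lipschitz (lipl d)).
  by move=> k b1 b2 /= L1 L2; rewrite cmul_linearr; exact: lL.
have MM c d : M c -> M d -> M (c ** d) by move=> Mc Md b Lb; rewrite -cmulA; apply: Mc; exact: Md.
have Mv x : M (v x) by apply: MW => y a z; rewrite v_VaV; exact: WL.
have Mio a : M (io a) by apply: MW => y a' z; rewrite io_VaV; exact: WL.
have Msv x : M (star (v x)).
  elim/Zn_ind: x => [|x i IH]; first by rewrite io_cone star_cone => b; rewrite cmul1l.
  rewrite vD starM; apply: MM => //; apply: MW => y a z.
  by have [x' [a' [y' ->]]] := star_v_VaV i y a z; exact: WL.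
(* The left multipliers [M] of [L] form a good set themselves, so they contain [L], which is
   therefore closed under products. *)
have LM b : L b -> M b.
  move=> Lb; have gM : good M.
    split; last by move=> x a y; rewrite VaVE; apply: (MM _ _ (MM _ _ (Mv x) (Mio a)) (Msv y)).
      have -> : M = \bigcap_(d in L) [set c | L (c ** d)] by apply/seteqP; split.
      by apply: closed_bigI => d _; exact: (closed_preimage_lipschitz (lipr d)).
    by move=> k c d Mc Md b' Lb'; rewrite cmul_linearl; apply: lL; [exact: Mc|exact: Md].
  exact: Lb M gM.
move=> b; apply: (tnp_generated tnp cL lL) => [c d Lc Ld|c|x a].
- exact: LM.
- apply: (Lmin [set b | L (star b)]); split=> [|k b1 b2 /= L1 L2|x a y /=].
  + apply: (@closed_preimage_lipschitz _ _ _ _ 1) => // b1 b2.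
    by rewrite -starB rnorm_star mul1r.
  + by rewrite star_semilinear; exact: lL.
  + by rewrite VaV_star.
- have := WL x a 0; rewrite VaVE io_cone star_cone cmul1r -gen_factor.
  exact.
Qed.

End Relations.

(** * Ground states *)

Section ExponentialPowers.
Variable R : realType.
Implicit Types z : R[i].

Lemma cexpN z : cexp (- z) = (cexp z)^-1.
Proof.
have zN : cexp z * cexp (- z) = 1 by rewrite -cexpD subrr cexp0.
have z0 : cexp z != 0 by apply: contra_eq_neq zN => ->; rewrite mul0r eq_sym oner_neq0.
by apply: (mulfI z0); rewrite zN mulfV.
Qed.

Lemma cexpMn z k : cexp z ^+ k = cexp (k%:R * z).
Proof.
elim: k => [|k IH]; first by rewrite expr0 mul0r cexp0.
by rewrite exprS IH -cexpD -natr1 mulrDl mul1r addrC.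
Qed.

Lemma cexp_exprz z (m : int) : cexp z ^ m = cexp (m%:~R * z).
Proof.
case: m => k; first by rewrite -exprnP cexpMn -pmulrn.
by rewrite NegzE -exprnN cexpMn -cexpN mulrNz mulNr -pmulrn.
Qed.

Lemma cexp_sum (I : finType) (F : I -> R[i]) : \prod_i cexp (F i) = cexp (\sum_i F i).
Proof. by elim/big_rec2: _ => [|i y w _ ->]; rewrite ?cexp0 // cexpD. Qed.

End ExponentialPowers.

Lemma derivable_bounded_linear (R : realType) (V W : normedModType R[i]) (F : R[i]^o -> V)
    (L : V -> W) (c : R) (z : R[i]^o) :
  linear L -> (forall v, rnorm (L v) <= c * rnorm v) -> derivable F z 1 ->
  derivable (fun w => L (F w)) z 1.
Proof.
move=> linL Lc dF; have : is_derive z 1 F ('D_1 F z) by split.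
move: ('D_1 F z) => l /derivable_rnormP H.
suff : is_derive z 1 (fun w => L (F w)) (L l) by case.
have LD u v : L (u + v) = L u + L v by have := linL 1 u v; rewrite !scale1r.
have L0 : L 0 = 0 by apply: (addIr (L 0)); rewrite -LD !add0r.
have LZ k v : L (k *: v) = k *: L v by have := linL k v 0; rewrite L0 !addr0.
have LB u v : L (u - v) = L u - L v by rewrite LD -scaleN1r LZ scaleN1r.
apply/derivable_rnormP => e e0; have c0 : 0 < 1 + `|c| by rewrite ltr_pwDl.
have [d d0 dP] := H _ (divr_gt0 e0 c0); exists d => // h /dP hd.
rewrite -LZ -!LB; apply: le_trans (Lc _) _.
apply: (@le_trans _ _ ((1 + `|c|) * rnorm (F (h + z) - F z - h *: l))).
  rewrite ler_wpM2r ?rnorm_ge0 //; apply: le_trans (ler_norm c) _.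
  by rewrite lerDr.
by move: hd; rewrite -(ler_pM2l c0) mulrA mulrCA divff ?mulr1 ?gt_eqF.
Qed.

Lemma denseP_rnorm (R : realType) (V : normedModType R[i]) (D : set V) :
  dense D <-> forall b (e : R), 0 < e -> exists2 c, D c & rnorm (b - c) < e.
Proof.
split=> [dD b e e0|H O [b Ob] oO].
  have e0' : 0 < e%:C by rewrite ltcR.
  have := dD ((ball b e%:C)°); case.
  - exists b; exact: (nbhsx_ballx b _ e0').
  - exact: open_interior.
  move=> c [/interior_subset]; rewrite -ball_normE /ball_ /= rnormE ltcR.
  by exists c.
have /nbhs_ballP[e /= e0 eO] : nbhs b O by exact: open_nbhs_nbhs.
have e1 : 0 < complex.Re e by move: e0; rewrite ltcE => /andP[].
have eE : (complex.Re e)%:C = e.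
  by move: e0; rewrite ltcE; case: (e) => p r /= /andP[/eqP -> _].
have [c Dc bc] := H b _ e1; exists c; split=> //; apply: eO.
by rewrite -ball_normE /ball_ /= rnormE -eE ltcR.
Qed.

Section GroundStates.
Variables (R : realType) (n : nat) (A : unitalCStarAlgType R).
Local Notation Zn := {ffun 'I_n -> nat}.
Variables (alpha : Zn -> A -> A) (NT : unitalCStarAlgType R) (gen : Zn -> A -> NT).
Variables (gamma : ('I_n -> R[i]) -> NT -> NT) (lambda : 'I_n -> R).
Hypotheses (dyn : unital_dynamical_system alpha) (tnp : is_toeplitz_nica_pimsner alpha gen).
Hypotheses (gauge : is_gauge_action gen gamma) (lambda_gt0 : forall i, 0 < lambda i).
Implicit Types (x y : Zn) (a : A) (b c d : NT) (psi : NT -> R[i]).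
Local Notation W := (VaV gen).
Local Notation sigma := (gauge_flow gamma lambda).
Local Notation C := (R[i]^o).
Local Notation nm z := (rnorm (z : R[i]^o)).

Definition weight x y : R := \sum_i lambda i * ((x i)%:R - (y i)%:R).

Lemma torus_exp (t : R) : torus (fun i => cos (lambda i * t) +i* sin (lambda i * t)).
Proof.
move=> i; rewrite [_ +i* _](_ : _ = cexp (Complex 0 (lambda i * t))); last first.
  by rewrite /cexp /= expR0 !mul1r.
by rewrite (rnormE (cexp _ : C)) rnorm_cexp expR0.
Qed.

Lemma flow_aut t : star_automorphism (sigma t).
Proof. exact: (gauge_aut gauge (torus_exp t)). Qed.

Lemma flow_VaV t x a y : sigma t (W x a y) = cexp (Complex 0 (weight x y) * t%:C) *: W x a y.
Proof.
rewrite /gauge_flow (gaugeE gauge (torus_exp t)); congr (_ *: _).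
under eq_bigr => i _.
  rewrite (_ : _ +i* _ = cexp (Complex 0 (lambda i * t))); last first.
    by rewrite /cexp /= expR0 !mul1r.
  rewrite cexp_exprz; over.
rewrite cexp_sum; congr cexp.
rewrite (_ : Complex 0 _ * t%:C = Complex 0 (weight x y * t)); last first.
  by apply/eqP; rewrite eq_complex /=; apply/andP; split; apply/eqP; ring.
have -> : Complex 0 (weight x y * t) = 'i * (weight x y)%:C * t%:C.
  by apply/eqP; rewrite eq_complex /=; apply/andP; split; apply/eqP; ring.
rewrite /weight rmorph_sum mulr_sumr mulr_suml; apply: eq_bigr => i _.
rewrite intrB rmorphM rmorphB /= !rmorph_nat -!pmulrn.
rewrite (_ : Complex 0 _ = 'i * (lambda i)%:C * t%:C); last first.
  by apply/eqP; rewrite eq_complex /=; apply/andP; split; apply/eqP; ring.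
ring.
Qed.

Lemma weight0l_lt0 y : y != 0 -> weight 0 y < 0.
Proof.
move=> y0; have [i yi] : exists i, (0 < y i)%N.
  apply: contrapT => /forallNP H; case/eqP: y0; apply/ffunP => i; rewrite ffunE.
  by apply/eqP; rewrite -leqn0 leqNgt; apply/negP; exact: H.
rewrite /weight (bigD1 i) //=; apply: ltr_wnDr.
  apply: sumr_le0 => j _; rewrite ffunE sub0r mulrN oppr_le0.
  by apply: mulr_ge0 => //; exact: ltW.
by rewrite ffunE sub0r mulrN oppr_lt0; apply: mulr_gt0 => //; rewrite ltr0n.
Qed.

Lemma weight0r_ge0 x : 0 <= weight x 0.
Proof.
apply: sumr_ge0 => j _; rewrite ffunE subr0.
by apply: mulr_ge0 => //; exact: ltW.
Qed.

Lemma aut_cone (theta : NT -> NT) : star_automorphism theta -> theta cone = cone.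
Proof.
move=> [hom [theta' K K']].
by rewrite -[LHS]cmul1r -[X in _ ** X]K' -(star_homM hom) cmul1l K'.
Qed.

Lemma state_aut (theta : NT -> NT) psi : star_automorphism theta -> is_state psi ->
  is_state (psi \o theta).
Proof.
move=> aut [psiL psiP psi1]; have [hom _] := aut; split=> [k b c|b|] /=.
- by rewrite (star_hom_linear hom) psiL.
- by rewrite (star_homM hom) (star_hom_star hom).
- by rewrite aut_cone.
Qed.

(** Since [psi \o theta] is again a state, the factor [psi (theta (star d ** d))] is bounded by
    [rnorm d ^+ 2]; the bound is the same for all automorphisms. *)
Lemma state_aut_le (theta : NT -> NT) psi c d : star_automorphism theta -> is_state psi ->
  nm (psi (c ** theta d)) <= rnorm c * rnorm d.
Proof.
move=> aut st; rewrite -(@ler_pXn2r _ 2) ?nnegrE ?rnorm_ge0 ?mulr_ge0 ?rnorm_ge0 //.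
have := state_CS (theta d) (star c) st; rewrite starK => /le_trans; apply.
rewrite exprMn mulrC; apply: ler_pM.
- have := sqn_ge0 (semi_inner_functional (state_positive_functional st)) (star c).
  by rewrite /sqn starK.
- exact: (sqn_ge0 (semi_inner_functional (state_positive_functional st)) (theta d)).
- have := state_sqn_le (star c) st; rewrite rnorm_star starK; exact.
- have [hom _] := aut; rewrite -(star_hom_star hom) -(star_homM hom).
  exact: (state_sqn_le d (state_aut aut st)).
Qed.

Lemma id_aut : star_automorphism (fun b : NT => b).
Proof. by split; [split | exists id]. Qed.

Lemma state_mul_le psi c d : is_state psi -> nm (psi (c ** d)) <= rnorm c * rnorm d.
Proof. exact: (@state_aut_le (fun b => b) psi c d id_aut). Qed.

Lemma state_lipschitz psi b c : is_state psi ->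
  rnorm (psi b - psi c : C) <= 1 * rnorm (b - c).
Proof.
move=> st; rewrite mul1r -(functionalB (state_positive_functional st)); exact: state_le.
Qed.

Lemma derivable_state psi c (F : C -> NT) (z : C) : is_state psi -> derivable F z 1 ->
  derivable (fun w => psi (c ** F w) : C) z 1.
Proof.
move=> st; apply: (derivable_bounded_linear (L := fun b => psi (c ** b) : C) (c := rnorm c)) => [k u v|v].
  by rewrite cmul_linearr (state_linear st).
exact: state_mul_le.
Qed.

Lemma cexp_Im_ge0 (s : R) (z : R[i]) : nm (cexp (Complex 0 s * z)) = expR (- (s * complex.Im z)).
Proof. by rewrite rnorm_cexp; case: z => p r /=; rewrite mul0r sub0r. Qed.

Lemma derivable_cexp_line (s : R) (z : C) : derivable (fun w : C => cexp (Complex 0 s * w) : C) z 1.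
Proof.
have daff w : derivable (fun w : C => Complex 0 s * w : C) w 1.
  have := @derivable_affineC R (Complex 0 s) 0 w.
  rewrite (_ : (fun w : C => _ + 0) = (fun w : C => Complex 0 s * w : C)) //.
  by apply/funext => w'; rewrite addr0.
exact: (derivable_compC (@derivable_cexp R) daff).
Qed.

Lemma ground_vanish psi c x a y : ground_state sigma psi -> weight x y < 0 ->
  psi (c ** W x a y) = 0.
Proof.
move=> [st [D [/denseP_rnorm dD Dan DM]]] s0; set s := weight x y in s0; set b := W x a y.
have pos := state_positive_functional st.
apply: (@rnorm_eq0 R C); apply/eqP; rewrite eq_le rnorm_ge0 andbT.
apply/ler_addgt0Pr => e e0; rewrite add0r.
have n0 : 0 < 2 + rnorm b + rnorm c by rewrite -addrA ltr_pwDl // addr_ge0 ?rnorm_ge0.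
(* The error is at most [rnorm (c' - c) * rnorm b' + rnorm c * rnorm (b' - b)], and [dl <= 1] gives
   [rnorm b' <= rnorm b + 1]. *)
pose dl := Num.min 1 (e / (2 + rnorm b + rnorm c)).
have dl0 : 0 < dl by rewrite lt_min ltr01 divr_gt0.
have dl1 : dl <= 1 by rewrite ge_min lexx.
have dle : dl * (2 + rnorm b + rnorm c) <= e by rewrite -ler_pdivlMr // ge_min lexx orbT.
have [c' Dc' cc'] := dD c _ dl0; have [b' Db' bb'] := dD b _ dl0.
have [F Fext] := Dan _ Db'; have [M MP] := DM _ _ Dc' Db' F Fext.
have [FR dF] := Fext.
(* The factor cancels the phase of the flow on [b] along the real line, and as [s < 0] its modulus
   decays upwards. *)
pose g : C -> C := fun z => psi (c' ** F z) * cexp (Complex 0 (- s) * z).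
have dg z : derivable g z 1.
  apply: (@derivable_mulC _ (fun z => psi (c' ** F z) : C)) => w.
    exact: derivable_state.
  exact: derivable_cexp_line.
have s0' : 0 < - s by rewrite oppr_gt0.
have M0 : 0 <= `|complex.Re M| by [].
apply: (@mean_value_bound _ g _ (- s) `|complex.Re M| e dg s0' M0 (ltW e0)) => [z z0|t].
  rewrite /g rnormM cexp_Im_ge0 ler_wpM2r ?expR_ge0 //.
  apply: le_trans (ler_norm _); have := MP z z0; rewrite (rnormE (psi _ : C)) lecE /=.
  by case/andP.
have -> : g t%:C - psi (c ** b) = (psi (c' ** sigma t b') - psi (c ** sigma t b)) * cexp (Complex 0 (- s) * t%:C).
  rewrite /g FR mulrBl flow_VaV cmulZr (functionalZ pos) mulrAC -cexpD.
  rewrite (_ : Complex 0 s * _ + _ = 0) ?cexp0 ?mul1r //.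
  by apply/eqP; rewrite eq_complex /=; apply/andP; split; apply/eqP; ring.
rewrite rnormM cexp_Im_ge0 mulr0 oppr0 expR0 mulr1.
have homt := (flow_aut t).1.
have linB u w : sigma t (u - w) = sigma t u - sigma t w.
  by rewrite addrC -scaleN1r (star_hom_linear homt) scaleN1r addrC.
have -> : psi (c' ** sigma t b') - psi (c ** sigma t b) =
    psi ((c' - c) ** sigma t b') + psi (c ** sigma t (b' - b)).
  by rewrite linB cmulBl cmulBr !(functionalB pos) addrA subrK.
apply: le_trans (rnormD _ _) _.
have := state_aut_le (c' - c) b' (flow_aut t) st.
have := state_aut_le c (b' - b) (flow_aut t) st.
have h1 : rnorm b' <= rnorm b + rnorm (b' - b) by rewrite -{1}[b'](subrK b) addrC; exact: rnormD.
move: cc' bb' h1; rewrite (rnormB c) (rnormB b).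
have := rnorm_ge0 b'; have := rnorm_ge0 c; have := rnorm_ge0 b; have := rnorm_ge0 (c' - c);
  have := rnorm_ge0 (b' - b).
move: (rnorm (b' - b)) (rnorm (c' - c)) (rnorm b) (rnorm c) (rnorm b') dle => p r B' C' B1 dle.
move: (nm _) (nm _) => X Y p0 r0 B0 C0 b0' h1 h2 h3 h4 h5.
have : r * B1 <= dl * (B' + 1) by apply: ler_pM; lra.
have : C' * p <= C' * dl by rewrite ler_wpM2l // ltW.
nra.
Qed.

Definition vacuum_form psi (tau : A -> R[i]) := forall a x y,
  psi (W x a y) = if (x == 0) && (y == 0) then tau a else 0.

Lemma io_state psi : is_state psi -> is_state (fun a => psi (W 0 a 0)).
Proof.
move=> [psiL psiP psi1]; split=> [k a a'|a|]; rewrite !(VaV00 dyn tnp).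
- by rewrite (io_linear tnp) psiL.
- by rewrite (ioM tnp) (io_star tnp).
- by rewrite (io_cone dyn tnp).
Qed.

Lemma ground_vacuum_form psi : ground_state sigma psi ->
  exists2 tau : A -> R[i], is_state tau & vacuum_form psi tau.
Proof.
move=> gr; have [st _] := gr; exists (fun a => psi (W 0 a 0)); first exact: io_state.
(* [weight x y] may have either sign; moving [V_x] into the left factor leaves [weight 0 y], which
   is negative. *)
have right0 x a y : y != 0 -> psi (W x a y) = 0.
  by move=> y0; rewrite (VaV_left dyn tnp); apply: ground_vanish gr _; exact: weight0l_lt0.
move=> a x y; have [->|y0] := eqVneq y 0; last by rewrite andbF right0.
rewrite andbT; have [->|x0] := eqVneq x 0; first by [].
have := right0 0 (star a) x x0; rewrite -(VaV_star tnp).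
rewrite (functional_star (state_positive_functional st)).
by move=> /eqP; rewrite conjc_eq0 => /eqP.
Qed.

Lemma entire_extension_unique psi c b F G : is_state psi ->
  entire_extension sigma b F -> entire_extension sigma b G ->
  forall z : R[i], 0 < complex.Im z -> psi (c ** F z) = psi (c ** G z).
Proof.
move=> st [FR dF] [GR dG] z z0; apply/eqP; rewrite -subr_eq0; apply/eqP.
have dh w : derivable (fun w : C => psi (c ** F w) - psi (c ** G w) : C) w 1.
  have h1 := @derivable_state psi c F w st (dF w).
  have h2 := @derivable_state psi c G w st (dG w).
  exact: (derivableB h1 h2).
by apply: (entire_eq0 dh _ z0) => t; rewrite FR GR subrr.
Qed.

Lemma vacuum_form_ground psi tau : is_state psi -> vacuum_form psi tau -> ground_state sigma psi.
Proof.
move=> st vac; split=> //; have pos := state_positive_functional st.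
have right0 c x a y : y != 0 -> psi (c ** W x a y) = 0.
  move=> y0; have := state_CS (W x a y) (star c) st; rewrite starK (VaV_sqn dyn tnp) vac.
  rewrite (negbTE y0) andbF /= mul0r => h; apply: (@rnorm_eq0 R C); apply/eqP.
  by rewrite -sqrf_eq0 eq_le h sqr_ge0.
(* The bound, for one extension [F] and every [c], is built into [D], so that [D] is stable under
   linear combinations. *)
pose D : set NT := [set b | exists2 F, entire_extension sigma b F &
  forall c : NT, exists M : R, forall z : R[i], 0 < complex.Im z -> nm (psi (c ** F z)) <= M].
have DL k b c : D b -> D c -> D (k *: b + c).
  move=> [F [FR dF] FM] [G [GR dG] GM]; exists (fun z => k *: F z + G z).
    split=> [t|z]; first by rewrite FR GR (star_hom_linear (flow_aut t).1).
    apply: (@derivableD _ _ _ (fun w => k *: F w) G); last exact: dG.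
    apply: (derivable_bounded_linear (L := fun v => k *: v) (c := nm k)) => [l u v|v|].
    + by rewrite scalerDr !scalerA mulrC.
    + by rewrite rnormZ.
    + exact: dF.
  move=> a; have [M MP] := FM a; have [M' MP'] := GM a; exists (nm k * M + M') => z z0.
  rewrite cmul_linearr pos.1; apply: le_trans (rnormD _ _) _; rewrite rnormM.
  by apply: lerD; [rewrite ler_wpM2l ?rnorm_ge0 ?MP | exact: MP'].
have DW x a y : D (W x a y).
  exists (fun z => cexp (Complex 0 (weight x y) * z) *: W x a y).
    split=> [t|z]; first by rewrite flow_VaV.
    apply: (derivable_bounded_linear (L := fun k : C => k *: W x a y) (c := rnorm (W x a y))) => [k u v|v|].
    - by rewrite scalerDl scalerA.
    - by rewrite rnormZ mulrC.
    - exact: derivable_cexp_line.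
  move=> c; exists (rnorm c * rnorm (W x a y)) => z z0.
  rewrite cmulZr (functionalZ pos) rnormM cexp_Im_ge0.
  have [y0|y0] := eqVneq y 0; last first.
    by rewrite right0 // rnorm0 mulr0 mulr_ge0 ?rnorm_ge0.
  apply: le_trans (state_mul_le c (W x a y) st); rewrite ler_piMl ?rnorm_ge0 //.
  rewrite -expR0 ler_expR oppr_le0 mulr_ge0 ?(ltW z0) //.
  by rewrite y0; exact: weight0r_ge0.
exists D; split=> [|b [F FE _]|a b _ [F FE FM] G GE]; last 2 first.
- by exists F.
- have [M MP] := FM a; exists M%:C => z z0.
  rewrite (entire_extension_unique a st GE FE z0) (rnormE (psi _ : C)) lecR.
  exact: MP.
apply/denseP_rnorm => b.
(* The closure of [D] is a closed subspace containing every [W x a y]. *)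
apply: (tnp_span dyn tnp (D := [set b | forall e : R, 0 < e -> exists2 c, D c & rnorm (b - c) < e])).
- apply/closed_rnormP => b' H e e0; have e2 : 0 < e / 2 by rewrite divr_gt0.
  have [c Hc bc] := H _ e2; have [d Dd cd] := Hc _ e2; exists d => //.
  by have := rnormD (b' - c) (c - d); rewrite addrA subrK; lra.
- move=> k b1 b2 H1 H2 e e0; have n0 : 0 < 2 * (1 + nm k) by rewrite mulr_gt0 // ltr_pwDl // rnorm_ge0.
  have [c1 D1 bc1] := H1 _ (divr_gt0 e0 n0).
  have e2 : 0 < e / 2 by rewrite divr_gt0.
  have [c2 D2 bc2] := H2 _ e2; exists (k *: c1 + c2); first exact: DL.
  rewrite opprD addrACA -scalerBr; apply: le_lt_trans (rnormD _ _) _; rewrite rnormZ.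
  move: bc1; rewrite ltr_pdivlMr //; have := rnorm_ge0 (b1 - c1); have := rnorm_ge0 (k : C).
  nra.
- by move=> x a y e e0; exists (W x a y) => //; rewrite subrr rnorm0.
Qed.

Lemma vacuum_state_exists (tau : A -> R[i]) : is_state tau ->
  exists2 psi, is_state psi & vacuum_form psi tau.
Proof.
move=> st; have N := fock_nica dyn st; have [Phi F] := tnp_universal tnp N.
pose om := fock_vacuum n st; pose psi b := inner (Phi b om) om.
have Hs := hilbert_semi_inner (antidual (fock_semi_inner n st)).
(* For [x != 0] the range of [V_x] is orthogonal to the vacuum; for [x = 0] the operator is
   [fock_pi cone], the identity because each [alpha z] is unital. *)
have V_form u x : inner (Phi (gen x cone) u) om = if x == 0 then inner u om else 0.
  rewrite (rep_gen F); have [->|x0] := eqVneq x 0; last exact: inner_fock_V.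
  rewrite (nica_V0 N); congr (inner _ om).
  apply: antidualP => f; rewrite dual_extE; congr (val u _); apply: fockP => z.
  by rewrite fock_leftE star_cone (dynsys_unital dyn) cmul1l.
exists psi.
  split=> [k b c|b|]; rewrite /psi.
  - by rewrite (rep_linear F) (semi_innerDl Hs) (semi_innerZl Hs).
  - rewrite (rep_mul F) (rep_starl F); exact: (semi_inner_ge0 Hs).
  - by rewrite -(io_cone dyn tnp) (rep_gen F) (nica_V0 N) inner_fock_pi (state1 st).
have right0 x a y : psi (W x a y) = if x == 0 then inner (Phi (gen 0 a ** star (gen y cone)) om) om else 0.
  by rewrite /psi /VaV -cmulA (rep_mul F) V_form.
move=> a x y; rewrite right0; case: eqVneq => //= _.
rewrite (rep_mul F); have [->|y0] := eqVneq y 0.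
  rewrite (io_cone dyn tnp) star_cone -(rep_mul F) cmul1r (rep_gen F) (nica_V0 N).
  exact: inner_fock_pi.
(* Both factors move to the right-hand vector, which then lies in the range of [V_y], orthogonal to
   the vacuum. *)
rewrite -[a]starK (io_star tnp) (rep_starl F) (rep_starl F).
by rewrite (semi_innerC Hs) (rep_gen F) (inner_fock_V _ y0) conjc0.
Qed.

Lemma state_eq psi psi' : is_state psi -> is_state psi' ->
  (forall x a y, psi (W x a y) = psi' (W x a y)) -> psi = psi'.
Proof.
move=> st st' H; apply/funext.
apply: (tnp_span dyn tnp (D := [set b | psi b = psi' b])) => [|k b c /= h1 h2|x a y] //.
  by apply: (@closed_eq_lipschitz R NT C psi psi' 1 1) => b c; exact: state_lipschitz.
by rewrite (state_linear st) (state_linear st') h1 h2.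
Qed.

End GroundStates.

Lemma cvg_lincomb (K : numFieldType) (T : Type) (F : set_system T) {FF : Filter F}
    (f g : T -> K^o) (k u v : K^o) :
  f t @[t --> F] --> u -> g t @[t --> F] --> v -> k * f t + g t @[t --> F] --> k * u + v.
Proof. by move=> fu gv; exact: (cvgD (cvgZl_tmp (k := k) fu) gv). Qed.

(** * The map from states of [A] to ground states: affinity and continuity *)

Section StateSpaces.
Variables (R : realType) (n : nat) (A : unitalCStarAlgType R).
Local Notation Zn := {ffun 'I_n -> nat}.
Variables (alpha : Zn -> A -> A) (NT : unitalCStarAlgType R) (gen : Zn -> A -> NT).
Hypotheses (dyn : unital_dynamical_system alpha) (tnp : is_toeplitz_nica_pimsner alpha gen).
Local Notation W := (VaV gen).
Local Notation SA := [set tau : {ptws A -> R[i]^o} | is_state tau].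
Variable Psi : {ptws A -> R[i]^o} -> {ptws NT -> R[i]^o}.
Hypothesis PsiP : forall tau, SA tau -> is_state (Psi tau) /\ vacuum_form gen (Psi tau) tau.

Lemma is_state_convex (B : unitalCStarAlgType R) (s t : B -> R[i]) (r : R) :
  is_state s -> is_state t -> 0 <= r <= 1 ->
  is_state (fun b => r%:C * s b + (1 - r)%:C * t b).
Proof.
move=> [sL sP s1] [tL tP t1] /andP[r0 r1]; split=> [k b c|b|].
- by rewrite sL tL /=; ring.
- by rewrite addr_ge0 // mulr_ge0 ?lecR ?subr_ge0.
- by rewrite s1 t1 !mulr1 -rmorphD /= addrC subrK.
Qed.

Lemma vacuum_map_affine : affine_on SA Psi.
Proof.
move=> s t Ss St r r01 b; have [sst sv] := PsiP Ss; have [tst tv] := PsiP St.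
have [cst cv] := PsiP (is_state_convex Ss St r01).
apply: (congr1 (fun psi : NT -> R[i] => psi b)
  (state_eq dyn tnp cst (is_state_convex sst tst r01) _)) => x a y.
by rewrite cv sv tv; case: ifP => // _; rewrite !mulr0 addr0.
Qed.

Lemma within_nearS (tau : {ptws A -> R[i]^o}) : \forall s \near within SA (nbhs tau), SA s.
Proof. exact: withinT. Qed.

Lemma eval_cvg (T : topologicalType) (f : {ptws T -> R[i]^o}) (S : set {ptws T -> R[i]^o}) b :
  (g b : R[i]^o) @[g --> within S (nbhs f)] --> (f b : R[i]^o).
Proof. by move: b; apply/pointwise_cvgP; exact: cvg_within. Qed.

(** The [b] at which evaluation is continuous form a closed subspace: states are contractions, so
    approximating [b] costs an error uniform in the state, and an [e / 3] argument applies. On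
    [W x a y] the map is an evaluation of the given state or 0. *)
Lemma vacuum_map_continuous : {within SA, continuous Psi}.
Proof.
apply/subspace_continuousP => tau Stau; apply/pointwise_cvgP => b /=.
have [st vac] := PsiP Stau.
apply: (tnp_span dyn tnp (D := [set b |
  (Psi s b : R[i]^o) @[s --> within SA (nbhs tau)] --> (Psi tau b : R[i]^o)])) => {b} /=.
- apply/closed_rnormP => b H /=; apply/cvgrPdist_lt => e0 e0_gt0.
  have e_gt0 : 0 < complex.Re e0 by move: e0_gt0; rewrite ltcE => /andP[].
  have eE : (complex.Re e0)%:C = e0.
    by move: e0_gt0; rewrite ltcE; case: (e0) => p r /= /andP[/eqP -> _].
  rewrite -eE; move: (complex.Re e0) e_gt0 => e e_gt0 {e0 e0_gt0 eE}.
  have e3 : 0 < e / 3 by rewrite divr_gt0.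
  have [c /= Dc bc] := H _ e3.
  have e3C : 0 < (e / 3)%:C by rewrite ltcR.
  near=> s.
  have Ss : SA s by near: s; exact: within_nearS.
  have [sst svac] := PsiP Ss.
  have h1 := state_lipschitz b c st; have h2 := state_lipschitz c b sst.
  have h3 : rnorm (Psi tau c - Psi s c : R[i]^o) < e / 3.
    rewrite -ltcR -rnormE; near: s; exact: (cvgr_dist_lt _ _ Dc _ e3C).
  rewrite rnormE ltcR.
  have -> : Psi tau b - Psi s b =
    (Psi tau b - Psi tau c) + ((Psi tau c - Psi s c) + (Psi s c - Psi s b)).
    by ring.
  have := rnormD (Psi tau b - Psi tau c : R[i]^o) ((Psi tau c - Psi s c) + (Psi s c - Psi s b)).
  have := rnormD (Psi tau c - Psi s c : R[i]^o) (Psi s c - Psi s b).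
  move: h1 h2; rewrite (rnormB c b) !mul1r; lra.
- move=> k b c Db Dc; rewrite (state_linear st).
  apply: (@cvg_trans _ ((k * Psi s b + Psi s c : R[i]^o) @[s --> within SA (nbhs tau)])).
    apply: near_eq_cvg; near=> s.
    have Ss : SA s by near: s; exact: within_nearS.
    by rewrite (state_linear (PsiP Ss).1).
  have FF : Filter (within SA (nbhs tau)) by exact: within_filter.
  exact: (@cvg_lincomb R[i] _ _ FF (fun s => Psi s b) (fun s => Psi s c) k _ _ Db Dc).
- move=> x a y; rewrite vac.
  apply: (@cvg_trans _ ((if (x == 0) && (y == 0) then s a else 0 : R[i]^o) @[s --> within SA (nbhs tau)])).
    apply: near_eq_cvg; near=> s.
    have Ss : SA s by near: s; exact: within_nearS.
    by rewrite (PsiP Ss).2.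
  by case: ifP => _; [exact: eval_cvg | exact: cvg_cst].
Unshelve. all: by end_near.
Qed.

End StateSpaces.

Theorem proposition3p5 (R : realType) (n : nat) (A : unitalCStarAlgType R)
  (alpha : {ffun 'I_n -> nat} -> A -> A)
  (NT : unitalCStarAlgType R) (gen : {ffun 'I_n -> nat} -> A -> NT)
  (gamma : ('I_n -> R[i]) -> NT -> NT) (lambda : 'I_n -> R) :
  unital_dynamical_system alpha ->
  is_toeplitz_nica_pimsner alpha gen ->
  is_gauge_action gen gamma ->
  (forall i, 0 < lambda i) ->
  (forall psi : NT -> R[i], is_state psi ->
     (ground_state (gauge_flow gamma lambda) psi <->
      exists2 tau : A -> R[i], is_state tau &
        forall a x y, psi (VaV gen x a y) =
          if (x == 0) && (y == 0) then tau a else 0)) /\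
  (exists2 Psi : {ptws A -> R[i]^o} -> {ptws NT -> R[i]^o},
     affine_on [set tau : {ptws A -> R[i]^o} | is_state tau] Psi &
     homeomorphism_onto [set tau : {ptws A -> R[i]^o} | is_state tau]
       [set psi : {ptws NT -> R[i]^o} |
          ground_state (gauge_flow gamma lambda) psi] Psi).
Proof.
move=> dyn tnp gauge lambda_gt0; split=> [psi st|].
  split; first exact: ground_vacuum_form dyn tnp gauge lambda_gt0 _.
  by move=> [tau _]; exact: vacuum_form_ground dyn tnp gauge lambda_gt0 _ _ st.
(* [Psi] has to be total, so functions that are not states receive the value 0. *)
have ex (tau : {ptws A -> R[i]^o}) : exists psi : {ptws NT -> R[i]^o},
    is_state tau -> is_state psi /\ vacuum_form gen psi tau.
  have [st|nst] := pselect (is_state tau); last by exists 0.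
  by have [psi] := vacuum_state_exists dyn tnp st; exists psi.
have [Psi PsiP] := choice ex.
exists Psi; first exact: (vacuum_map_affine dyn tnp PsiP).
(* The inverse is restriction to the copy of [A]; it is continuous because each of its values is an
   evaluation of [psi]. *)
pose res (psi : {ptws NT -> R[i]^o}) : {ptws A -> R[i]^o} := fun a => psi (VaV gen 0 a 0).
have resK (tau : {ptws A -> R[i]^o}) : is_state tau -> res (Psi tau) = tau.
  by move=> st; apply/funext => a; rewrite /res (PsiP _ st).2 !eqxx.
split; last 2 first.
- exact: (vacuum_map_continuous dyn tnp PsiP).
- exists res => //; apply/subspace_continuousP => psi _; apply/pointwise_cvgP => a /=.
  exact: eval_cvg.
split=> [tau st|s t|psi gr] /=.
- by have [pst vac] := PsiP _ st; exact: (vacuum_form_ground dyn tnp gauge lambda_gt0 pst vac).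
- by rewrite !inE => ss tt eq_st; rewrite -(resK _ ss) eq_st resK.
- have [tau st vac] := ground_vacuum_form dyn tnp gauge lambda_gt0 gr.
  exists tau => //; have [pst pvac] := PsiP _ st.
  by apply: (state_eq dyn tnp pst gr.1) => x a y; rewrite pvac vac.
Qed.
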